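(* There exists $n_0$ such that for every $n\ge n_0$ and every integer $s$ with $1\le s\le (n-2)/3$ we have $$\mu_3(n,s)=\max\Big\{\binom n3-\binom{n-s}3\,,\ \binom{3s+2}3\Big\}.$$ Furthermore, for such $n$ and $s$, $\mathcal{M}_3(n,s)\subseteq \mathrm{Cov}_3(n,s)\cup \mathrm{Cl}_3(n,s)$.
   Context: A $k$-uniform hypergraph ($k$-graph) $G=(V,E)$ consists of a finite vertex set $V\subseteq\mathbb{N}$ and a family $E$ of $k$-element subsets of $V$ (edges). A matching is a family of pairwise disjoint edges; $\mu(G)$ is the size of a largest matching in $G$. Let $\mathcal{H}_k(n,s)$ be the set of all $k$-graphs $G=(V,E)$ with $|V|=n$ and $\mu(G)=s$; let $\mu_k(n,s)=\max\{|E(G)|: G\in\mathcal{H}_k(n,s)\}$ and $\mathcal{M}_k(n,s)=\{G\in\mathcal{H}_k(n,s): |E(G)|=\mu_k(n,s)\}$. $\mathrm{Cov}_k(n,s)$ is the family of $k$-graphs $G=(V,E)$ with $|V|=n$ such that for some $S\subseteq V$ with $|S|=s$, $E=\{e\subseteq V: |e|=k,\ e\cap S\neq\emptyset\}$. $\mathrm{Cl}_k(n,s)$ is the family of $k$-graphs $G=(V,E)$ with $|V|=n$ such that for some $T\subseteq V$ with $|T|=ks+k-1$, $E=\{e\subseteq T: |e|=k\}$ (a complete $k$-graph on $ks+k-1$ vertices plus isolated vertices). *)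

(* Defs.v *)
From mathcomp Require Import all_boot all_order.
From mathcomp Require Import finmap.
From Stdlib Require Import ClassicalEpsilon.
Set Implicit Arguments. Unset Strict Implicit. Unset Printing Implicit Defensive.
Local Open Scope fset_scope.

Record hgraph := HGraph { hV : {fset nat}; hE : {fset {fset nat}} }.

Definition kgraph (k : nat) (G : hgraph) : bool :=
  all (fun e => (e `<=` hV G) && (#|` e| == k)) (hE G).

Definition pairwise_disjoint (M : {fset {fset nat}}) : bool :=
  all (fun e1 => all (fun e2 => (e1 == e2) || (e1 `&` e2 == fset0)) M) M.

Definition matching (G : hgraph) (M : {fset {fset nat}}) : bool :=
  (M `<=` hE G) && pairwise_disjoint M.

Definition matching_number (G : hgraph) : nat :=
  \max_(M <- fpowerset (hE G) | pairwise_disjoint M) #|` M|.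

Definition Hk (k n s : nat) (G : hgraph) : Prop :=
  kgraph k G /\ #|` hV G| = n /\ matching_number G = s.

Definition is_max_edges (k n s m : nat) : Prop :=
  (exists G, Hk k n s G /\ #|` hE G| = m) /\
  (forall G, Hk k n s G -> #|` hE G| <= m).

(* mu_k(n,s) = max { |E(G)| : G in H_k(n,s) } (via classical choice;
   it is the actual maximum whenever that maximum exists). *)
Definition mu_k (k n s : nat) : nat :=
  epsilon (inhabits 0) (is_max_edges k n s).

Definition Mk (k n s : nat) (G : hgraph) : Prop :=
  Hk k n s G /\ #|` hE G| = mu_k k n s.

Definition Cov (k n s : nat) (G : hgraph) : Prop :=
  #|` hV G| = n /\
  exists S : {fset nat}, S `<=` hV G /\ #|` S| = s /\
    hE G = [fset e in fpowerset (hV G) | (#|` e| == k) && (e `&` S != fset0)].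

Definition Cl (k n s : nat) (G : hgraph) : Prop :=
  kgraph k G /\ #|` hV G| = n /\
  exists T : {fset nat}, T `<=` hV G /\ #|` T| = k * s + k - 1 /\
    hE G = [fset e in fpowerset T | #|` e| == k].

(* Main.v *)
(** Shifting reduces the problem to left-compressed families of triples on
    {0, ..., n-1} and the maximum is then found by induction on s.  If
    {0, 3s+1, 3s+2} is an edge, deleting the vertex 0 lowers the matching number
    and at most C(n-1, 2) edges are lost.  Otherwise every edge has at most one
    vertex above 3s, and the family is governed by the triples inside {0, ..., 3s-1}
    and by the pairs there that extend to a far away vertex X.  Take a matching of
    size s covering {0, ..., 3s-1}.  For three of its edges (a "window") let T be
    the number of triples of the family crossing them and P the number of crossing
    pairs that extend to X.  A finite check shows that either 15 T + 8 P <= 405 and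
    P <= 18, or the window carries, for some K, more than 3K edges (pairs being
    completed by fresh vertices) that use no vertex more than K times.  Many disjoint
    windows of the second kind would give a 6-fold matching of size noticeably above
    6s, and in a left-compressed family such a multiple matching can be rounded to
    a matching of size greater than s.  So almost all windows are of the first kind;
    summing over them gives, up to lower order terms, a linear trade-off between
    triples and pairs which puts the family strictly below the covering bound when
    n - 3s >= s/2, and otherwise either below the clique bound or so close to a
    clique that it is compared with it directly.

    The extremal configurations survive undoing a shift: the triples that could
    have been moved are two-coloured by whether they were, disjoint pairs in the
    relevant set receive equal colours since otherwise a matching of size s + 1
    appears, and the Kneser graph of pairs is connected. *)
Require Import Defs.
From mathcomp Require Import all_boot all_order all_fingroup.
From mathcomp Require Import finmap.
From mathcomp Require Import zify.
From Stdlib Require Import Classical ClassicalEpsilon.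
Set Implicit Arguments. Unset Strict Implicit. Unset Printing Implicit Defensive.

(** * Left-compressed families and their matchings *)

(** The weights 15 and 8 are dictated by the two extremal families. In a clique a window has T = 27
    and P = 0; in a cover with one vertex on each matching edge it has T = 27 - 8 = 19 and P = 3 * 5
    = 15. Both give 15 T + 8 P = 405. Put m = n - 3s. Summed over all windows, the trade-off values
    a far pair at 8s/15 triples, while it really yields about m edges. Cover and clique balance near
    m = 0.486s, and 0.486 < 1/2 < 8/15. From m = s/2 on, the cover is ahead because of its roughly s
    m^2 / 2 edges with two vertices beyond 3s, which the family under study lacks; this reserve
    absorbs all error terms. For m < s/2 the gap up to 8s/15 leaves a family as large as the clique
    almost no far pairs. The bound P <= 18 serves beyond m = 8s/15. A window violating the bounds
    may be improvable only fractionally, which is why multiplicities K > 1 and a rounding step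
    occur. Rounding costs a small fraction of s, so only many disjoint violations contradict the
    matching number. *)

Definition tri := (nat * nat * nat)%type.
Definition tv (t : tri) : seq nat := [:: t.1.1; t.1.2; t.2].
Definition verts (M : seq tri) : seq nat := flatten (map tv M).

Definition shifted_system (n : nat) (f : nat -> nat -> nat -> bool) : Prop :=
  (forall x y z, f x y z -> [&& x < y, y < z & z < n]) /\
  (forall x y z x' y' z', f x y z -> x' <= x -> y' <= y -> z' <= z ->
     x' < y' -> y' < z' -> f x' y' z').

(* The symmetric extension of [f]: sort the three vertices first. *)
Definition symm (f : nat -> nat -> nat -> bool) (a b c : nat) : bool :=
  let lo := minn a (minn b c) in
  let hi := maxn a (maxn b c) in
  f lo (a + b + c - lo - hi) hi.

Definition is_matching (f : nat -> nat -> nat -> bool) (M : seq tri) : bool :=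
  all (fun t => symm f t.1.1 t.1.2 t.2) M && uniq (verts M).

Definition matching_le (f : nat -> nat -> nat -> bool) (s : nat) : Prop :=
  forall M, is_matching f M -> size M <= s.

Definition cnt (f : nat -> nat -> nat -> bool) (n : nat) : nat :=
  \sum_(z < n) \sum_(y < z) \sum_(x < y) f x y z.

(** Sorting is monotone: lowering entries one by one lowers the sorted entries, so compression
    applies to unsorted triples. *)
Lemma symm_dom n f a b c a' b' c' : shifted_system n f -> symm f a b c ->
  a' <= a -> b' <= b -> c' <= c -> uniq [:: a'; b'; c'] -> symm f a' b' c'.
Proof.
move=> [Hv Hm] H Ha Hb Hc; rewrite /= !inE negb_or => U.
rewrite /symm in H *; have V := Hv _ _ _ H.
by apply: Hm H _ _ _ _ _; clear -V Ha Hb Hc U; lia.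
Qed.

Lemma symm_bound n f a b c : shifted_system n f -> symm f a b c ->
  [/\ a < n, b < n, c < n & uniq [:: a; b; c]].
Proof.
move=> [Hv Hm] H; have V := Hv _ _ _ H.
rewrite /= !inE negb_or; split; lia.
Qed.

Lemma symm_eq f x y z : x < y -> y < z -> symm f x y z = f x y z.
Proof.
move=> H1 H2; rewrite /symm.
have -> : minn x (minn y z) = x by lia.
have -> : maxn x (maxn y z) = z by lia.
by have -> : x + y + z - x - z = y by lia.
Qed.

Lemma symmC12 f a b c : symm f a b c = symm f b a c.
Proof. by rewrite /symm; congr f; lia. Qed.

Lemma symmC23 f a b c : symm f a b c = symm f a c b.
Proof. by rewrite /symm; congr f; lia. Qed.

Lemma verts_cat M1 M2 : verts (M1 ++ M2) = verts M1 ++ verts M2.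
Proof. by rewrite /verts map_cat flatten_cat. Qed.

Lemma verts_cons t M : verts (t :: M) = tv t ++ verts M.
Proof. by []. Qed.

Lemma size_verts M : size (verts M) = 3 * size M.
Proof. by elim: M => //= t M IH; rewrite IH; lia. Qed.

Lemma is_matching_cons f t M : is_matching f (t :: M) =
  [&& symm f t.1.1 t.1.2 t.2, uniq (tv t), ~~ has (mem (tv t)) (verts M) & is_matching f M].
Proof.
rewrite /is_matching verts_cons cat_uniq /=.
by case: (symm _ _ _ _); case: (all _ _); case: (uniq (verts M)) ; rewrite /= ?andbT ?andbF.
Qed.

Lemma nat_lt_index (A : seq nat) v : uniq A -> v \in A -> index v (sort leq A) <= v.
Proof.
move=> U vA; set B := sort leq A.
have sB : sorted ltn B by rewrite ltn_sorted_uniq_leq sort_uniq U sort_sorted //; exact: leq_total.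
have vB : v \in B by rewrite mem_sort.
have nthge : forall i, i < size B -> i <= nth 0 B i.
  elim=> [|i IH] Hi //.
  have := IH (ltnW Hi).
  have : nth 0 B i < nth 0 B i.+1.
    by apply: (sorted_ltn_nth ltn_trans 0 sB) => //; rewrite inE // ltnW.
  lia.
by have := nthge (index v B); rewrite index_mem => /(_ vB); rewrite nth_index.
Qed.

Definition tmap (h : nat -> nat) (t : tri) : tri := (h t.1.1, h t.1.2, h t.2).

Lemma verts_map h M : verts (map (tmap h) M) = map h (verts M).
Proof. by rewrite /verts map_flatten -!map_comp. Qed.

Lemma mem_verts t M v : t \in M -> v \in tv t -> v \in verts M.
Proof. by move=> tM vt; apply/flattenP; exists (tv t) => //; apply: map_f. Qed.

Lemma uniq_tv M t : uniq (verts M) -> t \in M -> uniq (tv t).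
Proof.
elim: M => // u M IH; rewrite verts_cons cat_uniq inE => /and3P[U1 _ U2] /orP[/eqP-> //|].
exact: IH.
Qed.

(* Replacing every vertex by its rank among the covered vertices only lowers
   vertices, so the result is again a matching. *)
Lemma compress n f M : shifted_system n f -> is_matching f M ->
  exists M', [/\ is_matching f M', size M' = size M &
    perm_eq (verts M') (iota 0 (3 * size M))].
Proof.
move=> Sf /andP[AM UM].
pose h v := index v (sort leq (verts M)).
exists (map (tmap h) M); rewrite size_map /is_matching verts_map.
have inj : {in verts M &, injective h}.
  move=> u v uM vM E; have := congr1 (nth 0 (sort leq (verts M))) E.
  by rewrite !nth_index ?mem_sort.
have Uh : uniq (map h (verts M)) by rewrite map_inj_in_uniq.
rewrite Uh andbT; split => //.
- rewrite all_map; apply/allP => t tM /=.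
  have /allP/(_ _ tM) E := AM.
  have [_ _ _ Ut] := symm_bound Sf E.
  have m1 : t.1.1 \in verts M by apply: (mem_verts tM); rewrite !inE eqxx.
  have m2 : t.1.2 \in verts M by apply: (mem_verts tM); rewrite !inE eqxx ?orbT.
  have m3 : t.2 \in verts M by apply: (mem_verts tM); rewrite !inE eqxx ?orbT.
  apply: (symm_dom Sf E); try exact: nat_lt_index.
  have := Ut; rewrite -[X in uniq X -> _]/(tv t) -[X in _ -> uniq X]/(map h (tv t)).
  rewrite map_inj_in_uniq // => u v ut vt; apply: inj; exact: (mem_verts tM).
- apply: uniq_perm (iota_uniq _ _) _ => //.
  apply: (uniq_min_size Uh _ _).2; last by rewrite size_iota size_map size_verts.
  move=> _ /mapP[v vM ->]; rewrite mem_iota add0n leq0n /h.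
  by rewrite -size_verts -(size_sort leq) index_mem mem_sort.
Qed.

(** * From multiple matchings to matchings *)

Lemma count_block B (d : nat) (A : seq nat) : 0 < B ->
  count (fun v => v %/ B == d) A <= \sum_(i < B) count_mem (d * B + i) A.
Proof.
move=> B0; elim: A => [|x A IH]; first by rewrite big1.
rewrite [X in X <= _]/= ; under eq_bigr do rewrite /=.
rewrite big_split /= leq_add //.
case: eqP => //= E; rewrite (bigD1 (Ordinal (ltn_pmod x B0))) //= -E -divn_eq eqxx.
by rewrite leq_addr.
Qed.

Lemma count_block_le B K d (A : seq nat) : 0 < B -> (forall v, count_mem v A <= K) ->
  count (fun v => v %/ B == d) A <= B * K.
Proof.
move=> B0 HK; apply: leq_trans (count_block d A B0) _.
rewrite -[B in B * K]card_ord -sum_nat_const; exact: leq_sum.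
Qed.

(** A value of multiplicity m is kept m %/ K times; this loses less than one copy per distinct
    value, whence the term [size (undup Q)]. *)
Lemma thin (T : eqType) (Q : seq T) K : 0 < K ->
  exists L : seq T, [/\ {subset L <= Q}, size Q <= K * (size L + size (undup Q)) &
    forall w : T -> nat, K * \sum_(x <- L) w x <= \sum_(x <- Q) w x].
Proof.
move=> K0; pose L := flatten [seq nseq (count_mem x Q %/ K) x | x <- undup Q].
have sumL (w : T -> nat) : \sum_(x <- L) w x = \sum_(x <- undup Q) (count_mem x Q %/ K) * w x.
  rewrite big_flatten big_map; apply: eq_bigr => x _.
  by rewrite big_nseq iter_addn_0 mulnC.
have sumQ (w : T -> nat) : \sum_(x <- Q) w x = \sum_(x <- undup Q) count_mem x Q * w x.
  rewrite -big_undup_iterop_count; apply: eq_bigr => x _.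
  by rewrite Monoid.iteropE iter_addn_0 mulnC.
exists L; split.
- by move=> x /flattenP[_ /mapP[y yQ ->]] /nseqP[-> _]; rewrite -mem_undup.
- rewrite -[size Q]muln1 -sum1_size mulnDr.
  have -> : size L = \sum_(x <- L) 1 by rewrite sum1_size.
  rewrite sumL sumQ muln1 -sum1_size big_distrr big_distrr /= -big_split /=.
  apply: leq_sum => x _; rewrite !muln1 {1}(divn_eq (count_mem x Q) K) mulnC leq_add2l.
  exact/ltnW/ltn_pmod.
- move=> w; rewrite sumL sumQ big_distrr /=; apply: leq_sum => x _.
  by rewrite mulnA leq_mul2r mulnC leq_divM orbT.
Qed.

(** Successive occurrences of d take successive places in block d - 1, which has room for B of them.
    The last clause is the induction invariant: the places taken in a block lie below the number of
    occurrences so far, so the next place is free. *)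
Lemma spread B (D : seq nat) : 0 < B -> (forall d, count_mem d D <= B) -> all (leq 1) D ->
  exists V, [/\ uniq V, all2 (fun v d => v < d * B) V D &
    forall v, v \in V -> v %% B < count_mem (v %/ B).+1 D].
Proof.
move=> B0; elim/last_ind: D => [|D d IH] HB; first by exists [::].
rewrite all_rcons => /andP[d0 HD].
have HB' d' : count_mem d' D <= B.
  by apply: leq_trans (HB d'); rewrite -cats1 count_cat leq_addr.
have [V [UV AV CV]] := IH HB' HD.
have cB : count_mem d D < B.
  by have := HB d; rewrite -cats1 count_cat /= eqxx addn0 addn1.
pose v := d.-1 * B + count_mem d D.
have vd : v %/ B = d.-1 by rewrite /v divnMDl // divn_small // addn0.
have vm : v %% B = count_mem d D by rewrite /v modnMDl modn_small.
exists (rcons V v); split.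
- rewrite rcons_uniq UV andbT; apply/negP => /CV; rewrite vm vd prednK // ltnn //.
- rewrite all2E in AV; case/andP: AV => /eqP sV AV.
  rewrite all2E !size_rcons sV eqxx /= zip_rcons // all_rcons AV andbT /= /v.
  move: cB; move: (count_mem d D) => c; case: (d) d0 => // d' _ /=; rewrite mulSn; lia.
- move=> u; rewrite mem_rcons inE => /orP[/eqP->|uV].
    by rewrite vm vd prednK // -cats1 count_cat /= eqxx addn0 addn1.
  by apply: leq_trans (CV u uV) _; rewrite -cats1 count_cat leq_addr.
Qed.

Lemma regroup (r : rel nat) V (L : seq tri) : all2 r V (verts L) ->
  exists2 M, verts M = V &
    all2 (fun t l => [&& r t.1.1 l.1.1, r t.1.2 l.1.2 & r t.2 l.2]) M L.
Proof.
elim: L V => [|l L IH] V; first by case: V => // _; exists [::].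
case: V => [|x [|y [|z V]]] //=; rewrite ?andbF //.
case/and4P=> rx ry rz /IH[M <- AM]; exists ((x, y, z) :: M) => //=.
by rewrite rx ry rz.
Qed.

(* Integrality gap: vertices are cut into blocks of length [B], the edges of
   the [K]-fold matching [Q] are sorted by the blocks they meet, and one in [K]
   edges of each kind is realised by vertices of the preceding blocks. *)
Lemma rounding n f K B Q : shifted_system n f -> 0 < K -> 0 < B ->
  all (fun t => symm f t.1.1 t.1.2 t.2) Q ->
  (forall v, count_mem v (verts Q) <= K) ->
  exists2 M, is_matching f M & size Q <= K * (size M + B + (n %/ B).+1 ^ 3).
Proof.
move=> Sf K0 B0 AQ CQ; pose ty := tmap (fun v => v %/ B).
pose low (t : tri) := has (fun v => v %/ B == 0) (tv t).
pose Q1 := filter (predC low) Q.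
(* Block 0 has no predecessor to move into. The edges meeting it are discarded; its B vertices lie
   on at most K edges each. *)
have sQ0 : size (filter low Q) <= B * K.
  apply: leq_trans (count_block_le 0 B0 CQ); rewrite size_filter.
  elim: (Q) => // t Q' IH; rewrite verts_cons count_cat [count low _]/= leq_add //.
  by rewrite /low /=; do 3 case: (_ == 0).
have [L [subL szL sumL]] := thin (map ty Q1) K0.
have szU : size (undup (map ty Q1)) <= (n %/ B).+1 ^ 3.
  set N := (n %/ B).+1.
  have -> : N ^ 3 = size [seq (p, c) | p <- [seq (a, b) | a <- iota 0 N, b <- iota 0 N], c <- iota 0 N].
    by rewrite !size_allpairs !size_iota; lia.
  apply: uniq_leq_size (undup_uniq _) _ => l; rewrite mem_undup => /mapP[t].
  rewrite mem_filter => /andP[_ tQ] ->.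
  have [b1 b2 b3 _] := symm_bound Sf (allP AQ _ tQ).
  by apply: allpairs_f; first apply: allpairs_f; rewrite mem_iota add0n /= ltnS leq_div2r // ltnW.
have Lorig l : l \in L -> exists2 t, t \in Q1 & l = ty t by move=> /subL /mapP.
have pos : all (leq 1) (verts L).
  apply/allP => d /flattenP[_ /mapP[l lL ->]].
  have [t] := Lorig _ lL; rewrite mem_filter => /andP[/hasPn nl _] -> .
  have nl' v : v \in tv t -> 0 < v %/ B by move=> /nl; rewrite lt0n.
  by rewrite -[tv (ty t)]/(map (fun v => v %/ B) (tv t)) => /mapP[v vt ->]; exact: nl'.
(* A block carries at most B * K incidences with [Q], hence after thinning at most B, the number of
   places available. *)
have cnt_le d : count_mem d (verts L) <= B.
  have sumE (A : seq tri) : \sum_(x <- A) count_mem d (tv x) = count_mem d (verts A).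
    by rewrite /verts count_flatten sumnE !big_map.
  have := sumL (fun l => count_mem d (tv l)); rewrite !sumE verts_map count_map => H.
  rewrite -(leq_pmul2l K0) (leq_trans H) // mulnC.
  apply: leq_trans (count_block_le d B0 CQ).
  rewrite /Q1; elim: (Q) => // t Q' IH; rewrite verts_cons count_cat [filter (predC low) (t :: Q')]/=.
  case: ifP => _; first by rewrite verts_cons count_cat leq_add2l.
  by rewrite (leq_trans IH) // leq_addl.
have [V [UV AV _]] := spread B0 cnt_le pos.
have [M vM AM] := regroup AV.
have sM : size M = size L by move: AM; rewrite all2E => /andP[/eqP].
exists M.
  rewrite /is_matching vM UV andbT; apply/(all_nthP (0,0,0)) => i Hi.
  move: AM; rewrite all2E => /andP[_ /(all_nthP ((0,0,0),(0,0,0))) H].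
  have := H i; rewrite size_zip sM minnn -sM => /(_ Hi); rewrite nth_zip //=.
  set l := nth _ L i; set t := nth _ M i => /and3P[l1 l2 l3].
  have [q] := Lorig l (mem_nth _ (etrans (esym (congr1 (leq i.+1) sM)) Hi)).
  rewrite mem_filter => /andP[_ qQ] E; rewrite E /= in l1 l2 l3.
  apply: (symm_dom Sf (allP AQ _ qQ)).
  - exact: ltnW (leq_trans l1 (leq_divM _ _)).
  - exact: ltnW (leq_trans l2 (leq_divM _ _)).
  - exact: ltnW (leq_trans l3 (leq_divM _ _)).
  - rewrite -vM in UV; exact: (uniq_tv UV (mem_nth _ Hi)).
have -> : size Q = size (filter low Q) + size Q1 by rewrite !size_filter count_predC.
move: szL; rewrite size_map -sM => szL.
have : K * size (undup (map ty Q1)) <= K * (n %/ B).+1 ^ 3 by rewrite leq_mul2l szU orbT.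
nia.
Qed.

(** * Windows of three matching edges *)

(* A window consists of three edges of a matching; its vertices are coded
   0..8, the edges being {0,1,2}, {3,4,5}, {6,7,8}.  Each list below has length
   3K+1 and uses every code at most K times, for K = 1, 2 or 3; an entry with
   two codes stands for an edge completed by an unmatched vertex.  The lists were
   found by computer search (integral solutions of the fractional matching
   problem); permuting the three edges yields the remaining ones. *)
Definition base_obstructions : seq (seq (seq nat)) := [::
  [:: [:: 0; 5]; [:: 1; 4]; [:: 2; 3]; [:: 6; 7; 8]];
  [:: [:: 0; 7]; [:: 0; 7]; [:: 2; 6]; [:: 2; 6]; [:: 1; 3; 8]; [:: 1; 4; 8]; [:: 3; 4; 5]];
  [:: [:: 0; 7]; [:: 1; 6]; [:: 1; 6]; [:: 0; 5; 8]; [:: 2; 3; 8]; [:: 2; 4; 7]; [:: 3; 4; 5]];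
  [:: [:: 0; 7]; [:: 0; 7]; [:: 1; 3]; [:: 1; 7]; [:: 2; 6]; [:: 2; 6]; [:: 4; 6]; [:: 0; 1; 2]; [:: 3; 4; 5]; [:: 3; 4; 5]];
  [:: [:: 0; 6]; [:: 1; 3]; [:: 1; 3]; [:: 4; 6]; [:: 0; 4; 8]; [:: 2; 5; 7]; [:: 2; 5; 7]];
  [:: [:: 0; 6]; [:: 4; 7]; [:: 4; 7]; [:: 5; 6]; [:: 0; 1; 2]; [:: 1; 3; 8]; [:: 2; 3; 8]];
  [:: [:: 3; 7]; [:: 4; 6]; [:: 4; 6]; [:: 0; 1; 2]; [:: 0; 5; 8]; [:: 1; 3; 8]; [:: 2; 5; 7]];
  [:: [:: 0; 8]; [:: 0; 8]; [:: 1; 3]; [:: 3; 7]; [:: 1; 5; 7]; [:: 2; 4; 6]; [:: 2; 5; 6]];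
  [:: [:: 0; 4]; [:: 0; 7]; [:: 1; 3]; [:: 1; 4]; [:: 3; 7]; [:: 2; 5; 6]; [:: 2; 5; 6]];
  [:: [:: 0; 3]; [:: 2; 6]; [:: 4; 6]; [:: 0; 5; 8]; [:: 1; 4; 7]; [:: 1; 5; 8]; [:: 2; 3; 7]];
  [:: [:: 0; 3]; [:: 0; 6]; [:: 5; 6]; [:: 1; 4; 8]; [:: 1; 5; 7]; [:: 2; 3; 8]; [:: 2; 4; 7]];
  [:: [:: 0; 6]; [:: 0; 6]; [:: 0; 6]; [:: 1; 4; 8]; [:: 1; 4; 8]; [:: 1; 5; 7]; [:: 2; 3; 7]; [:: 2; 3; 8]; [:: 2; 5; 7]; [:: 3; 4; 5]];
  [:: [:: 0; 7]; [:: 2; 6]; [:: 4; 7]; [:: 5; 6]; [:: 0; 1; 2]; [:: 1; 3; 8]; [:: 3; 4; 5]];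
  [:: [:: 0; 7]; [:: 0; 7]; [:: 1; 6]; [:: 1; 7]; [:: 2; 6]; [:: 2; 6]; [:: 3; 8]; [:: 3; 8]; [:: 3; 8]; [:: 0; 1; 2]];
  [:: [:: 0; 8]; [:: 2; 3]; [:: 5; 6]; [:: 1; 4; 7]];
  [:: [:: 0; 6]; [:: 0; 6]; [:: 2; 3]; [:: 2; 3]; [:: 4; 7]; [:: 1; 4; 8]; [:: 1; 5; 7]]].

Definition block_perms : seq (seq nat) :=
  [:: [:: 0; 1; 2]; [:: 0; 2; 1]; [:: 1; 0; 2]; [:: 1; 2; 0]; [:: 2; 0; 1]; [:: 2; 1; 0]].

Definition obstructions : seq (seq (seq nat)) :=
  [seq [seq sort leq [seq 3 * nth 0 p (c %/ 3) + c %% 3 | c <- e] | e <- o]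
     | o <- base_obstructions, p <- block_perms].

Definition entry_in (P2 : nat -> nat -> bool) (P3 : nat -> nat -> nat -> bool) (e : seq nat) : bool :=
  match e with
  | [:: u; v] => P2 u v
  | [:: u; v; w] => P3 u v w
  | _ => false
  end.

(* A down-set of {0,1,2} x {0,1,2} is given by the heights of its columns. *)
Definition column_heights : seq (seq nat) :=
  [seq h <- [seq [:: p.1; p.2; c] | p <- [seq (a, b) | a <- iota 0 4, b <- iota 0 4], c <- iota 0 4]
     | (nth 0 h 1 <= nth 0 h 0) && (nth 0 h 2 <= nth 0 h 1)].

Definition heights_pair (h01 h02 h12 : seq nat) (u v : nat) : bool :=
  if v < 6 then v - 3 < nth 0 h01 u
  else if u < 3 then v - 6 < nth 0 h02 u else v - 6 < nth 0 h12 (u - 3).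

(* If [search up n os r T] holds and a set P is closed downwards for [up], then
   P contains a member of [os] or at most [r] elements of [T]: when it contains no
   member, some element of the first [o] in [os] contained in [T] is missing
   from P, hence so is everything above it. *)
Fixpoint search (up : nat -> nat -> bool) (n : nat) (os : seq (seq nat)) (r : nat) (T : seq nat) : bool :=
  (size T <= r) ||
  if n is n'.+1 then
    let fs := filter (all (fun i => has (eqn i) T)) os in
    if fs is o :: _ then all (fun i => search up n' fs r [seq j <- T | ~~ up i j]) o
    else false
  else false.

Lemma search_sound (up : nat -> nat -> bool) n os r T (P : pred nat) :
  (forall i j, up i j -> P j -> P i) -> search up n os r T -> has (all P) os || (count P T <= r).
Proof.
move=> HP; elim: n os T => [|n IH] os T /=; rewrite ?orbF.
  by move=> H; rewrite (leq_trans (count_size _ _) H) orbT.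
case/orP=> [H|]; first by rewrite (leq_trans (count_size _ _) H) orbT.
set fs := filter _ _; case E: fs => [//|o fs'] Ha.
have sub o' : o' \in fs -> o' \in os by rewrite mem_filter => /andP[].
case: (boolP (all P o)) => [oP|].
  by apply/orP; left; apply/hasP; exists o => //; apply: sub; rewrite E inE eqxx.
rewrite -has_predC => /hasP[i io /= nP]; have := allP Ha i io; rewrite -E => /IH /orP[/hasP[o' o'f Po]|H].
  by apply/orP; left; apply/hasP; exists o' => //; exact: sub.
apply/orP; right; apply: leq_trans H; rewrite count_filter; apply: sub_count => j /= Pj.
by rewrite Pj /=; apply/negP => /HP /(_ Pj); apply/negP.
Qed.

(* The crossing triple (a, 3 + b, 6 + c) has index 9a + 3b + c. *)
Definition tri_index (e : seq nat) : nat := 9 * nth 0 e 0 + 3 * (nth 0 e 1 - 3) + (nth 0 e 2 - 6).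

Definition tri_le (i j : nat) : bool :=
  [&& i %/ 9 <= j %/ 9, (i %/ 3) %% 3 <= (j %/ 3) %% 3 & i %% 3 <= j %% 3].

(** Entries that are edges of the window are dropped, being always present; the test on the first
    two codes singles out the crossing triples. *)
Definition pairs_triples (o : seq (seq nat)) : seq (seq nat) * seq nat :=
  ([seq e <- o | size e == 2], [seq tri_index e | e <- o & (size e == 3) && (nth 0 e 0 < 3 <= nth 0 e 1)]).

(** Once the pairs are fixed, each obstruction whose pairs are present forbids its crossing triples
    from occurring together; an empty list means that the window is already obstructed. Without any
    pair nothing has to be checked, since 15 * 27 = 405. *)
Definition check_window (up : nat -> nat -> bool) (thr : seq nat)
    (obs : seq (seq (seq nat) * seq nat)) (h01 h02 h12 : seq nat) : bool :=
  let s2 := sumn h01 + sumn h02 + sumn h12 in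
  if s2 == 0 then true else
  let os := [seq o.2 | o <- obs & all (entry_in (heights_pair h01 h02 h12) (fun _ _ _ => true)) o.1] in
  has (fun o => nilp o) os || (s2 <= 18) && search up 9 os (nth 0 thr s2) (iota 0 27).

(** A 3 x 3 grid has C(6, 3) = 20 down-sets, so 8000 configurations of pairs are examined. [thr]
    lists the number of triples that 15 T + 8 P <= 405 permits for each P. *)
Definition check_windows : bool :=
  let thr := [seq (405 - 8 * i) %/ 15 | i <- iota 0 19] in
  let upt := [seq [seq tri_le i j | j <- iota 0 27] | i <- iota 0 27] in
  let obs := map pairs_triples obstructions in
  all (fun h01 => all (fun h02 => all (fun h12 =>
    check_window (fun i j => nth false (nth [::] upt i) j) thr obs h01 h02 h12) column_heights) column_heights) column_heights.

Lemma check_windowsT : check_windows.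
Proof. by vm_cast_no_check (erefl true). Qed.

Definition valid_entry (e : seq nat) : bool :=
  match e with
  | [:: u; v] => (u %/ 3 < v %/ 3) && (v < 9)
  | [:: u; v; w] => (e \in [:: [:: 0; 1; 2]; [:: 3; 4; 5]; [:: 6; 7; 8]])
                    || [&& u < 3, 3 <= v, v < 6, 6 <= w & w < 9]
  | _ => false
  end.

(** K is recovered from the length 3K + 1. That it divides 6 allows obstructions of different
    multiplicities to be repeated up to the common multiplicity 6. *)
Definition valid_obstruction (o : seq (seq nat)) : bool :=
  let K := (size o).-1 %/ 3 in
  [&& size o == 3 * K + 1, (0 < K) && (K %| 6), all valid_entry o, all uniq o
    & all (fun c => count_mem c (flatten o) <= K) (iota 0 9)].

Lemma obstructions_valid : all valid_obstruction obstructions.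
Proof. by vm_compute. Qed.

Lemma column_heightsP a b c : c <= b -> b <= a -> a <= 3 -> [:: a; b; c] \in column_heights.
Proof. by case: a => [|[|[|[|a]]]] //; case: b => [|[|[|[|b]]]] //; case: c => [|[|[|[|c]]]]. Qed.

(** The pairs between two edges of the window form a down-set, so their column heights determine
    them and the exhaustive check applies. *)
Lemma window_bound (P2 : nat -> nat -> bool) (P3 : nat -> nat -> nat -> bool) :
  (forall u v u' v', u %/ 3 = u' %/ 3 -> v %/ 3 = v' %/ 3 -> u' <= u -> v' <= v ->
     u %/ 3 < v %/ 3 -> v < 9 -> P2 u v -> P2 u' v') ->
  (forall u v w u' v' w', u < 3 -> 3 <= v' -> v < 6 -> 6 <= w' -> w < 9 ->
     u' <= u -> v' <= v -> w' <= w -> P3 u v w -> P3 u' v' w') ->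
  P3 0 1 2 -> P3 3 4 5 -> P3 6 7 8 ->
  ~~ has (all (entry_in P2 P3)) obstructions ->
  let s2 := \sum_(a < 3) \sum_(b < 3) (P2 a (3 + b) + P2 a (6 + b) + P2 (3 + a) (6 + b)) in
  let s3 := \sum_(a < 3) \sum_(b < 3) \sum_(c < 3) P3 a (3 + b) (6 + c) in
  15 * s3 + 8 * s2 <= 405 /\ s2 <= 18.
Proof.
move=> D2 D3 E1 E2 E3 Hobs s2 s3.
pose r (i j a : nat) : nat := P2 (3 * i + a) (3 * j) + P2 (3 * i + a) (3 * j + 1) + P2 (3 * i + a) (3 * j + 2).
have imp (b b' : bool) : (b -> b') -> b <= b' by case: b; case: b' => // H; have := H isT.
have rm i j a : i < j -> j < 3 -> a < 2 -> r i j a.+1 <= r i j a.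
  move=> ij j3 a2; rewrite /r; apply: leq_add; first apply: leq_add; apply: imp; apply: D2; lia.
have r3 i j a : r i j a <= 3 by rewrite /r; do 3 case: (P2 _ _).
pose h i j := [:: r i j 0; r i j 1; r i j 2].
have hd i j : i < j -> j < 3 -> h i j \in column_heights.
  by move=> ij j3; apply: column_heightsP; rewrite ?rm ?r3.
(* By downward closure the entries of a column sit at its bottom, so its height tells which of them
   are present. *)
have row i j a b : i < j -> j < 3 -> a < 3 -> b < 3 -> b < r i j a -> P2 (3 * i + a) (3 * j + b).
  move=> ij j3 a3 b3.
  have m1 : P2 (3 * i + a) (3 * j + 1) -> P2 (3 * i + a) (3 * j) by apply: D2; lia.
  have m2 : P2 (3 * i + a) (3 * j + 2) -> P2 (3 * i + a) (3 * j + 1) by apply: D2; lia.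
  rewrite /r; move: m1 m2; case: b b3 => [|[|[|b]]] // _; rewrite ?addn0;
  case: (P2 _ (3 * j)); case: (P2 _ (3 * j + 1)); case: (P2 _ (3 * j + 2)) => // m1 m2; by [have := m1 isT | have := m2 isT].
have okh u v : valid_entry [:: u; v] -> heights_pair (h 0 1) (h 0 2) (h 1 2) u v -> P2 u v.
  move=> /= /andP[uv v9]; rewrite /heights_pair.
  case: ifP => v6.
    have u3 : u < 3 by lia.
    have v3 : 3 <= v by lia.
    have := @row 0 1 u (v - 3) isT isT u3; rewrite (_ : 3 * 1 + (v - 3) = v); last lia.
    by case: u u3 {uv} => [|[|[|u]]] //= _; apply; lia.
  case: ifP => u3.
    have := @row 0 2 u (v - 6) isT isT u3; rewrite (_ : 3 * 2 + (v - 6) = v); last lia.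
    by case: u u3 {uv} => [|[|[|u]]] //= _; apply; lia.
  have u3' : u - 3 < 3 by lia.
  have := @row 1 2 (u - 3) (v - 6) isT isT u3'; rewrite (_ : 3 * 2 + (v - 6) = v); last lia.
  rewrite (_ : 3 * 1 + (u - 3) = u); last lia.
  by move: u3'; move: (u - 3) => [|[|[|k]]] //= _; apply; lia.
pose P i := P3 (i %/ 9) (3 + (i %/ 3) %% 3) (6 + i %% 3).
(* A forbidden list of triples contained in [P], with the pairs of its obstruction and the window
   edges, would make up the whole obstruction. *)
have noP (os : seq (seq nat)) : os = [seq o.2 | o <- map pairs_triples obstructions &
    all (entry_in (heights_pair (h 0 1) (h 0 2) (h 1 2)) (fun _ _ _ => true)) o.1] -> ~~ has (all P) os.
  move=> ->; apply/hasPn => x /mapP[y]; rewrite mem_filter => /andP[H1 /mapP[o oo yE]] xE.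
  rewrite {x}xE {y}yE /= in H1 *.
  apply: contra (hasPn Hobs o oo) => H2.
  have /and5P[_ _ vo _ _] := allP obstructions_valid o oo.
  apply/allP => e eo; have ve := allP vo e eo.
  case: e eo ve => [|u [|v [|w [|]]]] // eo ve.
    apply: okh => //; have /allP/(_ [:: u; v]) := H1; rewrite mem_filter eo; exact.
  move: ve; rewrite /valid_entry => /orP[|/and5P[u3 v3 v6 w6 w9]].
    by rewrite !inE => /or3P[]/eqP[-> -> ->].
  have /allP/(_ (tri_index [:: u; v; w])) := H2.
  have -> : P (tri_index [:: u; v; w]) = P3 u v w.
    by case: u u3 {eo} => [|[|[|//]]] _; case: v v3 v6 => [|[|[|[|[|[|//]]]]]] // _ _;
       case: w w6 w9 => [|[|[|[|[|[|[|[|[|//]]]]]]]]].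
  by apply; apply: map_f; rewrite mem_filter eo /= u3 v3.
have upP i j : nth false (nth [::] [seq [seq tri_le i j | j <- iota 0 27] | i <- iota 0 27] i) j -> P j -> P i.
  case: (ltnP i 27) => i27; last by rewrite (nth_default [::]) ?size_map ?size_iota // nth_nil.
  rewrite (nth_map 0) ?size_iota //.
  case: (ltnP j 27) => j27; last by rewrite (nth_default false) ?size_map ?size_iota.
  rewrite (nth_map 0) ?size_iota // !nth_iota // !add0n => /and3P[l1 l2 l3].
  by apply: D3; rewrite ?leq_add2l //; lia.
have s3E : s3 = count P (iota 0 27).
  have -> : s3 = \sum_(a < 3) \sum_(b < 3) \sum_(c < 3) P (9 * a + 3 * b + c).
    apply: eq_bigr => a _; apply: eq_bigr => b _; apply: eq_bigr => c _.
    by case: a b c => [[|[|[|//]]] ?] [[|[|[|//]]] ?] [[|[|[|//]]] ?].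
  by rewrite !big_ord_recl !big_ord0 /= !addn0 !addnA.
have s2E : s2 = sumn (h 0 1) + sumn (h 0 2) + sumn (h 1 2).
  have -> : s2 = \sum_(a < 3) \sum_(b < 3) P2 a (3 + b) + \sum_(a < 3) \sum_(b < 3) P2 a (6 + b)
      + \sum_(a < 3) \sum_(b < 3) P2 (3 + a) (6 + b).
    by rewrite -!big_split; apply: eq_bigr => a _; rewrite -!big_split.
  by rewrite !big_ord_recl !big_ord0 /= !addn0 !addnA.
have := check_windowsT; rewrite /check_windows; cbv zeta.
move=> /allP/(_ _ (@hd 0 1 isT isT))/allP/(_ _ (@hd 0 2 isT isT))/allP/(_ _ (@hd 1 2 isT isT)).
rewrite /check_window -s2E; cbv zeta.
set os := [seq o.2 | o <- _]; set up := (fun _ _ => nth _ _ _); set thr := map _ (iota 0 19).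
have /noP Hos : os = os by [].
case: eqP => [-> _|_].
  by have : s3 <= 27; [rewrite s3E (leq_trans (count_size _ _)) ?size_iota | lia].
case/orP=> [/hasP[o oos /nilP o0]|/andP[s18 Hs]].
  by case/hasP: Hos; exists o => //; rewrite o0.
have := search_sound upP Hs; rewrite (negbTE Hos) orFb -s3E.
rewrite /thr (nth_map 0) ?size_iota ?nth_iota ?ltnS // add0n => l3.
have := leq_divM (405 - 8 * s2) 15; split => //; lia.
Qed.

(** * Obstructed windows as multiple matchings *)

Fixpoint realize (om : nat -> nat) (x : nat) (o : seq (seq nat)) : seq tri :=
  if o is e :: o' then
    (match e with
     | [:: u; v] => (om u, om v, x)
     | [:: u; v; w] => (om u, om v, om w)
     | _ => (0, 0, 0)
     end) :: realize om x.+1 o'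
  else [::].

Lemma size_realize om x o : size (realize om x o) = size o.
Proof. by elim: o x => //= e o IH x; rewrite IH. Qed.

(** A pair is only known to extend to the far vertex X; compression lowers X to the fresh vertex
    reserved for the entry. Entries with three codes reserve one too, so that position and vertex
    advance together. *)
Lemma realize_edges n f X om x o : shifted_system n f ->
  (forall c, c < 9 -> om c < x) -> all valid_entry o -> x + size o <= X ->
  all (entry_in (fun u v => symm f (om u) (om v) X) (fun u v w => symm f (om u) (om v) (om w))) o ->
  all (fun t => symm f t.1.1 t.1.2 t.2) (realize om x o).
Proof.
move=> Sf; elim: o x => //= e o IH x Hx /andP[ve vo] HX /andP[oe oo].
apply/andP; split; last by apply: IH => //; [move=> c /Hx; lia | rewrite addSnnS].
case: e ve oe => [|u [|v [|w [|]]]] //= /andP[uv v9] H.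
have [_ _ _ U] := symm_bound Sf H.
have lu := Hx u; have lv := Hx v.
apply: (symm_dom Sf H) => //; first lia.
by move: U; rewrite /= !inE !negb_or; lia.
Qed.

Lemma realize_count om x o (v : nat) : all valid_entry o ->
  count_mem v (verts (realize om x o)) <=
    count_mem v (map om (flatten o)) + (x <= v < x + size o).
Proof.
elim: o x => [|e o IH] x // /andP[ve vo]; have := IH x.+1 vo.
rewrite [realize _ x _]/= verts_cons count_cat [flatten (e :: o)]/= map_cat count_cat -[size (e :: o)]/(size o).+1 addnS -addSn.
by case: e ve => [|u [|v' [|w [|]]]] // _; rewrite /tv /=; lia.
Qed.

(** Up to order, [A] is a subsequence of m copies of [C]. Arbitrary predicates are needed because
    codes are later counted through preimages under [om]. *)
Lemma count_dominated (A C : seq nat) m p : (forall c, count_mem c A <= m * count_mem c C) ->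
  count p A <= m * count p C.
Proof.
move=> H; have E (q : pred nat) : count q (flatten (nseq m C)) = m * count q C.
  by elim: m {H} => //= m IH; rewrite count_cat IH mulSn.
have /count_subseqP[A' sub /seq.permP ->] : forall c, count_mem c A <= count_mem c (flatten (nseq m C)).
  by move=> c; rewrite E.
by rewrite -E leq_count_subseq.
Qed.

Definition sixfold (o : seq (seq nat)) := flatten (nseq (6 %/ ((size o).-1 %/ 3)) o).

(** 6 / K copies of 3K + 1 entries make 18 + 6 / K entries: more than the 18 edges of a window taken
    six times, and at most 24, the number of fresh vertices set aside per window. *)
Lemma sixfold_valid o : valid_obstruction o ->
  [/\ all valid_entry (sixfold o), 19 <= size (sixfold o) <= 24 &
    forall c, count_mem c (flatten (sixfold o)) <= 6 * count_mem c (iota 0 9)].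
Proof.
set K := (size o).-1 %/ 3 => /and5P[/eqP so /andP[K0 K6] vo uo co].
have E : (6 %/ K) * K = 6 by rewrite divnK.
have c9 c : c \in flatten o -> c < 9.
  case/flattenP=> e eo ce; have := allP vo e eo.
  case: e {eo} ce => [|u [|v [|w [|]]]] //= ; rewrite !inE.
    by case/orP=> /eqP->; lia.
  case/or3P=> /eqP->; case/orP; try lia; by case/or3P=> /eqP[]; lia.
have cnto c : count_mem c (flatten o) <= K * count_mem c (iota 0 9).
  case: (ltnP c 9) => H; last by rewrite (count_memPn _) //; apply/negP => /c9; lia.
  rewrite [X in _ * X]count_uniq_mem ?iota_uniq // mem_iota H muln1.
  by apply: (allP co); rewrite mem_iota.
rewrite /sixfold -/K; split.
- by elim: (6 %/ K) => //= k IH; rewrite all_cat vo.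
- have -> : size (flatten (nseq (6 %/ K) o)) = (6 %/ K) * size o.
    by elim: (6 %/ K) => //= k IH; rewrite size_cat IH mulSn.
  have K6' : K <= 6 by apply: dvdn_leq.
  rewrite so mulnDr mulnCA E; nia.
- move=> c; have -> : count_mem c (flatten (flatten (nseq (6 %/ K) o))) = (6 %/ K) * count_mem c (flatten o).
    by elim: (6 %/ K) => //= k IH; rewrite flatten_cat count_cat IH mulSn.
  by apply: leq_trans (leq_mul (leqnn _) (cnto c)) _; rewrite mulnA E.
Qed.

Definition window := (tri * tri * tri)%type.
Definition wl (w : window) : seq tri := [:: w.1.1; w.1.2; w.2].
Definition wcode (w : window) (c : nat) : nat := nth 0 (verts (wl w)) c.

Definition obstructed (f : nat -> nat -> nat -> bool) (X : nat) (w : window) : bool :=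
  let om := wcode w in
  has (all (entry_in (fun u v => symm f (om u) (om v) X) (fun u v w => symm f (om u) (om v) (om w))))
    obstructions.

Lemma wcode_map w : map (wcode w) (iota 0 9) = verts (wl w).
Proof. by []. Qed.

(** Each window receives its own block of at most 24 fresh vertices, so every fresh vertex is used
    at most once. *)
Lemma realize_windows n f X (W : seq window) x : shifted_system n f ->
  (forall v, v \in verts (flatten (map wl W)) -> v < x) ->
  all (obstructed f X) W -> x + 24 * size W <= X ->
  exists Q, [/\ all (fun t => symm f t.1.1 t.1.2 t.2) Q, 19 * size W <= size Q &
    forall v, count_mem v (verts Q) <= 6 * count_mem v (verts (flatten (map wl W))) + (x <= v)].
Proof.
move=> Sf; elim: W x => [|w W IH] x Hx; first by exists [::].
case/andP=> /hasP[o oobs oo] oW HX.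
have [vo /andP[so1 so2] co] := sixfold_valid (allP obstructions_valid o oobs).
have [||Q [eQ sQ cQ]] := IH (x + size (sixfold o)) _ oW.
- by move=> v vW; apply: ltn_addr; apply: Hx; rewrite verts_cat mem_cat vW orbT.
- move: HX => /=; lia.
exists (realize (wcode w) x (sixfold o) ++ Q); split.
- rewrite all_cat eQ andbT; apply: (@realize_edges n f X) => //.
  + move=> c c9; apply: Hx; rewrite verts_cat mem_cat -wcode_map map_f // mem_iota //.
  + move: HX => /=; lia.
  + by rewrite /sixfold; elim: (_ %/ _) => //= k IHk; rewrite all_cat oo.
- by rewrite size_cat size_realize /=; lia.
- move=> v; rewrite verts_cat count_cat [map wl _]/= [flatten _]/= -[_ :: _ :: _ :: _]/(wl w ++ _) verts_cat count_cat.
  have H1 := realize_count (wcode w) x v vo.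
  have H2 : count_mem v (map (wcode w) (flatten (sixfold o))) <= 6 * count_mem v (verts (wl w)).
    rewrite -wcode_map !count_map; exact: count_dominated.
  have H3 := cQ v.
  have H4 : (x <= v < x + size (sixfold o)) + (x + size (sixfold o) <= v) <= (x <= v) by lia.
  lia.
Qed.

Lemma uniq_matching f M : is_matching f M -> uniq M.
Proof.
case/andP=> _; elim: M => // t M IH; rewrite verts_cons cat_uniq => /and3P[_ /hasPn H /IH].
rewrite cons_uniq => ->; rewrite andbT; apply/negP => tM.
by have := H t.1.1 (mem_verts tM (mem_head _ _)); rewrite /= mem_head.
Qed.

(** In six copies of [M], the 18 edges of each window are replaced by at least 19. This 6-fold
    matching has size at least 6s + |W|, and rounding it to a matching, of size at most s, bounds
    |W| by the rounding loss. *)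
Lemma few_disjoint_windows n f s M X B (W : seq window) : shifted_system n f -> matching_le f s ->
  is_matching f M -> size M = s -> (forall v, v \in verts M -> v < 3 * s) -> 0 < B ->
  uniq (flatten (map wl W)) -> {subset flatten (map wl W) <= M} -> all (obstructed f X) W ->
  3 * s + 24 * size W <= X -> size W <= 6 * (B + (n %/ B).+1 ^ 3).
Proof.
move=> Sf Hs HM sM vM B0 UW WM oW HX.
have sub3 v : v \in verts (flatten (map wl W)) -> v < 3 * s.
  by case/flattenP=> _ /mapP[t tW ->] vt; apply: vM; apply: mem_verts vt; exact: WM.
have [Q [eQ sQ cQ]] := realize_windows Sf sub3 oW HX.
have /andP[eM UM] := HM.
have uM := uniq_matching HM.
pose R := [seq t <- M | t \notin flatten (map wl W)].
have permM : perm_eq (flatten (map wl W) ++ R) M.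
  apply: uniq_perm => //.
    rewrite cat_uniq UW filter_uniq // andbT /=; apply/hasPn => t.
    by rewrite mem_filter => /andP[].
  move=> t; rewrite mem_cat mem_filter; case: (boolP (t \in flatten _)) => //= /WM //.
pose Q' := Q ++ flatten (nseq 6 R).
have eR : all (fun t => symm f t.1.1 t.1.2 t.2) R.
  by apply/allP => t; rewrite mem_filter => /andP[_ /(allP eM)].
have countR v : count_mem v (verts (flatten (nseq 6 R))) = 6 * count_mem v (verts R).
  by elim: 6 => //= k IH; rewrite verts_cat count_cat IH mulSn.
have [|v|M' HM' sM'] := @rounding n f 6 B Q' Sf isT B0.
- by rewrite all_cat eQ /= !all_cat eR.
- rewrite verts_cat count_cat countR.
  have H1 := cQ v.
  have E : count_mem v (verts (flatten (map wl W))) + count_mem v (verts R) = count_mem v (verts M).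
    rewrite -count_cat -verts_cat; apply/seq.permP; apply: perm_flatten; exact: perm_map.
  have : count_mem v (verts M) <= (v < 3 * s).
    rewrite count_uniq_mem //; case: (boolP (v \in verts M)) => // /vM -> //.
  lia.
have sW : size W * 3 + size R = s.
  rewrite -sM -(perm_size permM) size_cat; congr (_ + _).
  by elim: (W) => //= w W' IHW; rewrite mulSn IHW.
have sQ' : size Q' = size Q + 6 * size R.
  rewrite /Q' size_cat; congr (_ + _).
  by elim: 6 => //= k IH; rewrite size_cat IH mulSn.
move: sM' (Hs _ HM'); rewrite sQ'; move: ((_ %/ _).+1 ^ 3) => A.
clear -sQ sW; lia.
Qed.

(** Greedy choice: as soon as no bad window avoids those already chosen, the edges of the chosen
    ones form the hitting set. *)
Lemma disjoint_or_hit (bad : pred window) (M : seq tri) k :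
  (exists W, [/\ size W = k, uniq (flatten (map wl W)), {subset flatten (map wl W) <= M} & all bad W]) \/
  (exists S : seq tri, size S <= 3 * k /\ forall w, {subset wl w <= M} -> uniq (wl w) -> bad w ->
     has (mem S) (wl w)).
Proof.
elim: k => [|k [[W [sW UW WM bW]]|[S [sS HS]]]]; first by left; exists [::].
  pose P t1 t2 t3 := [&& bad (t1, t2, t3), uniq [:: t1; t2; t3] & ~~ has (mem (flatten (map wl W))) [:: t1; t2; t3]].
  case: (boolP (has (fun t1 => has (fun t2 => has (fun t3 => P t1 t2 t3) M) M) M)).
    case/hasP=> t1 m1 /hasP[t2 m2 /hasP[t3 m3 /and3P[b u d]]].
    left; exists ((t1, t2, t3) :: W); split.
    - by rewrite /= sW.
    - rewrite [flatten _]/= -[_ :: _ :: _ :: _]/([:: t1; t2; t3] ++ _) cat_uniq u UW andbT /=.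
      by move: d; apply: contra => /hasP[t tW H]; apply/hasP; exists t.
    - move=> t; rewrite [flatten _]/= -[_ :: _ :: _ :: _]/([:: t1; t2; t3] ++ _) mem_cat !inE.
      by case/orP=> [/or3P[]/eqP-> //|/WM].
    - by rewrite /= b.
  move=> nP; right; exists (flatten (map wl W)); split.
    have -> : size (flatten (map wl W)) = 3 * k by rewrite -sW; elim: (W) => //= w W' ->; rewrite mulnS.
    by rewrite leq_mul2l leqnSn orbT.
  move=> [[t1 t2] t3] wM uw bw; apply: contraR nP => nh.
  apply/hasP; exists t1; first by apply: wM; rewrite !inE eqxx.
  apply/hasP; exists t2; first by apply: wM; rewrite !inE eqxx ?orbT.
  apply/hasP; exists t3; first by apply: wM; rewrite !inE eqxx ?orbT.
  by rewrite /P bw uw.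
by right; exists S; split => //; rewrite (leq_trans sS) // leq_mul2l leqnSn orbT.
Qed.

Lemma sum_symm3 f n N : shifted_system n f ->
  \sum_(u < N) \sum_(v < N) \sum_(w < N) symm f u v w = 6 * cnt f N.
Proof.
move=> Sf; pose S2 N w := \sum_(u < N) \sum_(v < N) symm f u v w.
have irr a c : symm f a c c = false.
  by apply/negP => /(symm_bound Sf)[_ _ _]; rewrite /= !inE eqxx andbF.
have irr' a c : symm f c a c = false by rewrite symmC12.
have irr2 a c : symm f c c a = false by rewrite symmC23.
have S2E K w : K <= w -> S2 K w = 2 * \sum_(y < K) \sum_(x < y) f x y w.
  elim: K => [|K IH] Kw; first by rewrite /S2 !big_ord0.
  rewrite [in RHS]big_ord_recr /= mulnDr -IH 1?ltnW // /S2 big_ord_recr /=.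
  under eq_bigr do rewrite big_ord_recr /=.
  rewrite big_split /= big_ord_recr /= irr2 addn0 -!addnA; congr (_ + _).
  rewrite mul2n -addnn; congr (_ + _); apply: eq_bigr => x _.
    by rewrite symm_eq.
  by rewrite symmC12 symm_eq.
elim: N => [|N IH]; first by rewrite /cnt !big_ord0.
rewrite /cnt [in RHS]big_ord_recr /= -/(cnt f N) mulnDr -IH.
have E3 : 6 * (\sum_(y < N) \sum_(x < y) f x y N) = 3 * S2 N N by rewrite S2E // mulnA.
rewrite E3 big_ord_recr /=.
have -> : \sum_(v < N.+1) \sum_(w < N.+1) symm f N v w = S2 N N.
  rewrite big_ord_recr /= [X in _ + X]big1 ?addn0; last by move=> i _; rewrite irr2.
  apply: eq_bigr => v _; rewrite big_ord_recr /= irr' addn0; apply: eq_bigr => w _.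
  by rewrite symmC12 symmC23.
have -> : \sum_(u < N) \sum_(v < N.+1) \sum_(w < N.+1) symm f u v w =
  \sum_(u < N) (\sum_(v < N) \sum_(w < N) symm f u v w + \sum_(v < N) symm f u v N + \sum_(w < N) symm f u w N).
  apply: eq_bigr => u _; rewrite big_ord_recr /=; congr (_ + _).
    under eq_bigr do rewrite big_ord_recr /=.
    by rewrite big_split.
  rewrite big_ord_recr /= irr addn0; by apply: eq_bigr => w _; rewrite symmC23.
rewrite !big_split /= -/(S2 N N); lia.
Qed.

Lemma sum_symm2 (G : nat -> nat -> bool) N : (forall u v, G u v = G v u) -> (forall u, G u u = false) ->
  \sum_(u < N) \sum_(v < N) G u v = 2 * \sum_(v < N) \sum_(u < v) G u v.
Proof.
move=> Gs Gi; elim: N => [|N IH]; first by rewrite !big_ord0.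
rewrite [in RHS]big_ord_recr /= mulnDr -IH big_ord_recr /=.
under eq_bigr do rewrite big_ord_recr /=.
rewrite big_split /= big_ord_recr /= Gi addn0 -addnA; congr (_ + _).
by rewrite mul2n -addnn; congr (_ + _); apply: eq_bigr => x _; rewrite Gs.
Qed.

Lemma sum_verts (M : seq tri) N (F : nat -> nat) : perm_eq (verts M) (iota 0 N) ->
  \sum_(u < N) F u = \sum_(t <- M) \sum_(u <- tv t) F u.
Proof.
move=> P; rewrite -(big_mkord xpredT F) /index_iota subn0 -(perm_big _ P).
by rewrite big_flatten big_map.
Qed.

Lemma sum_count (T : Type) (M : seq T) (b : pred T) : \sum_(t <- M) b t = count b M.
Proof. by elim: M => [|t M IH]; rewrite ?big_nil // big_cons IH. Qed.

Lemma sum_const_seq (T : Type) (M : seq T) c : \sum_(t <- M) c = size M * c.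
Proof. by rewrite big_const_seq count_predT iter_addn_0 mulnC. Qed.

(** Each of the three coincidences accounts for at most s^2 triples, each of the three memberships
    in [S] for at most |S| s^2. *)
Lemma few_exceptions (T : eqType) (M S : seq T) (bad : T -> T -> T -> bool) : uniq M ->
  (forall t1 t2 t3, bad t1 t2 t3 ->
     0 < ((t1 == t2) + (t1 == t3) + (t2 == t3) + (t1 \in S) + (t2 \in S) + (t3 \in S))) ->
  \sum_(t1 <- M) \sum_(t2 <- M) \sum_(t3 <- M) bad t1 t2 t3 <= 3 * size M ^ 2 * (size S).+1.
Proof.
move=> UM Hbad; set s := size M.
have eq1 t : \sum_(t' <- M) (t == t') <= 1.
  rewrite (eq_bigr (fun t' => nat_of_bool (pred1 t t'))); last by move=> t' _; rewrite /= eq_sym.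
  by rewrite sum_count count_uniq_mem // leq_b1.
have inS : \sum_(t <- M) (t \in S) <= size S.
  rewrite sum_count -size_filter; apply: uniq_leq_size; first exact: filter_uniq.
  by move=> t; rewrite mem_filter => /andP[].
pose B3 t1 t2 := s * (t1 == t2) + 1 + 1 + s * (t1 \in S) + s * (t2 \in S) + size S.
have H3 t1 t2 : \sum_(t3 <- M) bad t1 t2 t3 <= B3 t1 t2.
  apply: (@leq_trans (\sum_(t3 <- M) ((t1 == t2) + (t1 == t3) + (t2 == t3) + (t1 \in S) + (t2 \in S) + (t3 \in S)))).
    by apply: leq_sum => t3 _; case: (boolP (bad t1 t2 t3)) => // /Hbad.
  rewrite !big_split /= !sum_const_seq -/s /B3.
  by have := eq1 t1; have := eq1 t2; move: inS; lia.
pose B2 t1 := s + s + s + s * (s * (t1 \in S)) + s * size S + s * size S.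
have H2 t1 : \sum_(t2 <- M) \sum_(t3 <- M) bad t1 t2 t3 <= B2 t1.
  apply: (@leq_trans (\sum_(t2 <- M) B3 t1 t2)); first by apply: leq_sum.
  rewrite /B3 !big_split /= !sum_const_seq -/s -!big_distrr /= !muln1 /B2.
  have h1 : s * \sum_(t2 <- M) (t1 == t2) <= s by rewrite -{2}(muln1 s) leq_mul2l eq1 orbT.
  have h2 : s * \sum_(t2 <- M) (t2 \in S) <= s * size S by rewrite leq_mul2l inS orbT.
  lia.
apply: (@leq_trans (\sum_(t1 <- M) B2 t1)); first by apply: leq_sum.
rewrite /B2 !big_split /= !sum_const_seq -/s -!big_distrr /=.
have h2 : s * (s * \sum_(t2 <- M) (t2 \in S)) <= s * (s * size S) by rewrite !leq_mul2l inS !orbT.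
rewrite !expnS expn0 muln1; nia.
Qed.

Definition window_pairs (f : nat -> nat -> nat -> bool) X (w : window) : nat :=
  \sum_(u <- tv w.1.1) \sum_(v <- tv w.1.2) symm f u v X
  + \sum_(u <- tv w.1.1) \sum_(v <- tv w.2) symm f u v X
  + \sum_(u <- tv w.1.2) \sum_(v <- tv w.2) symm f u v X.

Definition window_triples (f : nat -> nat -> nat -> bool) (w : window) : nat :=
  \sum_(u <- tv w.1.1) \sum_(v <- tv w.1.2) \sum_(x <- tv w.2) symm f u v x.

Definition increasing (t : tri) : bool := t.1.1 < t.1.2 < t.2.

Lemma uniq_verts_sub f M (A : seq tri) : is_matching f M -> {subset A <= M} -> uniq A -> uniq (verts A).
Proof.
move=> HM; elim: A => // t A IH AM; rewrite cons_uniq => /andP[tA uA].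
have [_ UM] := andP HM.
rewrite verts_cons cat_uniq IH // ?andbT; last by move=> t' t'A; apply: AM; rewrite inE t'A orbT.
rewrite (uniq_tv UM) ?AM ?mem_head //=; apply/hasPn => v vA; apply/negP => vt.
case/flattenP: vA => _ /mapP[t' t'A ->] vt'.
have tM : t \in M by apply: AM; rewrite mem_head.
have t'M : t' \in M by apply: AM; rewrite inE t'A orbT.
have nt : t != t' by apply: contra tA => /eqP->.
move: UM tM t'M; elim: (M) => // q M' IHM; rewrite verts_cons cat_uniq => /and3P[_ /hasPn H U'].
rewrite !inE => /orP[/eqP E|m] /orP[/eqP E'|m']; last exact: IHM.
- by rewrite E E' eqxx in nt.
- by have := H v (mem_verts m' vt'); rewrite /= -E vt.
- by have := H v (mem_verts m vt); rewrite /= -E' vt'.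
Qed.

Lemma window_sumsE f X w :
  window_pairs f X w = \sum_(a < 3) \sum_(b < 3)
     (symm f (wcode w a) (wcode w (3 + b)) X + symm f (wcode w a) (wcode w (6 + b)) X
      + symm f (wcode w (3 + a)) (wcode w (6 + b)) X)
  /\ window_triples f w = \sum_(a < 3) \sum_(b < 3) \sum_(c < 3)
      symm f (wcode w a) (wcode w (3 + b)) (wcode w (6 + c)).
Proof.
have E (F : nat -> nat) (t : tri) : \sum_(u <- tv t) F u = \sum_(a < 3) F (nth 0 (tv t) a).
  by rewrite !big_ord_recl big_ord0 !big_cons big_nil.
have w0 (a : 'I_3) : wcode w a = nth 0 (tv w.1.1) a by case: a => [[|[|[|]]]].
have w1 (a : 'I_3) : wcode w (3 + a) = nth 0 (tv w.1.2) a by case: a => [[|[|[|]]]].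
have w2 (a : 'I_3) : wcode w (6 + a) = nth 0 (tv w.2) a by case: a => [[|[|[|]]]].
split.
  rewrite /window_pairs !E; under eq_bigr do rewrite E.
  under [X in _ + X + _]eq_bigr do rewrite E.
  under [X in _ + X]eq_bigr do rewrite E.
  rewrite -!big_split; apply: eq_bigr => a _; rewrite -!big_split; apply: eq_bigr => b _.
  by rewrite w0 !w1 !w2.
rewrite /window_triples E; apply: eq_bigr => a _; rewrite E; apply: eq_bigr => b _; rewrite E.
by apply: eq_bigr => c _; rewrite w0 w1 w2.
Qed.

(** With every edge listed increasingly, codes and vertices are ordered alike on each edge, and
    compression of [f] becomes the closure hypotheses of [window_bound]. *)
Lemma good_window n f X w : shifted_system n f ->
  all (fun t => symm f t.1.1 t.1.2 t.2) (wl w) -> all increasing (wl w) -> uniq (verts (wl w)) ->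
  (forall v, v \in verts (wl w) -> v < X) -> ~~ obstructed f X w ->
  15 * window_triples f w + 8 * window_pairs f X w <= 405 /\ window_pairs f X w <= 18.
Proof.
move=> Sf; move=> /and4P[e1 e2 e3 _] /and4P[/andP[a1 b1] /andP[a2 b2] /andP[a3 b3] _] Uw HX nob.
have [-> ->] := window_sumsE f X w.
have mono u u' : u %/ 3 = u' %/ 3 -> u' <= u -> u < 9 -> wcode w u' <= wcode w u.
  move=> E le lt; have u9 := leq_ltn_trans le lt.
  move: E le; case: w {e1 e2 e3 Uw HX nob} a1 b1 a2 b2 a3 b3 => [[[[x1 x2] x3] [[y1 y2] y3]] [[z1 z2] z3]] /=.
  rewrite /wcode /=.
  by case: u lt => [|[|[|[|[|[|[|[|[|//]]]]]]]]] _; case: u' u9 => [|[|[|[|[|[|[|[|[|//]]]]]]]]] _ //= a1 b1 a2 b2 a3 b3 _ _; lia.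
have inj u v : u < 9 -> v < 9 -> u != v -> wcode w u != wcode w v.
  by move=> u9 v9 uv; rewrite /wcode (@nth_uniq _ 0 (verts (wl w)) u v u9 v9 Uw).
have ltX u : u < 9 -> wcode w u < X.
  by move=> u9; apply: HX; apply: mem_nth; rewrite size_verts.
apply: (window_bound (P2 := fun u v => symm f (wcode w u) (wcode w v) X)
   (P3 := fun u v x => symm f (wcode w u) (wcode w v) (wcode w x))) => //.
- move=> u v u' v' Eu Ev lu lv uv v9 H; apply: (symm_dom Sf H) => //; try by apply: mono; clear -Eu Ev lu lv uv v9; lia.
  have := inj u' v'; have := ltX u'; have := ltX v'; rewrite /= !inE !negb_or; clear -Eu Ev lu lv uv v9; lia.
- move=> u v x u' v' x' u3 v3 v6 x6 x9 lu lv lx H.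
  apply: (symm_dom Sf H); try by apply: mono; clear -u3 v3 v6 x6 x9 lu lv lx; lia.
  have := inj u' v'; have := inj u' x'; have := inj v' x'; rewrite /= !inE !negb_or; clear -u3 v3 v6 x6 x9 lu lv lx; lia.
Qed.

Lemma increasing_matching f M : is_matching f M ->
  exists M', [/\ is_matching f M', size M' = size M, perm_eq (verts M') (verts M) & all increasing M'].
Proof.
pose srt (t : tri) : tri := let lo := minn t.1.1 (minn t.1.2 t.2) in
  let hi := maxn t.1.1 (maxn t.1.2 t.2) in (lo, t.1.1 + t.1.2 + t.2 - lo - hi, hi).
case/andP=> eM uM; have Hs t : t \in M -> increasing (srt t) /\ perm_eq (tv (srt t)) (tv t).
  move=> tM; have := uniq_tv uM tM; case: t {tM} => [[a b] c].
  rewrite /tv /= !inE negb_or => U.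
  have inc : increasing (srt (a, b, c)) by rewrite /srt /increasing /=; lia.
  split => //; apply: uniq_perm.
  - by move: inc; rewrite /increasing /= !inE negb_or; lia.
  - by rewrite /= !inE negb_or.
  - by clear -U; move=> x; rewrite /= !inE; lia.
have P : perm_eq (verts (map srt M)) (verts M).
  elim: (M) Hs => // t M' IH H; rewrite [map _ _]/= !verts_cons.
  have [_ Pt] := H t (mem_head _ _).
  by rewrite perm_cat // IH // => t' m; apply: H; rewrite inE m orbT.
have inc : all increasing (map srt M).
  by apply/allP => _ /mapP[t tM ->]; have [] := Hs t tM.
exists (map srt M); split; rewrite ?size_map //.
rewrite /is_matching (perm_uniq P) uM andbT all_map; apply/allP => t tM /=.
have [/andP[i1 i2] _] := Hs t tM; rewrite symm_eq //; exact: (allP eM).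
Qed.

(** The edges partition {0, ..., 3s-1}. Repeated edges are kept in the sum so that it runs over
    exactly all ordered triples of vertices, whence the factor 6. *)
Lemma sum_triples n f s M : shifted_system n f -> perm_eq (verts M) (iota 0 (3 * s)) ->
  \sum_(t1 <- M) \sum_(t2 <- M) \sum_(t3 <- M) window_triples f (t1, t2, t3) = 6 * cnt f (3 * s).
Proof.
move=> Sf P; rewrite -(sum_symm3 _ Sf).
rewrite (sum_verts (fun u => \sum_(v < 3 * s) \sum_(w < 3 * s) symm f u v w) P).
apply: eq_bigr => t1 _.
under [RHS]eq_bigr => u _ do rewrite (sum_verts (fun v => \sum_(w < 3 * s) symm f u v w) P).
rewrite [RHS]exchange_big /=; apply: eq_bigr => t2 _.
under [RHS]eq_bigr => u _ do under eq_bigr => v _ do rewrite (sum_verts (fun w => symm f u v w) P).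
under [RHS]eq_bigr do rewrite exchange_big /=.
by rewrite [RHS]exchange_big.
Qed.

(** An ordered pair of edges occurs in three positions of the window, with s choices for the third
    edge, and every pair of vertices is met in two orders: 3 * s * 2 = 6s. *)
Lemma sum_pairs n f s X M : shifted_system n f -> perm_eq (verts M) (iota 0 (3 * s)) -> size M = s ->
  \sum_(t1 <- M) \sum_(t2 <- M) \sum_(t3 <- M) window_pairs f X (t1, t2, t3) =
  6 * s * \sum_(v < 3 * s) \sum_(u < v) symm f u v X.
Proof.
move=> Sf P sM; pose G2 t1 t2 := \sum_(u <- tv t1) \sum_(v <- tv t2) symm f u v X.
have E : \sum_(t1 <- M) \sum_(t2 <- M) G2 t1 t2 = 2 * \sum_(v < 3 * s) \sum_(u < v) symm f u v X.
  rewrite -(@sum_symm2 (fun u v => symm f u v X)); last 2 first.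
  - by move=> u v; rewrite symmC12.
  - by move=> u; apply/negP => /(symm_bound Sf)[_ _ _]; rewrite /= !inE eqxx.
  rewrite (sum_verts (fun u => \sum_(v < 3 * s) symm f u v X) P); apply: eq_bigr => t1 _.
  under [RHS]eq_bigr => u _ do rewrite (sum_verts (fun v => symm f u v X) P).
  by rewrite [RHS]exchange_big.
have E1 : \sum_(t1 <- M) \sum_(t2 <- M) \sum_(t3 <- M) G2 t1 t2 = s * (\sum_(t1 <- M) \sum_(t2 <- M) G2 t1 t2).
  under eq_bigr do under eq_bigr do rewrite sum_const_seq sM.
  by rewrite big_distrr; apply: eq_bigr => t _; rewrite big_distrr.
have E2 : \sum_(t1 <- M) \sum_(t2 <- M) \sum_(t3 <- M) G2 t1 t3 = s * (\sum_(t1 <- M) \sum_(t2 <- M) G2 t1 t2).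
  under eq_bigr do rewrite sum_const_seq sM.
  by rewrite big_distrr.
have E3 : \sum_(t1 <- M) \sum_(t2 <- M) \sum_(t3 <- M) G2 t2 t3 = s * (\sum_(t1 <- M) \sum_(t2 <- M) G2 t1 t2).
  by rewrite sum_const_seq sM.
have -> : \sum_(t1 <- M) \sum_(t2 <- M) \sum_(t3 <- M) window_pairs f X (t1, t2, t3) =
  \sum_(t1 <- M) \sum_(t2 <- M) \sum_(t3 <- M) G2 t1 t2
  + \sum_(t1 <- M) \sum_(t2 <- M) \sum_(t3 <- M) G2 t1 t3
  + \sum_(t1 <- M) \sum_(t2 <- M) \sum_(t3 <- M) G2 t2 t3.
  rewrite -!big_split; apply: eq_bigr => t1 _; rewrite -!big_split; apply: eq_bigr => t2 _.
  by rewrite -!big_split.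
by rewrite E1 E2 E3 E; lia.
Qed.

(** [tau] exceeds by one the possible number of disjoint obstructed windows, so at most 3 tau edges
    hit all of them; X leaves 24 fresh vertices for each of [tau] windows. An exceptional window has
    T, P <= 27, which overshoots the two bounds by 15 * 27 + 8 * 27 - 405 = 216 and 27 - 18 = 9. *)
Lemma windows_count n f s M B : shifted_system n f -> matching_le f s -> is_matching f M -> size M = s ->
  perm_eq (verts M) (iota 0 (3 * s)) -> all increasing M -> 0 < B ->
  let tau := 6 * (B + (n %/ B).+1 ^ 3) + 1 in
  let X := 3 * s + 24 * tau in
  let G := \sum_(v < 3 * s) \sum_(u < v) f u v X in
  let err := 3 * s ^ 2 * (3 * tau + 1) in
  90 * cnt f (3 * s) + 48 * s * G <= 405 * s ^ 3 + 216 * err /\ 6 * s * G <= 18 * s ^ 3 + 9 * err.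
Proof.
move=> Sf Hs HM sM P iM B0 tau X G err.
have uM := uniq_matching HM.
have vM v : v \in verts M -> v < 3 * s by rewrite (perm_mem P) mem_iota.
have GE : G = \sum_(v < 3 * s) \sum_(u < v) symm f u v X.
  by apply: eq_bigr => v _; apply: eq_bigr => u _; rewrite symm_eq // /X ltn_addr.
have [[W [sW UW WM oW]]|[S [sS HS]]] := disjoint_or_hit (obstructed f X) M tau.
  have := few_disjoint_windows Sf Hs HM sM vM B0 UW WM oW.
  by rewrite sW => /(_ (leqnn _)); rewrite /tau; lia.
pose bad (t1 t2 t3 : tri) := ~~ uniq [:: t1; t2; t3] || has (mem S) [:: t1; t2; t3].
have Hbad : \sum_(t1 <- M) \sum_(t2 <- M) \sum_(t3 <- M) bad t1 t2 t3 <= err.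
  apply: leq_trans (few_exceptions (S := S) (bad := bad) uM _) _.
    move=> t1 t2 t3; rewrite /bad /= !inE negb_and negbK negb_or.
    by case: (t1 == t2); case: (t1 == t3); case: (t2 == t3); case: (t1 \in S); case: (t2 \in S); case: (t3 \in S).
  by rewrite sM /err leq_mul2l addn1 ltnS sS orbT.
have b9 (F : nat -> nat -> bool) t1 t2 : \sum_(u <- tv t1) \sum_(v <- tv t2) F u v <= 9.
  by rewrite !big_cons !big_nil; do 9 case: (F _ _).
have w27 (t1 t2 t3 : tri) : window_triples f (t1, t2, t3) <= 27.
  rewrite /window_triples /=; apply: (@leq_trans (\sum_(u <- tv t1) 9)).
    by apply: leq_sum => u _; apply: b9.
  by rewrite sum_const_seq.
have p27 (t1 t2 t3 : tri) : window_pairs f X (t1, t2, t3) <= 27.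
  exact: (leq_add (leq_add (b9 (fun u v => symm f u v X) t1 t2) (b9 _ t1 t3)) (b9 _ t2 t3)).
have Hw (t1 t2 t3 : tri) : t1 \in M -> t2 \in M -> t3 \in M ->
    15 * window_triples f (t1, t2, t3) + 8 * window_pairs f X (t1, t2, t3) <= 405 + 216 * bad t1 t2 t3 /\
    window_pairs f X (t1, t2, t3) <= 18 + 9 * bad t1 t2 t3.
  move=> m1 m2 m3; have := w27 t1 t2 t3; have := p27 t1 t2 t3.
  case: (boolP (bad t1 t2 t3)) => [_ h1 h2|]; first by rewrite !muln1; split; clear -h1 h2; lia.
  rewrite negb_or negbK => /andP[u3 nS] _ _.
  have sub : {subset wl (t1, t2, t3) <= M} by move=> t; rewrite !inE => /or3P[]/eqP->.
  have := @good_window n f X (t1, t2, t3) Sf; rewrite !muln0 !addn0; apply.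
  - by apply/allP => t /sub tM; have /andP[/allP /(_ _ tM)] := HM.
  - by apply/allP => t /sub tM; exact: (allP iM).
  - exact: uniq_verts_sub HM sub u3.
  - move=> v /flattenP[_ /mapP[t tw ->] vt]; apply: ltn_addr; apply: vM.
    exact: mem_verts (sub _ tw) vt.
  - by apply: contra nS => ob; exact: (HS (t1, t2, t3)).
have sumB c d : \sum_(t1 <- M) \sum_(t2 <- M) \sum_(t3 <- M) (c + d * bad t1 t2 t3) <= c * s ^ 3 + d * err.
  have -> : \sum_(t1 <- M) \sum_(t2 <- M) \sum_(t3 <- M) (c + d * bad t1 t2 t3) =
     \sum_(t1 <- M) \sum_(t2 <- M) \sum_(t3 <- M) c + d * \sum_(t1 <- M) \sum_(t2 <- M) \sum_(t3 <- M) bad t1 t2 t3.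
    rewrite big_distrr -big_split; apply: eq_bigr => t1 _; rewrite big_distrr -big_split; apply: eq_bigr => t2 _.
    by rewrite big_distrr -big_split.
  rewrite !sum_const_seq sM leq_add ?leq_mul2l ?Hbad ?orbT // !expnS expn0; lia.
split.
- have -> : 90 * cnt f (3 * s) + 48 * s * G = 15 * (6 * cnt f (3 * s)) + 8 * (6 * s * G) by lia.
  rewrite -(sum_triples Sf P) GE -(sum_pairs X Sf P sM).
  apply: leq_trans (sumB 405 216).
  rewrite !big_distrr -big_split [leqRHS]big_seq [leqLHS]big_seq; apply: leq_sum => t1 m1.
  rewrite !big_distrr -big_split [leqRHS]big_seq [leqLHS]big_seq; apply: leq_sum => t2 m2.
  rewrite !big_distrr -big_split [leqRHS]big_seq [leqLHS]big_seq; apply: leq_sum => t3 m3.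
  by have [] := Hw t1 t2 t3 m1 m2 m3.
- rewrite GE -(sum_pairs X Sf P sM); apply: leq_trans (sumB 18 9).
  rewrite [leqRHS]big_seq [leqLHS]big_seq; apply: leq_sum => t1 m1.
  rewrite [leqRHS]big_seq [leqLHS]big_seq; apply: leq_sum => t2 m2.
  rewrite [leqRHS]big_seq [leqLHS]big_seq; apply: leq_sum => t3 m3.
  by have [] := Hw t1 t2 t3 m1 m2 m3.
Qed.

(** * Counting edges *)

Definition link_cnt (f : nat -> nat -> nat -> bool) (z N : nat) : nat :=
  \sum_(y < N) \sum_(x < y) f x y z.

Lemma cntS f n : cnt f n.+1 = cnt f n + link_cnt f n n.
Proof. by rewrite /cnt big_ord_recr. Qed.

Lemma link_cntS f z N : link_cnt f z N.+1 = link_cnt f z N + \sum_(x < N) f x N z.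
Proof. by rewrite /link_cnt big_ord_recr. Qed.

Lemma sum_bool_le N (F : nat -> bool) : \sum_(x < N) F x <= N.
Proof.
by apply: (@leq_trans (\sum_(x < N) 1)); [apply: leq_sum => x _; exact: leq_b1 | rewrite sum1_card card_ord].
Qed.

Lemma link_cnt_le f z N : link_cnt f z N <= 'C(N, 2).
Proof.
elim: N => [|N IH]; first by rewrite /link_cnt big_ord0.
by rewrite link_cntS binS bin1 leq_add // (@sum_bool_le N (fun x => f x N z)).
Qed.

Lemma cnt_le f n : cnt f n <= 'C(n, 3).
Proof.
elim: n => [|n IH]; first by rewrite /cnt big_ord0.
by rewrite cntS binS leq_add // link_cnt_le.
Qed.

Lemma bin2E N : 2 * 'C(N, 2) = N * (N - 1).
Proof. by elim: N => // N IH; rewrite binS bin1 mulnDr IH; case: N {IH} => // N; rewrite !subSS !subn0; nia. Qed.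

Lemma bin3E N : 6 * 'C(N, 3) = N * (N - 1) * (N - 2).
Proof.
elim: N => // N IH; have e : 6 * 'C(N, 2) = 3 * (N * (N - 1)) by rewrite -bin2E mulnA.
rewrite binS mulnDr IH e.
by case: N {IH e} => [|[|N]] //; rewrite !subSS !subn0; nia.
Qed.

Lemma link_cnt_anti n f z z' N : shifted_system n f -> z <= z' -> N <= z -> link_cnt f z' N <= link_cnt f z N.
Proof.
move=> [_ Hm] zz Nz; apply: leq_sum => y _; apply: leq_sum => x _.
case: (boolP (f x y z')) => // H; rewrite (Hm _ _ _ _ _ _ H) //.
exact: leq_trans (ltn_ord y) Nz.
Qed.

Lemma link_cnt_cut (f : nat -> nat -> nat -> bool) z N N' : N <= N' -> (forall x y, f x y z -> y < N) -> link_cnt f z N' = link_cnt f z N.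
Proof.
move=> NN H; rewrite -(subnKC NN); elim: (N' - N) => [|k IH]; first by rewrite addn0.
rewrite addnS link_cntS IH big1 ?addn0 // => x _; case E: (f _ _ _) => //.
by have := H _ _ E; rewrite ltnNge leq_addr.
Qed.

Lemma cnt_split f N n : N <= n -> cnt f n = cnt f N + \sum_(i < n - N) link_cnt f (N + i) (N + i).
Proof.
move=> Nn; rewrite -{1}(subnKC Nn); elim: (n - N) => [|k IH]; first by rewrite big_ord0 !addn0.
by rewrite addnS cntS IH big_ord_recr /= addnA.
Qed.

(** From X on, the links inside [0, 3s) are no larger than that of X; the X - 3s vertices before it
    get the trivial bound. The only other possible middle vertex is 3s itself, which adds at most 3s
    edges per top vertex. *)
Lemma cnt_outside n f s X : shifted_system n f -> (forall x y z, f x y z -> y <= 3 * s) ->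
  3 * s <= X -> 3 * s <= n ->
  cnt f n <= cnt f (3 * s) + (n - 3 * s) * link_cnt f X (3 * s)
    + (X - 3 * s) * 'C(3 * s, 2) + (n - 3 * s) * (3 * s).
Proof.
move=> Sf Hy HX Hn; rewrite (cnt_split _ Hn) -!addnA leq_add2l.
have bnd i : link_cnt f (3 * s + i) (3 * s + i) <=
    link_cnt f X (3 * s) + (3 * s + i < X) * 'C(3 * s, 2) + 3 * s.
  apply: (@leq_trans (link_cnt f (3 * s + i) (3 * s) + 3 * s)).
    case: i => [|i]; first by rewrite addn0 leq_addr.
    rewrite (@link_cnt_cut _ _ (3 * s).+1); first by rewrite link_cntS leq_add2l (@sum_bool_le (3 * s) (fun x => f x (3 * s) _)).
      by rewrite addnS ltnS leq_addr.
    by move=> x y /Hy.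
  rewrite leq_add2r; case: ltnP => h /=; rewrite ?mul1n ?mul0n ?addn0.
    by rewrite (leq_trans (link_cnt_le _ _ _)) // leq_addl.
  exact: (link_cnt_anti Sf h HX).
apply: (@leq_trans (\sum_(i < n - 3 * s) (link_cnt f X (3 * s) + (3 * s + i < X) * 'C(3 * s, 2) + 3 * s))).
  by apply: leq_sum => i _; exact: bnd.
rewrite big_split big_split /= !sum_nat_const card_ord -addnA leq_add2l leq_add2r -big_distrl /= leq_mul2r.
apply/orP; right; move: (n - 3 * s) => k.
have -> : forall k, \sum_(i < k) (3 * s + i < X) = minn k (X - 3 * s).
  elim=> [|m IH]; first by rewrite big_ord0 min0n.
  by rewrite big_ord_recr /= IH; lia.
exact: geq_minr.
Qed.

(** All errors are to stay below s^3 / E. With blocks of length s %/ D and n <= C0 * s the number of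
    blocks is bounded, so that tau <= 7s / D and err <= 66 s^3 / D; D = 66 * 216 * E then
    compensates the factor 216 of the window count. *)
Lemma asymptotics E C0 : 0 < E -> exists s0, forall s n f M, s0 <= s -> n <= C0 * s ->
  shifted_system n f -> matching_le f s -> is_matching f M -> size M = s -> 3 * s <= n ->
  (forall x y z, f x y z -> y <= 3 * s) ->
  exists G, [/\ E * (90 * cnt f (3 * s) + 48 * (s * G)) <= (405 * E + 1) * s ^ 3,
    E * (6 * (s * G)) <= (18 * E + 1) * s ^ 3 &
    E * cnt f n <= E * (cnt f (3 * s) + (n - 3 * s) * G) + s ^ 3].
Proof.
move=> E0; have [D DE] : {D | D = 66 * (216 * E)} by exists (66 * (216 * E)).
pose A0 := (2 * C0 * D).+1 ^ 3.
have D0 : 0 < D by rewrite DE !muln_gt0.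
exists (D * (6 * A0 + 2) + 6 * C0 * E) => s n f M s_ge nC Sf Hs HM0 sM0 Hn Hy.
have [M1 [HM1 sM1 P1]] := compress Sf HM0.
have [M2 [HM2 sM2 P2 iM2]] := increasing_matching HM1.
have sM : size M2 = s by rewrite sM2 sM1.
have P : perm_eq (verts M2) (iota 0 (3 * s)) by rewrite (perm_trans P2) // -sM0.
pose B := s %/ D.
have sD : D * (6 * A0 + 2) <= s by apply: leq_trans s_ge; exact: leq_addr.
have sC : 6 * C0 * E <= s by apply: leq_trans s_ge; exact: leq_addl.
have s_gt : D <= s by apply: leq_trans sD; rewrite leq_pmulr // addnS.
have B0 : 0 < B by rewrite divn_gt0.
have BD : D * B <= s by rewrite mulnC leq_divM.
have sB : s < 2 * (D * B).
  have := ltn_ceil s D0; rewrite -/B mulSn mulnC => h.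
  by have := leq_mul (leqnn D) B0; move: h; clear; lia.
have nB : n %/ B <= 2 * C0 * D.
  rewrite -(leq_pmul2r B0); apply: leq_trans (leq_divM _ _) _.
  apply: (leq_trans nC); have := leq_mul (leqnn C0) (ltnW sB).
  by rewrite !mulnA [2 * C0]mulnC.
have [A Adef] : {A | A = (n %/ B).+1 ^ 3} by exists ((n %/ B).+1 ^ 3).
have AA0 : A <= A0 by rewrite Adef leq_exp2r.
have [tau tauE] : {tau | tau = 6 * (B + A) + 1} by exists (6 * (B + A) + 1).
have tauD : D * tau <= 7 * s.
  have : tau <= 6 * B + (6 * A0 + 2) by rewrite tauE; clear -AA0; lia.
  move=> h; apply: (leq_trans (leq_mul (leqnn D) h)); rewrite mulnDr mulnCA.
  by move: (D * B) (D * (6 * A0 + 2)) BD sD => p q; clear; lia.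
have [H1 H2] := windows_count Sf Hs HM2 sM P iM2 B0.
rewrite -Adef -tauE in H1 H2.
have [G GE] : {G | G = link_cnt f (3 * s + 24 * tau) (3 * s)} by exists (link_cnt f (3 * s + 24 * tau) (3 * s)).
exists G.
rewrite -[\sum_(v < 3 * s) _]/(link_cnt f (3 * s + 24 * tau) (3 * s)) -GE in H1 H2.
have [q qE] : {q | q = s ^ 2} by exists (s ^ 2).
have s3 : s ^ 3 = s * q by rewrite qE expnS.
have [err errE] : {err | err = 3 * q * (3 * tau + 1)} by exists (3 * q * (3 * tau + 1)).
rewrite -qE -errE in H1 H2; rewrite s3 in H1 H2 *.
have errD : D * err <= 66 * (s * q).
  have -> : D * err = 3 * q * (3 * (D * tau) + D) by rewrite errE; clear; lia.
  have -> : 66 * (s * q) = 3 * q * (22 * s) by clear; lia.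
  rewrite leq_mul2l; apply/orP; right; move: (D * tau) tauD s_gt => p; clear; lia.
have errE' : E * (216 * err) <= s * q.
  by move: errD; rewrite DE; clear; move: (s * q) => p; lia.
split.
- have := leq_mul (leqnn E) H1; move: errE'; clear; lia.
- have := leq_mul (leqnn E) H2; move: errE'; clear; lia.
- have H := @cnt_outside n f s (3 * s + 24 * tau) Sf Hy (leq_addr _ _) Hn.
  rewrite -GE addKn in H.
  have := leq_mul (leqnn E) H; rewrite mulnDr mulnDr => H'.
  apply: leq_trans H' _; rewrite -addnA leq_add2l.
  have b2 : 2 * 'C(3 * s, 2) <= 9 * q.
    by rewrite bin2E qE !expnS expn0; clear; nia.
  have t1 : 2 * (E * (24 * tau * 'C(3 * s, 2))) <= s * q.
    have e2 : 24 * (E * tau) * (2 * 'C(3 * s, 2)) <= 24 * (E * tau) * (9 * q) by rewrite leq_mul2l b2 orbT.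
    have e3 : 216 * (E * tau) <= s.
      by move: tauD; rewrite DE -!mulnA; move: (E * tau) => p; clear; lia.
    have := leq_mul e3 (leqnn q); move: e2; clear; lia.
  have t2 : 2 * (E * ((n - 3 * s) * (3 * s))) <= s * q.
    have e1 : n - 3 * s <= C0 * s by move: nC; clear; lia.
    have e3 := leq_mul e1 (leqnn (3 * s)).
    have e4 := leq_mul sC (leqnn q).
    have e5 : C0 * s * (3 * s) = 3 * C0 * q by rewrite qE !expnS expn0; clear; lia.
    have e6 := leq_mul (leqnn (2 * E)) e3.
    move: e4 e6; rewrite e5; clear; lia.
  move: t1 t2; rewrite mulnDr; clear; lia.
Qed.

(** * Families close to a clique *)

Lemma pairs_hitting (U : seq nat) N :
  \sum_(y < N) \sum_(x < y) (((x : nat) \in U) || ((y : nat) \in U)) <= size U * N.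
Proof.
elim: U => [|u U IH]; first by rewrite big1 // => y _; rewrite big1.
have one : \sum_(y < N) \sum_(x < y) ((x == u :> nat) + (y == u :> nat)) <= N.
  have -> : \sum_(y < N) \sum_(x < y) ((x == u :> nat) + (y == u :> nat)) = (u < N) * N.-1.
    elim: (N) => [|K IHK]; first by rewrite big_ord0.
    rewrite big_ord_recr /= IHK big_split /= sum_nat_const card_ord.
    have -> : \sum_(x < K) (x == u :> nat) = (u < K).
      elim: (K) => [|K' IHK']; first by rewrite big_ord0.
      by rewrite big_ord_recr /= IHK'; lia.
    by case: (ltngtP u K) => /=; case: (K) => //= ?; lia.
  by case: (u < N) => //; rewrite mul1n leq_pred.
rewrite /= mulSn; apply: leq_trans (leq_add one IH).
rewrite -big_split; apply: leq_sum => y _; rewrite -big_split; apply: leq_sum => x _ /=.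
by rewrite !inE; case: (x == u :> nat); case: (y == u :> nat); case: (_ \in U); case: (_ \in U).
Qed.

Lemma pick_pair f z N (U : seq nat) : size U * N < link_cnt f z N ->
  exists x y, [/\ x < y < N, f x y z, x \notin U & y \notin U].
Proof.
move=> H; pose P (y : 'I_N) := [exists x : 'I_y, [&& f x y z, (x : nat) \notin U & (y : nat) \notin U]].
case: (boolP [exists y, P y]) => [/existsP[y /existsP[x /and3P[h1 h2 h3]]]|].
  by exists x, y; rewrite h1 h2 h3 !ltn_ord.
move=> /existsPn nP; move: H; rewrite ltnNge => /negP[].
apply: leq_trans (pairs_hitting U N); apply: leq_sum => y _; apply: leq_sum => x _.
have /existsPn/(_ x) := nP y.
by case: (f _ _ _); case: (_ \in U); case: (_ \in U).
Qed.

Definition tri_pair (t : tri) : seq nat := [:: t.1.1; t.1.2].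
Definition pair_verts (M : seq tri) : seq nat := flatten (map tri_pair M).

(** At most k vertices are blocked before each choice, even the last, and they meet at most k * N
    pairs, fewer than the link contains. *)
Lemma greedy_pairs f N k (zs U : seq nat) : (forall z, z \in zs -> k * N < link_cnt f z N) ->
  size U + 2 * (size zs).-1 <= k ->
  exists P : seq tri, [/\ map snd P = zs, all (fun t => f t.1.1 t.1.2 t.2) P,
    all (fun v => v < N) (pair_verts P), uniq (pair_verts P) & ~~ has (mem U) (pair_verts P)].
Proof.
elim: zs U => [|z zs IH] U Hz Hk; first by exists [::].
have [|x [y [/andP[xy yN] fxy xU yU]]] := @pick_pair f z N U.
  apply: leq_ltn_trans (Hz z (mem_head _ _)); rewrite leq_mul2r; apply/orP; right.
  by apply: leq_trans Hk; exact: leq_addr.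
case: (posnP (size zs)) => [/eqP /nilP ->|zs0].
  exists [:: (x, y, z)]; split => //=; rewrite ?fxy ?(ltn_trans xy yN) ?yN ?inE //.
    by rewrite andbT neq_ltn xy.
  by rewrite !negb_or xU yU.
have [||P [P1 P2 P3 P4 P5]] := IH [:: x, y & U].
- by move=> z' z'z; apply: Hz; rewrite inE z'z orbT.
- by move: Hk zs0 => /=; clear; lia.
exists ((x, y, z) :: P); split.
- by rewrite /= P1.
- by rewrite /= fxy.
- by rewrite /= (ltn_trans xy yN) yN.
- rewrite [pair_verts _]/= -/(pair_verts P) /= P4 andbT inE negb_or neq_ltn xy /=.
  by apply/andP; split; apply: contra P5 => h; apply/hasP; eexists; try exact: h; rewrite /= !inE eqxx ?orbT.
- rewrite [pair_verts _]/= -/(pair_verts P) /= !negb_or xU yU /=.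
  apply: contra P5 => /hasP[v vP vU]; apply/hasP; exists v => //=.
  by rewrite !inE (vU : v \in U) !orbT.
Qed.

Lemma verts_pairs P : perm_eq (verts P) (pair_verts P ++ map snd P).
Proof.
elim: P => // t P IH; apply/seq.permP => p; have /seq.permP/(_ p) := IH.
have -> : pair_verts (t :: P) ++ map snd (t :: P) = t.1.1 :: t.1.2 :: (pair_verts P ++ t.2 :: map snd P) by [].
rewrite verts_cons count_cat !count_cat => -> /=; rewrite count_cat /=; lia.
Qed.

Lemma chunk (R : seq nat) : exists C : seq tri, size C = size R %/ 3 /\ subseq (verts C) R.
Proof.
elim: {R}(size R) {-2}R (leqnn (size R)) => [|k IH] R.
  by rewrite leqn0 size_eq0 => /eqP->; exists [::].
case: R => [|x [|y [|z R]]] sR; try by exists [::]; rewrite sub0seq.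
have [|C [sC subC]] := IH R; first by move: sR => /=; lia.
exists ((x, y, z) :: C); split.
  by rewrite /= sC -[in RHS]addn3 divnDr // addn1.
by rewrite verts_cons /= !eqxx.
Qed.

Lemma clique_symm n f N a b c : shifted_system n f -> f (N - 3) (N - 2) (N - 1) ->
  a < N -> b < N -> c < N -> uniq [:: a; b; c] -> symm f a b c.
Proof.
move=> [_ Hm] H aN bN cN; rewrite /= !inE negb_or => U.
by rewrite /symm; apply: Hm H _ _ _ _ _; lia.
Qed.

(* With few vertices above [N] of small degree into the clique [0, N), a graph
   of pairs that extend to edges outside [0, 3 s + 2) is small: otherwise b + 1
   such pairs, pairs for the remaining vertices above [N] and triples of the
   clique form a matching of size s + 1. *)
Lemma outer_link_le n f s N b q z : shifted_system n f -> matching_le f s ->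
  f (N - 3) (N - 2) (N - 1) -> N <= 3 * s + 2 - b ->
  (forall v, N <= v < 3 * s + 2 - b -> q * N < link_cnt f v N) ->
  2 * (b + 1) + 2 * (3 * s + 2 - N) <= q -> 3 * b <= s ->
  3 * s + 2 + b <= z -> link_cnt f z (3 * s + 1) <= 2 * b * (3 * s + 1).
Proof.
move=> Sf Hs Hcl HN Hgood Hq bs zb; rewrite leqNgt; apply/negP => Hz.
have [||A [A1 A2 A3 A4 A5]] := @greedy_pairs f (3 * s + 1) (2 * b) (iota (3 * s + 2) b.+1) [::].
- move=> z'; rewrite mem_iota => hz'; apply: leq_trans Hz _; apply: (link_cnt_anti Sf); lia.
- by rewrite size_iota.
have sA : size A = b.+1 by rewrite -(size_map snd) A1 size_iota.
have spA (P : seq tri) : size (pair_verts P) = 2 * size P.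
  by elim: P => // t P IH; rewrite [pair_verts _]/= -/(pair_verts P) /= IH; lia.
pose H := [seq v <- iota N (3 * s + 2 - b - N) | v \notin pair_verts A].
have sH : size H <= 3 * s + 2 - N by rewrite size_filter (leq_trans (count_size _ _)) // size_iota; lia.
have [||P [P1 P2 P3 P4 P5]] := @greedy_pairs f N q H (pair_verts A).
- by move=> v; rewrite mem_filter mem_iota => /andP[_ hv]; apply: Hgood; lia.
- by rewrite spA sA; move: (size H) sH Hq => h; clear; lia.
have sP : size P = size H by rewrite -(size_map snd) P1.
pose R := [seq v <- iota 0 N | v \notin pair_verts A ++ pair_verts P].
have [C [sC subC]] := chunk R.
have CR v : v \in verts C -> v \in R by exact: (mem_subseq subC).
have UC : uniq (verts C) by apply: subseq_uniq subC _; rewrite filter_uniq // iota_uniq.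
have permV : perm_eq (verts (A ++ P ++ C)) ((pair_verts A ++ iota (3 * s + 2) b.+1) ++ (pair_verts P ++ H) ++ verts C).
  by rewrite !verts_cat perm_cat // -?A1 ?verts_pairs // perm_cat // -P1 verts_pairs.
have HM : is_matching f (A ++ P ++ C).
  rewrite /is_matching; apply/andP; split.
    rewrite !all_cat; apply/and3P; split.
    - apply/allP => t /(allP A2) H1; have [Hv _] := Sf.
      by have /and3P[? ? _] := Hv _ _ _ H1; rewrite symm_eq.
    - apply/allP => t /(allP P2) H1; have [Hv _] := Sf.
      by have /and3P[? ? _] := Hv _ _ _ H1; rewrite symm_eq.
    - apply/allP => t tC; have lt v : v \in tv t -> v < N.
        by move=> vt; have := CR v (mem_verts tC vt); rewrite mem_filter mem_iota => /andP[_].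
      apply: (clique_symm Sf Hcl); try by apply: lt; rewrite !inE eqxx ?orbT.
      exact: (uniq_tv UC tC).
  rewrite (perm_uniq permV) cat_uniq; apply/and3P; split.
  - rewrite cat_uniq A4 iota_uniq andbT; apply/hasPn => v; rewrite mem_iota => hv.
    by apply/negP => /(allP A3); move: hv; clear; lia.
  - apply/hasPn => v; rewrite !mem_cat => hv; apply/negP; rewrite mem_iota => /orP[vA|v2].
      case/orP: hv => [/orP[vP|]|].
      + by case/hasP: P5; exists v.
      + by rewrite mem_filter vA.
      + by move/CR; rewrite mem_filter mem_cat vA.
    case/orP: hv => [/orP[/(allP P3)|]|].
    + by move: v2 HN; clear; lia.
    + by rewrite mem_filter mem_iota => /andP[_]; move: v2 HN; clear; lia.
    + by move/CR; rewrite mem_filter mem_iota => /andP[_]; move: v2 HN; clear; lia.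
  - rewrite cat_uniq UC andbT; apply/andP; split.
      rewrite cat_uniq P4 filter_uniq ?iota_uniq // andbT; apply/hasPn => v.
      rewrite mem_filter mem_iota => /andP[_ hv]; apply/negP => /(allP P3); move: hv; clear; lia.
    apply/hasPn => v /CR; rewrite mem_filter mem_cat negb_or mem_iota => /andP[/andP[_ nP] vN].
    apply/negP; rewrite /= mem_cat (negbTE nP) /= mem_filter mem_iota => /andP[_]; move: vN; clear; lia.
have := Hs _ HM; rewrite !size_cat sA sP sC.
(* Among the 3s + 2 - b low vertices, [A] uses at most 2(b + 1) and each vertex of [H] with its pair
   accounts for three. At least 3(s - b - |H|) remain for [C], so the sizes add up to (b + 1) + |H|
   + (s - b - |H|) = s + 1. *)
have cnt1 : 3 * s + 2 - b <= size H + size (pair_verts A) + size (pair_verts P) + size R.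
  have : size (iota 0 (3 * s + 2 - b)) <= size (H ++ pair_verts A ++ pair_verts P ++ R).
    apply: uniq_leq_size (iota_uniq _ _) _ => v; rewrite mem_iota add0n => /= hv.
    rewrite !mem_cat /H /R !mem_filter mem_cat !mem_iota.
    case: (boolP (v \in pair_verts A)) => //=; rewrite ?orbT //.
    case: (boolP (v \in pair_verts P)) => //=; rewrite ?orbT //.
    by move=> _ _; move: hv HN; clear; lia.
  by rewrite size_iota !size_cat !addnA.
move: cnt1; rewrite !spA sA sP; move: (size H) (size R) bs; clear; lia.
Qed.

Lemma link_cnt_eq0 (f : nat -> nat -> nat -> bool) z N x y : link_cnt f z N = 0 -> x < y -> y < N -> f x y z = false.
Proof.
move=> /eqP; rewrite sum_nat_eq0 => /forallP H xy yN; have := H (Ordinal yN).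
by rewrite /= sum_nat_eq0 => /forallP /(_ (Ordinal xy)) /=; case: (f _ _ _).
Qed.

Lemma cnt_eq0 (f : nat -> nat -> nat -> bool) n x y z : cnt f n = 0 -> x < y -> y < z -> z < n -> f x y z = false.
Proof.
move=> /eqP; rewrite sum_nat_eq0 => /forallP H xy yz zn; have := H (Ordinal zn).
by move=> /= /eqP /link_cnt_eq0; apply.
Qed.

Lemma link_cntC f z N : link_cnt f z N + link_cnt (fun x y z => ~~ f x y z) z N = 'C(N, 2).
Proof.
elim: N => [|N IH]; first by rewrite /link_cnt !big_ord0.
rewrite !link_cntS addnACA IH binS bin1; congr (_ + _); rewrite -big_split /=.
by rewrite (eq_bigr (fun=> 1)) ?sum1_card ?card_ord // => x _; case: (f _ _ _).
Qed.

Lemma cntC f n : cnt f n + cnt (fun x y z => ~~ f x y z) n = 'C(n, 3).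
Proof.
elim: n => [|n IH]; first by rewrite /cnt !big_ord0.
by rewrite !cntS addnACA IH link_cntC binS.
Qed.

Lemma cnt_full (f : nat -> nat -> nat -> bool) n x y z : cnt f n = 'C(n, 3) ->
  x < y -> y < z -> z < n -> f x y z.
Proof.
move=> H xy yz zn; have := cntC f n; rewrite H => E.
have E0 : cnt (fun x y z => ~~ f x y z) n = 0 by lia.
by have := cnt_eq0 E0 xy yz zn; case: (f _ _ _).
Qed.

Lemma cnt_first_lt (f : nat -> nat -> nat -> bool) a n : (forall x y z, f x y z -> x < a) -> cnt f n + 'C(n - a, 3) <= 'C(n, 3).
Proof.
move=> Ha.
have row N y z : \sum_(x < N) f x y z + (N - a) <= N.
  elim: N => [|N IH]; first by rewrite big_ord0.
  have -> : \sum_(x < N.+1) f x y z = \sum_(x < N) f x y z + f N y z by rewrite big_ord_recr.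
  move: (Ha N y z) IH; case: (f N y z) => [/(_ isT)|_]; move: (\sum_(x < N) f x y z) => S /=; lia.
have link z N : link_cnt f z N + 'C(N - a, 2) <= 'C(N, 2).
  elim: N => [|N IH]; first by rewrite /link_cnt big_ord0.
  rewrite link_cntS [X in _ <= X]binS bin1; have := row N N z.
  case: (leqP a N) => h; first by rewrite subSn // binS bin1; lia.
  by rewrite (_ : N.+1 - a = 0) ?bin0n; lia.
elim: n => [|n IH]; first by rewrite /cnt big_ord0.
rewrite cntS [X in _ <= X]binS; have := link n n.
case: (leqP a n) => h; first by rewrite subSn // binS; lia.
by rewrite (_ : n.+1 - a = 0) ?bin0n; lia.
Qed.

Lemma link_cnt_grow f z N k : link_cnt f z (N + k) + 'C(N, 2) <= 'C(N + k, 2) + link_cnt f z N.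
Proof.
elim: k => [|k IH]; first by rewrite addn0 addnC.
rewrite addnS link_cntS binS bin1; have := @sum_bool_le (N + k) (fun x => f x (N + k) z); lia.
Qed.

Lemma cnt_deficit f K b d : (forall v, K <= v < K + b -> link_cnt f v v + d <= 'C(v, 2)) ->
  cnt f (K + b) + b * d <= 'C(K + b, 3).
Proof.
elim: b => [|b IH] H; first by rewrite addn0 mul0n addn0 cnt_le.
have h1 : link_cnt f (K + b) (K + b) + d <= 'C(K + b, 2) by apply: H; lia.
have h2 : cnt f (K + b) + b * d <= 'C(K + b, 3) by apply: IH => v hv; apply: H; lia.
by rewrite addnS cntS binS mulSn; move: h1 h2; clear; lia.
Qed.

(* [1000 * 1000] stands for a large constant that unary numerals cannot hold. *)
Lemma near_clique n f s : 1000 <= s -> shifted_system n f -> matching_le f s ->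
  (forall x y z, f x y z -> y <= 3 * s) -> 3 * s + 2 <= n -> 2 * (n - 3 * s) <= s ->
  9 * (1000 * 1000 * s ^ 3) <= 2 * (1000 * 1000 * cnt f (3 * s)) + 34 * s ^ 3 ->
  cnt f n <= 'C(3 * s + 2, 3) /\
  (cnt f n = 'C(3 * s + 2, 3) ->
     forall x y z, x < y -> y < z -> z < n -> f x y z = (z < 3 * s + 2)).
Proof.
move=> s_ge Sf Hs Hy Hn Hm HF; pose r := s %/ 20; pose q := s %/ 8; pose N := 3 * s - r.
have r1 : 20 * r <= s by rewrite mulnC leq_divM.
have r2 : s < 20 * r + 20 by have := ltn_ceil s (isT : 0 < 20); rewrite -/r; lia.
have q1 : 8 * q <= s by rewrite mulnC leq_divM.
have q2 : s < 8 * q + 8 by have := ltn_ceil s (isT : 0 < 8); rewrite -/q; lia.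
have NE : N + r = 3 * s by rewrite /N; lia.
clearbody r q N.
have b3 K : 6 * 'C(K, 3) = K * (K - 1) * (K - 2) := bin3E K.
have b2 K : 2 * 'C(K, 2) = K * (K - 1) := bin2E K.
have [_ Hm'] := Sf.
(* Were this triple missing, every edge would have a vertex below N - 3, so all C(r + 3, 3) >= s^3 /
   48000 triples of [N - 3, 3s) would be missing. The density hypothesis tolerates only 17 s^3 /
   10^6. *)
have Hcl : f (N - 3) (N - 2) (N - 1).
  case: (boolP (f _ _ _)) => // nf; exfalso.
  have H : cnt f (3 * s) + 'C(3 * s - (N - 3), 3) <= 'C(3 * s, 3).
    apply: cnt_first_lt => x y z H; rewrite ltnNge; apply: contra nf => hx.
    have /and3P[xy yz _] := Sf.1 _ _ _ H.
    by apply: (Hm' _ _ _ _ _ _ H); lia.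
  have e1 := b3 (3 * s); have e2 := b3 (3 * s - (N - 3)).
  have e3 : 3 * s - (N - 3) = r + 3 by lia.
  rewrite e3 in H e2.
  have e4 : s ^ 3 <= 20 * (20 * (20 * (6 * 'C(r + 3, 3)))).
    apply: (@leq_trans ((20 * (r + 1)) ^ 3)); first by rewrite leq_exp2r //; move: r2; clear; lia.
    have g1 : r + 3 - 1 = r + 2 by clear; lia.
    have g2 : r + 3 - 2 = r + 1 by clear; lia.
    by rewrite e2 g1 g2 !expnS expn0 muln1; clear; nia.
  have e5 : 6 * 'C(3 * s, 3) <= 27 * s ^ 3 by rewrite e1 !expnS expn0 muln1; clear; nia.
  have s3 : 0 < s ^ 3 by rewrite expn_gt0; apply/orP; left; move: s_ge; clear; lia.
  move: HF H e4 e5 s3; move: (s ^ 3) (cnt f _) ('C(3 * s, 3)) ('C(r + 3, 3)) => S F c1 c2; clear; lia.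
have N59 : 59 * s <= 20 * N by move: NE r1; clear; lia.
have N3 : N <= 3 * s by move: NE; clear; lia.
(* Links shrink as the vertex grows, so the vertices of [N, 3s + 2) with a small link into [0, N)
   are the last ones; b is their number. *)
pose P b := (3 * s + 2 - b <= N) || (q * N < link_cnt f (3 * s + 1 - b) N).
have exP : exists b, P b by exists (3 * s + 2); rewrite /P subnn.
pose b := ex_minn exP.
have bmin b' : b' < b -> ~~ P b'.
  by rewrite /b; case: ex_minnP => m _ Hmin; rewrite ltnNge; apply: contra => /Hmin.
have bP : P b by rewrite /b; case: ex_minnP.
have bN : N <= 3 * s + 2 - b.
  have : b <= 3 * s + 2 - N.
    rewrite /b; case: ex_minnP => m _; apply; rewrite /P; apply/orP; left; lia.
  lia.
have good v : N <= v < 3 * s + 2 - b -> q * N < link_cnt f v N.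
  move=> /andP[v1 v2]; case/orP: bP => [|bP]; first lia.
  by apply: (leq_trans bP); apply: (link_cnt_anti Sf) => //; lia.
have badv v : 3 * s + 2 - b <= v < 3 * s + 2 -> link_cnt f v N <= q * N.
  move=> /andP[v1 v2]; have /bmin : 3 * s + 1 - v < b by lia.
  rewrite /P negb_or -leqNgt => /andP[_]; by rewrite (_ : 3 * s + 1 - (3 * s + 1 - v) = v) //; lia.
clearbody b.
have cN : 400 * (2 * 'C(N, 2)) >= 59 * s * (59 * s - 20).
  by rewrite b2; move: N59 s_ge; clear; nia.
have Q3 : 8 * (q * N) <= 3 * (s * s).
  have := leq_mul q1 N3; clear; lia.
have ss : 1000 * s <= s * s by rewrite leq_mul2r s_ge orbT.
have cN' : 400 * (2 * 'C(N, 2)) + 1180 * s >= 3481 * (s * s).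
  by move: cN s_ge; clear; nia.
have qN : q * N <= 'C(N, 2).
  by move: Q3 cN' ss; move: (q * N) (s * s) ('C(N, 2)) => x y w; clear; lia.
pose d := 'C(N, 2) - q * N.
have defi : cnt f (3 * s + 2) + b * d <= 'C(3 * s + 2, 3).
  have bs : b <= 3 * s + 2 by lia.
  rewrite -{1 2}(subnK bs); apply: cnt_deficit => v; rewrite (subnK bs) => hv.
  have := badv v hv; have := link_cnt_grow f v N (v - N); rewrite subnKC; last lia.
  by rewrite /d; move: qN; clear; lia.
have d3 : 3 * (s * s) <= d.
  by rewrite /d; move: Q3 cN' ss; move: (q * N) (s * s) ('C(N, 2)) => x y w; clear; lia.
(* Each of the b vertices costs at least 3 s^2 triples, while hardly any are missing. The resulting
   bound makes room for the greedy choices in [outer_link_le]. *)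
have bsmall : 400 * b <= s.
  have h1 : b * (3 * (s * s)) + cnt f (3 * s) <= 'C(3 * s + 2, 3).
    have : cnt f (3 * s) <= cnt f (3 * s + 2) by rewrite addn2 !cntS -addnA leq_addr.
    have := leq_mul (leqnn b) d3; move: defi; clear; lia.
  have h2 : 6 * 'C(3 * s + 2, 3) = 27 * s ^ 3 + 27 * (s * s) + 6 * s.
    by rewrite b3 !expnS expn0 muln1 addnK (_ : 3 * s + 2 - 1 = 3 * s + 1); [clear; nia | clear; lia].
  have h3 : s * s * (6 * (1000 * 1000 * b)) <= s * s * (10 * (1000 * 1000) + 34 * s).
    have s3 : s ^ 3 = s * s * s by rewrite !expnS expn0 muln1 mulnA.
    rewrite s3 in h2 HF; move: h1 h2 HF ss; clear; move: (cnt f _) ('C(_, _)) => F c; nia.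
  rewrite leq_pmul2l in h3; last by rewrite muln_gt0; move: s_ge; clear; lia.
  by move: h3 s_ge; clear; lia.
have outer z : 3 * s + 2 + b <= z -> link_cnt f z (3 * s + 1) <= 2 * b * (3 * s + 1).
  by apply: (outer_link_le Sf Hs Hcl bN good); lia.
pose m := n - (3 * s + 2).
have total : cnt f n = cnt f (3 * s + 2) + \sum_(i < m) link_cnt f (3 * s + 2 + i) (3 * s + 1).
  rewrite (cnt_split _ Hn); congr (_ + _); apply: eq_bigr => i _.
  by apply: link_cnt_cut; [lia | move=> x y /Hy; lia].
case: (posnP b) => [b0|b1].
  have zero z : 3 * s + 2 <= z -> link_cnt f z (3 * s + 1) = 0.
    by move=> hz; apply/eqP; rewrite -leqn0; have := outer z; rewrite b0 addn0 muln0 mul0n; apply.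
  have total0 : cnt f n = cnt f (3 * s + 2).
    by rewrite total big1 ?addn0 // => i _; apply: zero; exact: leq_addr.
  rewrite total0; split; first exact: cnt_le.
  move=> full x y z xy yz zn; case: (ltnP z (3 * s + 2)) => hz.
    exact: (cnt_full full).
  case: (leqP y (3 * s)) => hy; last by case E: (f _ _ _) => //; have := Hy _ _ _ E; lia.
  by apply: (link_cnt_eq0 (zero z hz) xy); lia.
pose D1 := q * N + 'C(3 * s + 1, 2) - 'C(N, 2).
have inner z : 3 * s + 2 <= z -> link_cnt f z (3 * s + 1) <= D1.
  move=> hz; have := link_cnt_grow f z N (3 * s + 1 - N); rewrite subnKC; last lia.
  have h1 : link_cnt f z N <= link_cnt f (3 * s + 1) N by apply: (link_cnt_anti Sf); lia.
  have h2 : link_cnt f (3 * s + 1) N <= q * N by apply: badv; lia.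
  rewrite /D1; move: h1 h2; clear; lia.
have sumb : \sum_(i < m) link_cnt f (3 * s + 2 + i) (3 * s + 1) <= b * D1 + m * (2 * b * (3 * s + 1)).
  apply: (@leq_trans (\sum_(i < m) ((i < b) * D1 + 2 * b * (3 * s + 1)))).
    apply: leq_sum => i _; case: ltnP => hi; rewrite ?mul1n ?mul0n.
      by rewrite (leq_trans (inner _ _)) ?leq_addr.
    by rewrite add0n outer // leq_add2l.
  rewrite big_split /= sum_nat_const card_ord leq_add2r -big_distrl /= leq_mul2r; apply/orP; right.
  have -> : forall k, \sum_(i < k) (i < b) = minn k b.
    by elim=> [|k IH]; rewrite ?big_ord0 ?min0n // big_ord_recr /= IH; lia.
  exact: geq_minr.
(* At least b * d triples are missing inside [0, 3s + 2). Outside, b vertices carry at most D1 edges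
   each and the others at most 2b(3s + 1), so this inequality lets the clique win. As m <= s/2, the
   left side is about 3.53 s^2 at most, and d about 3.97 s^2 at least. *)
have key : D1 + m * (2 * (3 * s + 1)) < d.
  have h1 : m * (2 * (3 * s + 1)) <= 3 * (s * s) + s.
    have : 2 * m <= s by rewrite /m; move: Hm; clear; lia.
    by move=> h; have := leq_mul h (leqnn (3 * s + 1)); clear; nia.
  have h2 : 2 * 'C(3 * s + 1, 2) = 9 * (s * s) + 3 * s by rewrite b2 addnK; clear; nia.
  rewrite /D1 /d; move: h1 h2 Q3 cN' ss s_ge.
  move: (q * N) (s * s) ('C(N, 2)) ('C(3 * s + 1, 2)) (m * _) => x y w v u; clear; lia.
have lt : cnt f n < 'C(3 * s + 2, 3).
  have : b * (D1 + m * (2 * (3 * s + 1))) < b * d by rewrite ltn_pmul2l.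
  move: defi sumb; rewrite total; clear; lia.
by split; [exact: ltnW | move=> E; rewrite E ltnn in lt].
Qed.

(** * Extremal left-compressed families *)

Lemma bin3_poly N : 6 * 'C(N, 3) + 3 * (N * N) = N * N * N + 2 * N.
Proof. by rewrite bin3E; case: N => [|[|N]] //; rewrite !subSS !subn0; clear; nia. Qed.

(** To leading order the cover bound is (19 s^3 + 15 s^2 m + 3 s m^2) / 6. Negative terms are moved
    across, which keeps truncated subtraction out of the estimates. *)
Lemma cover_size s m : let n := 3 * s + m in
  6 * 'C(n, 3) + 15 * (s * s) + 6 * (s * m) =
  6 * 'C(n - s, 3) + 19 * (s * s * s) + 15 * (s * s * m) + 3 * (s * m * m) + 2 * s.
Proof.
move=> n; have -> : n - s = 2 * s + m by rewrite /n; lia.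
have := bin3_poly n; have := bin3_poly (2 * s + m); rewrite {2 3 4 5 6 7}/n.
move: ('C(n, 3)) ('C(_, 3)) => a b; clear; nia.
Qed.

Lemma two_below : exists s0, forall s n f M, s0 <= s -> n <= 20 * s ->
  shifted_system n f -> matching_le f s -> is_matching f M -> size M = s -> 3 * s + 2 <= n ->
  (forall x y z, f x y z -> y <= 3 * s) ->
  (s <= 2 * (n - 3 * s) -> cnt f n < 'C(n, 3) - 'C(n - s, 3)) /\
  (2 * (n - 3 * s) < s -> cnt f n <= 'C(3 * s + 2, 3) /\
    (cnt f n = 'C(3 * s + 2, 3) -> forall x y z, x < y -> y < z -> z < n -> f x y z = (z < 3 * s + 2))).
Proof.
have [E EE] : {E | E = 1000 * 1000} by eexists.
have E0 : 0 < E by rewrite EE.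
have [s0 Hs0] := asymptotics 20 E0.
exists (s0 + 1000) => s n f M s_ge n20 Sf Hs HM sM Hn Hy.
have s0s : s0 <= s by move: s_ge; clear; lia.
have s1 : 1000 <= s by move: s_ge; clear; lia.
have n3 : 3 * s <= n by move: Hn; clear; lia.
have [G [H1 H2 H3]] := Hs0 s n f M s0s n20 Sf Hs HM sM n3 Hy.
have [m mE] : {m | n = 3 * s + m} by exists (n - 3 * s); rewrite subnKC.
have s3 : s ^ 3 = s * s * s by rewrite !expnS expn0 muln1 mulnA.
rewrite s3 in H1 H2 H3.
have -> : n - 3 * s = m by rewrite mE addKn.
rewrite (_ : n - 3 * s = m) in H3; last by rewrite mE addKn.
split=> hm.
- have cov := cover_size s m; cbv zeta in cov; rewrite -mE in cov.
  suff : E * (540 * cnt f n) + E * (540 * 'C(n - s, 3)) < E * (540 * 'C(n, 3)).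
    rewrite -mulnDr ltn_pmul2l //.
    by move: (cnt f n) ('C(n, 3)) ('C(n - s, 3)) => c c1 c2; clear; lia.
  have m17 : m <= 17 * s by move: n20; rewrite mE; clear; lia.
  have sm : s * m <= 17 * (s * s) by have := leq_mul (leqnn s) m17; clear; lia.
  have ss : 1000 * (s * s) <= s * s * s by rewrite -mulnA leq_mul2r s1 orbT.
  have T17 : s * s * m <= 17 * (s * s * s) by have := leq_mul (leqnn (s * s)) m17; clear; lia.
  have T2 : s * s * s <= 2 * (s * s * m) by have := leq_mul (leqnn (s * s)) hm; clear; lia.
  have UT : 4 * (s * s * m) <= 4 * (s * m * m) + s * s * s.
    have h : 4 * (s * m) <= 4 * (m * m) + s * s.
      by have := (nat_Cauchy (2 * m) s).1; rewrite !expnS !expn0 !muln1; clear; lia.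
    by have := leq_mul (leqnn s) h; clear; lia.
  (* For 90m <= 48s the trade-off alone gives 2430 s^3 (scaled by 540), and the cover has at least
     2452 s^3 when m >= s/2. Otherwise the excess 90m - 48s is paid for by G <= 3 s^2, that is P <=
     18; with x = m/s the cover then leads by (270 x^2 - 270 x + 144) s^3, positive by [UT], which
     is (2m - s)^2 >= 0. All this is up to lower order terms. *)
  have bound : E * (540 * cnt f n) <= E * (2431 * (s * s * s)) \/
     E * (540 * cnt f n) + E * (864 * (s * s * s)) <=
       E * (2430 * (s * s * s) + 1620 * (s * s * m)) + 546 * (s * s * s) + 90 * (s * s * m).
    case: (leqP (90 * m) (48 * s)) => h90; [left|right].
      have h := leq_mul (leqnn E) (leq_mul h90 (leqnn G)).
      have h91 : 546 * (s * s * s) <= E * (s * s * s) by rewrite leq_mul2r EE orbT.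
      by move: H1 H3 h h91; clear; lia.
    have [a aE] : {a | 90 * m = 48 * s + a} by exists (90 * m - 48 * s); rewrite subnKC // ltnW.
    have sp : 0 < s by move: s1; clear; lia.
    have h6 : 6 * (E * (a * G)) <= (18 * E + 1) * (s * s * a).
      by rewrite -(leq_pmul2l sp); have := leq_mul H2 (leqnn a); clear; lia.
    have e1 : E * (a * G) + 48 * (E * (s * G)) = 90 * (E * (m * G)).
      by have := congr1 (fun k => E * (k * G)) aE; clear; lia.
    have e2 : s * s * a + 48 * (s * s * s) = 90 * (s * s * m).
      by have := congr1 (fun k => s * s * k) aE; clear; lia.
    have e3 : E * (s * s * a) + 48 * (E * (s * s * s)) = 90 * (E * (s * s * m)).
      by have := congr1 (fun k => E * k) e2; clear; lia.
    by move: H1 H3 h6 e1 e2 e3; clear; lia.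
  have sp : 0 < s * s * s by rewrite !muln_gt0; move: s1; clear; lia.
  move: sp bound cov sm ss T17 T2 UT s1; rewrite EE.
  move: (s * s * s) (s * s * m) (s * m * m) (s * s) (s * m) (cnt f n) ('C(n, 3)) ('C(n - s, 3)) => S T U p q c c1 c2.
  clear; lia.
(* A family of clique size has 405 s^3 <= 90 cnt + 45 s G up to errors, against 90 cnt + 48 s G <=
   405 s^3. Hence 3 s G is at most about 91 s^3 / E, and the triples inside [0, 3s) are as dense as
   [near_clique] requires. *)
- have [lt|ge] := ltnP (cnt f n) ('C(3 * s + 2, 3)).
    by split; [exact: ltnW | move=> e; rewrite e ltnn in lt].
  apply: (near_clique s1 Sf Hs Hy Hn).
    by rewrite mE addKn; exact: ltnW.
  rewrite s3 -EE.
  have h27 : 27 * (s * s * s) <= 6 * cnt f n.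
    apply: (@leq_trans (6 * 'C(3 * s + 2, 3))); last by rewrite leq_mul2l ge orbT.
    by have := bin3_poly (3 * s + 2); clear; move: ('C(_, 3)) => c; nia.
  have h1 := leq_mul (leqnn E) h27.
  have h2 := leq_mul (leqnn E) (leq_mul (ltnW hm) (leqnn G)).
  by move: H1 H3 h1 h2; clear; lia.
Qed.

(** * Induction on the matching number *)

Definition cover_bound (n s : nat) := 'C(n, 3) - 'C(n - s, 3).
Definition clique_bound (s : nat) := 'C(3 * s + 2, 3).
Definition is_cover (f : nat -> nat -> nat -> bool) n s :=
  forall x y z, x < y -> y < z -> z < n -> f x y z = (x < s).
Definition is_clique (f : nat -> nat -> nat -> bool) n s :=
  forall x y z, x < y -> y < z -> z < n -> f x y z = (z < 3 * s + 2).

Definition extremal_for (f : nat -> nat -> nat -> bool) n s :=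
  cnt f n <= maxn (cover_bound n s) (clique_bound s) /\
  (cnt f n = maxn (cover_bound n s) (clique_bound s) -> is_cover f n s \/ is_clique f n s).

Definition del0 (f : nat -> nat -> nat -> bool) x y z := f x.+1 y.+1 z.+1.

Lemma del0_shifted n f : shifted_system n f -> shifted_system n.-1 (del0 f).
Proof.
move=> [Hv Hm]; split=> [x y z /Hv|x y z x' y' z' H h1 h2 h3 h4 h5]; first lia.
exact: (Hm _ _ _ _ _ _ H).
Qed.

Lemma symm_del0 f a b c : symm (del0 f) a b c = symm f a.+1 b.+1 c.+1.
Proof. by rewrite /symm /del0; congr f; lia. Qed.

Lemma cnt_del0 f n : cnt f n.+1 = cnt (del0 f) n + link_cnt (fun y z _ => f 0 y.+1 z.+1) 0 n.
Proof.
rewrite /cnt big_ord_recl big_ord0 add0n /link_cnt -big_split; apply: eq_bigr => z _.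
rewrite big_ord_recl big_ord0 add0n -big_split; apply: eq_bigr => y _.
by rewrite big_ord_recl addnC.
Qed.

Lemma link_cnt_full (f : nat -> nat -> nat -> bool) z N x y : link_cnt f z N = 'C(N, 2) -> x < y -> y < N -> f x y z.
Proof.
move=> H xy yN; have := link_cntC f z N; rewrite H => E.
have E0 : link_cnt (fun x y z => ~~ f x y z) z N = 0 by move: E; clear; lia.
by have := link_cnt_eq0 E0 xy yN; case: (f _ _ _).
Qed.

Lemma is_matching_take f M k : is_matching f M -> is_matching f (take k M).
Proof.
rewrite /is_matching -{1 2}(cat_take_drop k M) all_cat verts_cat cat_uniq.
by case/andP=> /andP[-> _] /and3P[-> _ _].
Qed.

(** A matching of size s + 1 avoiding 0 can be compressed onto {1, ..., 3s+3}; the given edge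
    through 0 is disjoint from it and would extend it to size s + 2. *)
Lemma del0_matching n f s : shifted_system n f -> matching_le f s.+1 ->
  f 0 (3 * s.+1).+1 (3 * s.+1).+2 -> matching_le (del0 f) s.
Proof.
move=> Sf Hs f0 M HM; rewrite leqNgt; apply/negP => sM.
have [M1 [HM1 sM1 P1]] := compress (del0_shifted Sf) (is_matching_take s.+1 HM).
rewrite size_take_min (minn_idPl sM) in sM1 P1.
pose M2 := (0, (3 * s.+1).+1, (3 * s.+1).+2) :: map (tmap S) M1.
suff /Hs : is_matching f M2 by rewrite /= size_map sM1 ltnn.
rewrite is_matching_cons verts_map; apply/and4P; split.
- by rewrite symm_eq.
- by rewrite /tv /= !inE; lia.
- apply/hasPn => _ /mapP[v vM ->]; rewrite (perm_mem P1) mem_iota in vM.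
  apply/negP => H; have : v.+1 \in tv (0, (3 * s.+1).+1, (3 * s.+1).+2) by exact: H.
  by rewrite !inE /=; move: vM; clear; lia.
- case/andP: HM1 => A U; rewrite /is_matching verts_map map_inj_uniq ?U ?andbT; last exact: succn_inj.
  by rewrite all_map; apply/allP => t /(allP A) /=; rewrite symm_del0.
Qed.

Lemma cover_boundS n s : s < n -> cover_bound n.+1 s.+1 = 'C(n, 2) + cover_bound n s.
Proof.
move=> sn; rewrite /cover_bound subSS binS addnC.
by rewrite addnBA // leq_bin2l // leq_subr.
Qed.

Lemma clique_boundS s : 2 * clique_bound s.+1 = 2 * clique_bound s + 27 * (s * s) + 45 * s + 20.
Proof.
rewrite /clique_bound (_ : 3 * s.+1 + 2 = (3 * s + 2).+3); last lia.
have := bin2E (3 * s + 2); have := bin2E (3 * s + 2).+1; have := bin2E (3 * s + 2).+2.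
rewrite !binS !bin1 !bin0 => h1 h2 h3; nia.
Qed.

Lemma bounds_lt n s : 3 * s.+1 + 2 <= n ->
  maxn (cover_bound n s) (clique_bound s) < maxn (cover_bound n s.+1) (clique_bound s.+1).
Proof.
move=> hn; rewrite gtn_max !leq_max; apply/andP; split; apply/orP; [left|right].
  rewrite /cover_bound (_ : n - s = (n - s.+1).+1); last lia.
  have h : 'C((n - s.+1).+1, 3) <= 'C(n, 3) by apply: leq_bin2l; lia.
  have h2 : 0 < 'C(n - s.+1, 2) by rewrite bin_gt0; lia.
  by move: h; rewrite binS; move: h2; clear; lia.
by have := clique_boundS s; clear; lia.
Qed.

Lemma clique_lt_cover n s : 0 < s -> 4 * s + 4 <= n -> clique_bound s < cover_bound n s.
Proof.
move=> s0 hn; have [k kE] : {k | n = 3 * s + (s + 4 + k)} by exists (n - (4 * s + 4)); lia.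
have := cover_size s (s + 4 + k); cbv zeta; rewrite -kE /cover_bound /clique_bound.
have := bin3_poly (3 * s + 2).
have : 'C(n - s, 3) <= 'C(n, 3) by apply: leq_bin2l; exact: leq_subr.
move: ('C(n, 3)) ('C(n - s, 3)) ('C(3 * s + 2, 3)) s0 => a b c; clear; lia.
Qed.

(** Two vertices of every edge lie in [0, 3s], so there are at most about 9 s^2 n / 2 edges, while
    the cover has about s n^2 / 2. This leaves n < 20s, the range in which the asymptotic estimates
    apply. *)
Lemma sparse_bound n f s : 0 < s -> 20 * s <= n -> shifted_system n f ->
  (forall x y z, f x y z -> y <= 3 * s) -> cnt f n < cover_bound n s.
Proof.
move=> s0 hn Sf Hy.
have h1 : cnt f n <= n * 'C(3 * s + 1, 2).
  rewrite -[X in X * _]card_ord -sum_nat_const; apply: leq_sum => z _.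
  rewrite -/(link_cnt f z z); case: (leqP z (3 * s + 1)) => hz.
    by apply: leq_trans (link_cnt_le _ _ _) _; apply: leq_bin2l.
  rewrite (@link_cnt_cut f z (3 * s + 1) z (ltnW hz)) ?link_cnt_le // => x y /Hy; lia.
have [k kE] : {k | n = 3 * s + (17 * s + k)} by exists (n - 20 * s); lia.
have := cover_size s (17 * s + k); cbv zeta; rewrite -kE /cover_bound.
have : 'C(n - s, 3) <= 'C(n, 3) by apply: leq_bin2l; exact: leq_subr.
have h2 : 6 * cnt f n <= (3 * s + (17 * s + k)) * (3 * ((3 * s + 1) * (3 * s))).
  by rewrite -kE; have := bin2E (3 * s + 1); rewrite addnK => <-; move: h1; clear; lia.
have h3 : s * s <= s * s * s by rewrite leq_pmulr.
have h4 : s * k <= s * s * k by rewrite leq_mul2r leq_pmulr ?orbT.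
have h5 : 0 < s * s * s by rewrite !muln_gt0 s0.
move: h2 h3 h4 h5; move: ('C(n, 3)) ('C(n - s, 3)) (cnt f n) => a b c; clear; lia.
Qed.

Lemma clique_cnt_le f n s : 3 * s + 2 <= n -> is_clique f n s -> cnt f n <= clique_bound s.
Proof.
move=> hn H; rewrite (cnt_split _ hn) big1 ?addn0 ?cnt_le // => i _.
apply/eqP; rewrite /link_cnt sum_nat_eq0; apply/forallP => y; rewrite sum_nat_eq0 /=.
apply/forallP => x; rewrite H ?ltn_ord //=; first by rewrite ltnNge leq_addr.
by have := ltn_ord i; move: hn; clear; lia.
Qed.

(** The lower bound on n is stated as N1 + s <= n because this form survives the passage from (n, s)
    to (n - 1, s - 1). *)
Lemma shifted_extremal : exists N1, forall s n f, shifted_system n f -> matching_le f s ->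
  3 * s + 2 <= n -> N1 + s <= n -> extremal_for f n s.
Proof.
(* When n < 20(s + 1), this constant forces s + 1 > s0, as [two_below] demands. *)
have [s0 Hs0] := two_below; exists (20 * s0 + 40) => s; elim: s => [|s IH] n f Sf Hs Hn HN.
  have f0 x y z : f x y z = false.
    apply/negP => H; have /and3P[xy yz _] := Sf.1 _ _ _ H.
    suff /Hs : is_matching f [:: (x, y, z)] by [].
    by rewrite /is_matching /= symm_eq // H /= !inE; move: xy yz; clear; lia.
  split; last by left=> x y z _ _ _; rewrite f0.
  have := @cnt_first_lt f 0 n (fun x y z => _); rewrite subn0 => H.
  have : cnt f n + 'C(n, 3) <= 'C(n, 3) by apply: H => x y z; rewrite f0.
  by rewrite -[X in _ <= X]add0n leq_add2r leqn0 => /eqP->.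
have n2 : 3 * s + 2 <= n by move: Hn; clear; lia.
have nN : 20 * s0 + 40 + s <= n by move: HN; clear; lia.
have [Hs1|nHs1] := classic (matching_le f s).
  have [le _] := IH n f Sf Hs1 n2 nN.
  have lt := leq_ltn_trans le (bounds_lt Hn).
  by split; [exact: ltnW | move=> e; rewrite e ltnn in lt].
have [M [HM sM]] : exists M, is_matching f M /\ size M = s.+1.
  have [M nM] := not_all_ex_not _ _ nHs1; have [HM sM] := imply_to_and _ _ nM.
  exists M; split => //; apply/eqP; rewrite eqn_leq Hs //= ltnNge; exact/negP.
have [n3|n3] := leqP n (3 * s.+1 + 2).
  have nE : n = 3 * s.+1 + 2 by apply/eqP; rewrite eqn_leq n3.
  have mE : maxn (cover_bound n s.+1) (clique_bound s.+1) = 'C(n, 3).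
    by rewrite /cover_bound /clique_bound -nE; apply/maxn_idPr; exact: leq_subr.
  rewrite /extremal_for mE; split; first exact: cnt_le.
  by move=> e; right=> x y z xy yz zn; rewrite -nE zn; exact: (cnt_full e).
case: (boolP (f 0 (3 * s.+1).+1 (3 * s.+1).+2)) => [f0|nf0].
  have nS : n = n.-1.+1 by move: n3; clear; case: n.
  set k := n.-1 in nS; have Sf' : shifted_system k (del0 f) by exact: del0_shifted.
  have k2 : 3 * s + 2 <= k by move: n3; rewrite nS; clear; lia.
  have kN : 20 * s0 + 40 + s <= k by move: HN; rewrite nS; clear; lia.
  have [le eq] := IH k (del0 f) Sf' (del0_matching Sf Hs f0) k2 kN.
  pose star y z (_ : nat) := f 0 y.+1 z.+1.
  have cE : cnt f n = cnt (del0 f) k + link_cnt star 0 k by rewrite nS cnt_del0.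
  have sle := link_cnt_le star 0 k.
  have cov : cover_bound n s.+1 = 'C(k, 2) + cover_bound k s.
    by rewrite nS cover_boundS //; move: kN; clear; lia.
  have le' : cnt f n <= 'C(k, 2) + cnt (del0 f) k by rewrite cE addnC leq_add2r.
  (* For s = 0 both bounds vanish and the empty clique is also a cover; for s > 0 a strictly larger
     cover bound excludes the clique. *)
  have [[lt cl]|[s1 ge]] : (clique_bound s <= cover_bound k s /\ (is_clique (del0 f) k s ->
      cnt (del0 f) k = cover_bound k s -> is_cover (del0 f) k s)) \/
      (0 < s /\ cover_bound k s <= clique_bound s).
    case: (posnP s) => [->|s1].
      left; split; first by rewrite /clique_bound /cover_bound subn0 subnn.
      by move=> H _ x y z xy yz zk; rewrite (H x y z) //; move: xy yz; clear; lia.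
    case: (ltnP (clique_bound s) (cover_bound k s)) => h; [left|by right].
    split; first exact: ltnW.
    by move=> /(clique_cnt_le k2) h1 h2; move: h; rewrite -h2 ltnNge h1.
  - have mE : maxn (cover_bound k s) (clique_bound s) = cover_bound k s by exact/maxn_idPl.
    rewrite mE in le eq.
    have ub : cnt f n <= cover_bound n s.+1 by rewrite cov (leq_trans le') // leq_add2l.
    split; first by rewrite (leq_trans ub) // leq_maxl.
    move=> e; left.
    have eC : cnt f n = cover_bound n s.+1 by apply/eqP; rewrite eqn_leq ub e leq_maxl.
    have e1 : cnt (del0 f) k = cover_bound k s.
      by move: eC le sle; rewrite cov cE; clear; lia.
    have e2 : link_cnt star 0 k = 'C(k, 2).
      by move: eC; rewrite cov cE e1; clear; lia.
    have co : is_cover (del0 f) k s by case: (eq e1) => // c; exact: cl.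
    move=> [|x] [|y] [|z] // xy yz; rewrite nS => zn.
      have : star y z 0 by apply: (link_cnt_full e2).
      by rewrite /star => ->.
    exact: (co x y z).
  (* The clique can only dominate for k < 4s + 4. Then the C(k, 2) <= (4s + 3)(2s + 1) edges through
     0 are fewer than the growth of the clique bound from s to s + 1. *)
  - have mE : maxn (cover_bound k s) (clique_bound s) = clique_bound s by exact/maxn_idPr.
    rewrite mE in le.
    have k4 : k < 4 * s + 4.
      by rewrite ltnNge; apply/negP => /(clique_lt_cover s1); rewrite ltnNge ge.
    have lt : cnt f n < clique_bound s.+1.
      have := clique_boundS s; have := bin2E k.
      have : k * (k - 1) <= (4 * s + 3) * (4 * s + 2) by apply: leq_mul; move: k4; clear; lia.
      by move: le le'; clear; lia.
    split; first by rewrite (leq_trans (ltnW lt)) // leq_maxr.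
    by move=> e; move: lt; rewrite e ltnNge leq_maxr.
have Hy x y z : f x y z -> y <= 3 * s.+1.
  move=> H; rewrite leqNgt; apply: contra nf0 => hy; have /and3P[xy yz _] := Sf.1 _ _ _ H.
  by apply: (Sf.2 _ _ _ _ _ _ H) => //; move: xy yz hy; clear; lia.
case: (leqP (20 * s.+1) n) => hn.
  have lt := sparse_bound (ltn0Sn s) hn Sf Hy.
  split; first by rewrite (leq_trans (ltnW lt)) // leq_maxl.
  by move=> e; move: lt; rewrite e ltnNge leq_maxl.
have sl : s0 <= s.+1 by move: hn HN; clear; lia.
have [A B] := Hs0 s.+1 n f M sl (ltnW hn) Sf Hs HM sM Hn Hy.
case: (leqP s.+1 (2 * (n - 3 * s.+1))) => hs.
  have lt := A hs.
  split; first by rewrite (leq_trans (ltnW lt)) // leq_maxl.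
  by move=> e; move: lt; rewrite e ltnNge leq_maxl.
have [C D] := B hs; split; first by rewrite (leq_trans C) // leq_maxr.
move=> e; right; apply: D; apply/eqP; rewrite eqn_leq C e leq_maxr //.
Qed.

(** * Shifting *)

Definition disjoint_seq (T : finType) (L : seq {set T}) : bool :=
  pairwise (fun A B : {set T} => [disjoint A & B]) L.

Definition nu_le (T : finType) (F : {set {set T}}) (s : nat) : Prop :=
  forall L, all (mem F) L -> disjoint_seq L -> size L <= s.

Definition uniform3 (T : finType) (F : {set {set T}}) : Prop := forall e, e \in F -> #|e| = 3.

Definition swap_set (T : finType) (i j : T) (e : {set T}) : {set T} := tperm i j @^-1: e.

(** The usual (i, j)-compression, written locally: of an edge and its mirror image under the
    exchange of i and j, the one with i stays if either was present, the one with j only if both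
    were. *)
Definition shift_family (T : finType) (i j : T) (F : {set {set T}}) : {set {set T}} :=
  [set e : {set T} | if (i \in e) && (j \notin e) then (e \in F) || (swap_set i j e \in F)
           else if (j \in e) && (i \notin e) then (e \in F) && (swap_set i j e \in F)
           else e \in F].

Definition cover_family (T : finType) (S : {set T}) : {set {set T}} :=
  [set e : {set T} | (#|e| == 3) && ~~ [disjoint e & S]].
Definition clique_family (T : finType) (U : {set T}) : {set {set T}} :=
  [set e : {set T} | (#|e| == 3) && (e \subset U)].

Lemma swap_setK (T : finType) (i j : T) : involutive (swap_set i j).
Proof. by move=> e; apply/setP => v; rewrite !inE tpermK. Qed.

Lemma card_swap (T : finType) (i j : T) (e : {set T}) : #|swap_set i j e| = #|e|.
Proof.
rewrite -(card_imset (swap_set i j e) (@perm_inj _ (tperm i j))); congr #|pred_of_set _|.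
apply/setP => v; apply/imsetP/idP => [[u]|ve]; first by rewrite inE => ? ->.
by exists (tperm i j v); rewrite ?inE tpermK.
Qed.

Lemma swap_in (T : finType) (i j : T) (e : {set T}) : (i \in swap_set i j e) = (j \in e) /\ (j \in swap_set i j e) = (i \in e).
Proof. by rewrite !inE tpermL tpermR. Qed.

Lemma swap_id (T : finType) (i j : T) (e : {set T}) : (i \in e) = (j \in e) -> swap_set i j e = e.
Proof. by move=> E; apply/setP => v; rewrite inE; case: tpermP => // ->. Qed.

Lemma disjoint_swap (T : finType) (i j : T) (A C : {set T}) : [disjoint swap_set i j A & swap_set i j C] = [disjoint A & C].
Proof.
apply/pred0P/pred0P => H v; have := H (tperm i j v); rewrite /= ?inE ?tpermK //.
Qed.

Lemma shift_uniform (T : finType) (i j : T) F : uniform3 F -> uniform3 (shift_family i j F).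
Proof.
move=> H e; rewrite inE; case: ifP => _; first by case/orP => /H //; rewrite card_swap.
by case: ifP => _; [case/andP => /H|move/H].
Qed.

(* Exchanging [i] and [j] in a whole matching of the shifted family gives a
   matching of the original one as soon as one of its edges is new. *)
Lemma shift_nu (T : finType) (i j : T) F s : nu_le F s -> nu_le (shift_family i j F) s.
Proof.
move=> HF L AL DL; case: (boolP (all (mem F) L)) => [A|]; first exact: HF.
rewrite -has_predC => /hasP[e eL /= neF].
have := allP AL e eL; rewrite /= inE (negbTE neF) /=.
case: ifP => [/andP[ie je] seF|_]; last by case: ifP.
rewrite -(size_map (swap_set i j) L); apply: HF; last first.
  by rewrite /disjoint_seq pairwise_map; apply: sub_pairwise DL => A C; rewrite /= disjoint_swap.
have other e' : e' \in L -> e' != e -> i \notin e'.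
  move=> e'L ne; apply/negP => ie'.
  have : [disjoint e & e'] || [disjoint e' & e].
    move: eL e'L DL; rewrite /disjoint_seq; elim: (L) => // a L' IH.
    rewrite !inE /= => /orP[/eqP E|m] /orP[/eqP E'|m'] /andP[/allP Ha P'].
    - by rewrite E E' eqxx in ne.
    - by rewrite E Ha.
    - by rewrite E' (Ha _ m) orbT.
    - exact: IH.
  by case/orP => /pred0P /(_ i) /=; rewrite ie ie'.
apply/allP => _ /mapP[e' e'L ->] /=; case: (eqVneq e' e) => [->//|ne].
have ie' := other _ e'L ne; have := allP AL e' e'L; rewrite /= inE (negbTE ie') /=.
rewrite andbT; case: ifP => [_ /andP[]//|je' h].
by rewrite swap_id // je' (negbTE ie').
Qed.

Lemma shiftE (T : finType) (i j : T) (F : {set {set T}}) (e : {set T}) :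
  (e \in shift_family i j F) =
    (if (i \in e) && (j \notin e) then (e \in F) || (swap_set i j e \in F)
     else if (j \in e) && (i \notin e) then (e \in F) && (swap_set i j e \in F)
     else e \in F).
Proof. by rewrite inE. Qed.

Lemma shift_swapE (T : finType) (i j : T) (F : {set {set T}}) (e : {set T}) :
  (swap_set i j e \in shift_family i j F) =
    (if (j \in e) && (i \notin e) then (swap_set i j e \in F) || (e \in F)
     else if (i \in e) && (j \notin e) then (swap_set i j e \in F) && (e \in F)
     else swap_set i j e \in F).
Proof. by rewrite shiftE swap_setK (swap_in i j e).1 (swap_in i j e).2. Qed.

(** Grouping each edge with its mirror image makes comparisons local, since a shift only
    redistributes membership within such a group. *)
Lemma swap_sum (T : finType) (i j : T) (F : {set {set T}}) (w : {set T} -> nat) :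
  2 * \sum_(e in F) w e = \sum_e ((e \in F) * w e + (swap_set i j e \in F) * w (swap_set i j e)).
Proof.
have E : \sum_(e in F) w e = \sum_e (e \in F) * w e.
  by rewrite big_mkcond; apply: eq_bigr => e _; case: (e \in F); rewrite ?mul1n ?mul0n.
rewrite E mul2n -addnn big_split /=; congr (_ + _).
by rewrite (reindex_inj (inv_inj (@swap_setK T i j))).
Qed.

Lemma card_shift (T : finType) (i j : T) (F : {set {set T}}) : #|shift_family i j F| = #|F|.
Proof.
apply/eqP; rewrite -(eqn_pmul2l (isT : 0 < 2)) -!sum1_card !(swap_sum i j).
apply/eqP/eq_bigr => e _; rewrite (shiftE i j F e) (shift_swapE i j F e) !muln1.
case: (i \in e); case: (j \in e) => //=; case: (e \in F); case: (_ \in F) => //.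
Qed.

Definition weight n (e : {set 'I_n}) : nat := \sum_(v in e) v.

Lemma weight_swap n (i j : 'I_n) (e : {set 'I_n}) : i < j -> i \in e -> j \notin e ->
  weight e < weight (swap_set i j e).
Proof.
move=> ij ie je; rewrite /weight [X in _ < X](reindex_inj (@perm_inj _ (tperm i j))) /=.
rewrite [X in _ < X](eq_bigl (fun v => v \in e)); last by move=> v; rewrite /swap_set inE tpermK.
rewrite (bigD1 i) //= [X in _ < X](bigD1 i) //= tpermL.
rewrite [X in _ + X < _](eq_bigr (fun v => nat_of_ord (tperm i j v))) ?ltn_add2r // => v /andP[ve vi].
by rewrite tpermD // eq_sym //; apply: contraNneq je => <-.
Qed.

Definition potential n (F : {set {set 'I_n}}) : nat := \sum_(e in F) weight e.

(** This is the termination measure of shifting: an edge that moves trades j for the smaller i and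
    loses weight. *)
Lemma shift_potential n (i j : 'I_n) (F : {set {set 'I_n}}) : i < j -> shift_family i j F != F ->
  potential (shift_family i j F) < potential F.
Proof.
move=> ij ne; rewrite -(ltn_pmul2l (isT : 0 < 2)) /potential !(swap_sum i j).
have le (e : {set 'I_n}) : (e \in shift_family i j F) * weight e
    + (swap_set i j e \in shift_family i j F) * weight (swap_set i j e)
  <= (e \in F) * weight e + (swap_set i j e \in F) * weight (swap_set i j e)
    ?= iff ((e \in shift_family i j F) == (e \in F)).
  rewrite (shiftE i j F e) (shift_swapE i j F e).
  have := @weight_swap n i j e ij; have := @weight_swap n i j (swap_set i j e) ij.
  rewrite (swap_in i j e).1 (swap_in i j e).2 swap_setK.
  case: (i \in e); case: (j \in e) => /= h1 h2; case: (e \in F); case: (swap_set i j e \in F) => /=; rewrite ?mul1n ?mul0n ?add0n ?addn0; apply/leqifP => //=; try exact: h1; try exact: h2; rewrite ?addnC //.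
have [e he] : exists e, (e \in shift_family i j F) != (e \in F).
  apply/existsP; apply: contraR ne => /existsPn H; apply/eqP/setP => e.
  by apply/eqP; have := H e; rewrite negbK.
rewrite (bigD1 e) //= [X in _ < X](bigD1 e) //= -addSn leq_add //.
  by rewrite (ltn_leqif (le e)).
by apply: leq_sum => e' _; exact: (leq_of_leqif (le e')).
Qed.

(* Connectivity of the Kneser graph of the pairs of [D]. *)
Lemma kneser_pairs (T : finType) (D : {set T}) (c : {set T} -> bool) (p p' : {set T}) : 5 <= #|D| ->
  p \subset D -> #|p| = 2 -> p' \subset D -> #|p'| = 2 -> c p -> ~~ c p' ->
  exists q q' : {set T}, [/\ q \subset D, q' \subset D, #|q| = 2 /\ #|q'| = 2, [disjoint q & q'] & c q && ~~ c q'].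
Proof.
move=> D5 pD p2 p'D p'2 cp cp'; case: (boolP [disjoint p & p']) => dis.
  by exists p, p'; rewrite cp.
have : 2 <= #|D :\: (p :|: p')|.
  have : 0 < #|p :&: p'| by rewrite card_gt0 setI_eq0.
  have := cardsU p p'; have := subset_leq_card (subsetIl D (p :|: p')).
  have := cardsD D (p :|: p'); have := subset_leq_card (subsetIr D (p :|: p')).
  rewrite p2 p'2; lia.
case/card_gt1P => x [y [xD yD xy]].
have q2 : #|[set x; y]| = 2 by rewrite cards2 xy.
have qD : [set x; y] \subset D.
  by apply/subsetP => v; rewrite !inE => /orP[]/eqP->; [move: xD | move: yD]; rewrite !inE => /andP[].
have dq : [disjoint [set x; y] & p :|: p'].
  apply/pred0P => v /=; rewrite !inE; apply/negP => /andP[/orP[]/eqP->]; [move: xD | move: yD];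
  by rewrite !inE => /andP[/negbTE->].
have dqp : [disjoint [set x; y] & p] by apply: disjointWr dq; exact: subsetUl.
have dqp' : [disjoint [set x; y] & p'] by apply: disjointWr dq; exact: subsetUr.
case: (boolP (c [set x; y])) => cq.
  by exists [set x; y], p'; rewrite cq.
by exists p, [set x; y]; rewrite cp cq disjoint_sym.
Qed.

Lemma edge_pair (T : finType) (e : {set T}) (i : T) : #|e| = 3 -> i \in e -> #|e :\ i| = 2.
Proof. by move=> e3 ie; have := cardsD1 i e; rewrite e3 ie => -[]. Qed.

(** The pairs q inside D are those for which the shifted family contains q with i but not q with j,
    and q is coloured by which of the two edges [F] contains. A constant colouring makes [F] the
    shifted family or its mirror image; otherwise [kneser_pairs], which needs five points, supplies
    two disjoint pairs of different colours. *)
Lemma recolor (T : finType) (i j : T) (F : {set {set T}}) (D : {set T}) : i != j ->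
  uniform3 F -> 5 <= #|D| -> i \notin D -> j \notin D ->
  (forall e : {set T}, i \in e -> j \notin e -> #|e| = 3 ->
     if e :\ i \subset D then (e \in shift_family i j F) && (swap_set i j e \notin shift_family i j F)
     else (e \in shift_family i j F) == (swap_set i j e \in shift_family i j F)) ->
  [\/ F = shift_family i j F, F = [set e | swap_set i j e \in shift_family i j F] |
    exists q q' : {set T}, [/\ q \subset D, q' \subset D, #|q| = 2 /\ #|q'| = 2, [disjoint q & q']
      & (i |: q \in F) && (j |: q' \in F)]].
Proof.
move=> ij uF D5 iD jD H; set H' := shift_family i j F.
have neutral (e : {set T}) : (i \in e) = (j \in e) -> (e \in H') = (e \in F).
  by move=> E; rewrite /H' shiftE E; case: (j \in e).
(* the edges of either family meeting {i, j} in one point, outside [D], agree *)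
have same (e : {set T}) : i \in e -> j \notin e -> #|e| = 3 -> ~~ (e :\ i \subset D) ->
    ((e \in F) = (e \in H')) /\ ((swap_set i j e \in F) = (e \in H')) /\ ((swap_set i j e \in H') = (e \in H')).
  move=> ie je e3 nD; have := H e ie je e3; rewrite (negbTE nD) /H' (shiftE i j F e) (shift_swapE i j F e) ie (negbTE je) /=.
  by case: (e \in F); case: (_ \in F).
have xor (e : {set T}) : i \in e -> j \notin e -> #|e| = 3 -> e :\ i \subset D ->
    [/\ e \in H', swap_set i j e \notin H' & (swap_set i j e \in F) = (e \notin F)].
  move=> ie je e3 eD; have := H e ie je e3; rewrite eD /H' (shiftE i j F e) (shift_swapE i j F e) ie (negbTE je) /=.
  by case: (e \in F); case: (_ \in F).
have uH : uniform3 H' by apply: shift_uniform.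
have card3 (e : {set T}) : #|e| != 3 -> (e \in F) = false /\ (e \in H') = false.
  by move=> ne; split; apply/negP; [move/uF | move/uH] => E; rewrite E in ne.
have addi (q : {set T}) : q \subset D -> #|q| = 2 -> [/\ i \in i |: q, j \notin i |: q, #|i |: q| = 3 & (i |: q) :\ i = q].
  move=> qD q2; have iq : i \notin q by apply: contra iD => /(subsetP qD).
  have jq : j \notin q by apply: contra jD => /(subsetP qD).
  rewrite setU11 cardsU1 iq q2 setU1K // !inE negb_or eq_sym ij jq; split => //.
have swapi (q : {set T}) : q \subset D -> swap_set i j (i |: q) = j |: q.
  move=> qD; have iq : i \notin q by apply: contra iD => /(subsetP qD).
  have jq : j \notin q by apply: contra jD => /(subsetP qD).
  apply/setP => v; rewrite !inE; case: tpermP => [->|->|/eqP/negbTE-> /eqP/negbTE->] //.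
    by rewrite (negbTE ij) eq_sym (negbTE ij) (negbTE iq) (negbTE jq).
  by rewrite !eqxx.
pose pairD (q : {set T}) := (q \subset D) && (#|q| == 2).
case: (boolP [forall q : {set T}, pairD q ==> (i |: q \in F)]) => [/forallP allF|].
  apply: Or31; apply/setP => e; case: (eqVneq #|e| 3) => [e3|/card3[-> ->]] //.
  have key (a : {set T}) : i \in a -> j \notin a -> #|a| = 3 ->
      (a \in F) = (a \in H') /\ (swap_set i j a \in F) = (swap_set i j a \in H').
    move=> ia ja a3; case: (boolP (a :\ i \subset D)) => aD; last first.
      by have [-> [-> ->]] := same a ia ja a3 aD.
    have [-> /negbTE-> ->] := xor a ia ja a3 aD.
    have := allF (a :\ i); rewrite /pairD aD (edge_pair a3 ia) /= setD1K // => ->.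
    by [].
  case: (boolP (i \in e)) => ie; case: (boolP (j \in e)) => je.
  - by rewrite neutral // ie je.
  - by have [] := key e ie je e3.
  - have := key (swap_set i j e); rewrite (swap_in i j e).1 (swap_in i j e).2 swap_setK card_swap.
    by case.
  - by rewrite neutral // (negbTE ie) (negbTE je).
rewrite negb_forall => /existsP[q']; rewrite negb_imply => /andP[/andP[q'D /eqP q'2] nq'].
case: (boolP [exists q : {set T}, pairD q && (i |: q \in F)]) => [/existsP[q /andP[/andP[qD /eqP q2] cq]]|].
  apply: Or33; have [a [b [aD bD [a2 b2] ab /andP[ca cb]]]] :=
    @kneser_pairs T D (fun q : {set T} => i |: q \in F) q q' D5 qD q2 q'D q'2 cq nq'.
  exists a, b; split => //; rewrite ca /=.
  have [h1 h2 h3 h4] := addi b bD b2.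
  have := xor _ h1 h2 h3; rewrite h4 => /(_ bD)[_ _]; rewrite swapi // => ->; exact: cb.
move=> /existsPn noF; apply: Or32; apply/setP => e; rewrite inE.
case: (eqVneq #|e| 3) => [e3|ne]; last first.
  by rewrite (card3 e ne).1 (card3 (swap_set i j e) _).2 // card_swap.
have key (a : {set T}) : i \in a -> j \notin a -> #|a| = 3 ->
    (a \in F) = (swap_set i j a \in H') /\ (swap_set i j a \in F) = (a \in H').
  move=> ia ja a3; case: (boolP (a :\ i \subset D)) => aD; last first.
    by have [-> [-> ->]] := same a ia ja a3 aD.
  have [-> /negbTE-> ->] := xor a ia ja a3 aD.
  have := noF (a :\ i); rewrite /pairD aD (edge_pair a3 ia) /= setD1K // => /negbTE->.
  by [].
case: (boolP (i \in e)) => ie; case: (boolP (j \in e)) => je.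
- by rewrite swap_id ?neutral // ie je.
- by have [] := key e ie je e3.
- have := key (swap_set i j e); rewrite (swap_in i j e).1 (swap_in i j e).2 swap_setK card_swap.
  by case.
- by rewrite swap_id ?neutral // (negbTE ie) (negbTE je).
Qed.

(** Each member of [cs] is completed by two of [ds]. For covers [cs] lies in the covering set; for
    cliques any split of the vertices will do. *)
Lemma build_triples (T : finType) (cs ds : seq T) : uniq (cs ++ ds) -> 2 * size cs <= size ds ->
  exists L : seq {set T}, [/\ size L = size cs, disjoint_seq L &
    forall e, e \in L -> [/\ #|e| = 3, exists2 x, x \in cs & x \in e & forall v, v \in e -> v \in cs ++ ds]].
Proof.
elim: cs ds => [|x cs IH] ds U; first by exists [::].
move=> sz; case: ds U sz => [|a [|b ds]] U sz; try by move: sz; rewrite /= mulnS.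
rewrite /= in sz.
have perm : perm_eq (x :: cs ++ a :: b :: ds) ([:: x; a; b] ++ (cs ++ ds)).
  by apply/seq.permP => p; rewrite /= !count_cat /=; lia.
have U' : uniq ([:: x; a; b] ++ (cs ++ ds)) by rewrite -(perm_uniq perm).
move: (U'); rewrite cat_uniq => /and3P[U3 /hasPn dis Ur].
have [|L [sL DL HL]] := IH ds Ur; first by move: sz; clear; lia.
have in3 v : (v \in [set x; a; b]) = (v \in [:: x; a; b]) by rewrite !inE orbA.
exists ([set x; a; b] :: L); split.
- by rewrite /= sL.
- rewrite /disjoint_seq /= -/(disjoint_seq L) DL andbT; apply/allP => e eL.
  have [_ _ sub] := HL e eL; apply/pred0P => v /=; rewrite in3.
  apply/negP => /andP[v3 /sub vr]; have := dis v vr; rewrite /= v3 //.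
- move=> e; rewrite inE => /orP[/eqP->|eL].
    split.
    + have -> : #|[set x; a; b]| = #|[:: x; a; b]| by apply: eq_card => v; exact: in3.
      by move/card_uniqP: U3 => ->.
    + by exists x; rewrite ?inE ?eqxx.
    + move=> v; rewrite in3 => v3; rewrite -[_ ++ _]/(x :: cs ++ a :: b :: ds) (perm_mem perm) mem_cat v3 //.
  have [e3 [y yc ye] sub] := HL e eL; split => //.
    by exists y => //; rewrite inE yc orbT.
  move=> v /sub vr; rewrite -[_ ++ _]/(x :: cs ++ a :: b :: ds) (perm_mem perm) mem_cat vr orbT //.
Qed.

(** * Undoing a shift that ends in a cover or a clique *)

Lemma swap_cover (T : finType) (i j : T) (e S : {set T}) :
  (swap_set i j e \in cover_family S) = (e \in cover_family (swap_set i j S)).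
Proof. by rewrite ![_ \in cover_family _]inE card_swap -{1}(swap_setK i j S) disjoint_swap. Qed.

Lemma swap_sub (T : finType) (i j : T) (A C : {set T}) : (swap_set i j A \subset swap_set i j C) = (A \subset C).
Proof.
apply/subsetP/subsetP => H v; last by rewrite !inE => /H.
by move=> vA; have := H (tperm i j v); rewrite !inE !tpermK; apply.
Qed.

Lemma swap_clique (T : finType) (i j : T) (e U : {set T}) :
  (swap_set i j e \in clique_family U) = (e \in clique_family (swap_set i j U)).
Proof. by rewrite ![_ \in clique_family _]inE card_swap -{1}(swap_setK i j U) swap_sub. Qed.

(** If [F] contained exactly one of an edge and its mirror image, so would the shifted family. *)
Lemma shift_invariant (T : finType) (i j : T) (F : {set {set T}}) :
  (forall e : {set T}, (swap_set i j e \in shift_family i j F) = (e \in shift_family i j F)) ->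
  F = shift_family i j F.
Proof.
move=> H; apply/setP => e; have := H e; rewrite (shiftE i j F e) (shift_swapE i j F e).
by case: (i \in e); case: (j \in e) => //=; case: (e \in F); case: (_ \in F).
Qed.

Lemma shift_closed (T : finType) (i j : T) (F : {set {set T}}) (e : {set T}) : e \in shift_family i j F ->
  j \in e -> i \notin e -> swap_set i j e \in shift_family i j F.
Proof.
rewrite (shiftE i j F e) (shift_swapE i j F e) => + je /negbTE ie; rewrite je ie /=.
by case/andP => -> ->.
Qed.

Lemma swap_setU1 (T : finType) (i j : T) (q : {set T}) : i \notin q -> j \notin q ->
  swap_set i j (j |: q) = i |: q.
Proof.
move=> /negbTE iq /negbTE jq; apply/setP => v; rewrite !inE.
case: tpermP => [->|->|/eqP/negbTE-> /eqP/negbTE->] //; first by rewrite !eqxx.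
by rewrite iq jq !orbF eq_sym.
Qed.

Lemma two_colours_absurd (T : finType) (i j : T) (F : {set {set T}}) s (q q' : {set T}) (cs ds : seq T) :
  nu_le F s -> i != j -> i |: q \in F -> j |: q' \in F -> i \notin q' -> j \notin q -> [disjoint q & q'] ->
  uniq (cs ++ ds) -> 2 * size cs <= size ds -> s <= (size cs).+1 ->
  (forall v, v \in cs ++ ds -> [&& v != i, v != j, v \notin q & v \notin q']) ->
  (forall e : {set T}, #|e| = 3 -> (exists2 x, x \in cs & x \in e) -> (forall v, v \in e -> v \in cs ++ ds) ->
     e \in F) -> False.
Proof.
move=> HF ij iF jF iq jq dis U sz sc out HE.
have [L [sL DL HL]] := build_triples U sz.
have AL : all (mem F) L by apply/allP => e /HL[h1 h2 h3]; exact: HE.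
suff D : disjoint_seq [:: i |: q, j |: q' & L].
  have := HF [:: i |: q, j |: q' & L]; rewrite /= iF jF AL sL => /(_ isT D).
  by move: sc; clear; lia.
have disL (a : T) (b e : {set T}) : e \in L -> (forall v, v \in cs ++ ds -> (v != a) && (v \notin b)) -> [disjoint a |: b & e].
  move=> eL Ha; have [_ _ sub] := HL e eL; apply/pred0P => v /=; rewrite !inE.
  by apply/negP => /andP[vab /sub /Ha /andP[/negbTE va /negbTE vb]]; rewrite va vb in vab.
rewrite /disjoint_seq /= -/(disjoint_seq L) DL andbT; apply/andP; split; last first.
  by apply/allP => e eL; apply: disL => // v /out /and4P[_ -> _ ->].
apply/andP; split; last by apply/allP => e eL; apply: disL => // v /out /and4P[-> _ -> _].
apply/pred0P => v /=; rewrite !inE; apply/negP => /andP[/orP[/eqP->|vq] /orP[/eqP E|vq']].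
- by rewrite E eqxx in ij.
- by rewrite vq' in iq.
- by rewrite -E vq in jq.
- by have /pred0P/(_ v) := dis; rewrite /= vq vq'.
Qed.

Lemma shift_neutral (T : finType) (i j : T) (F : {set {set T}}) (e : {set T}) : i \notin e -> j \notin e ->
  e \in shift_family i j F -> e \in F.
Proof. by move=> /negbTE ie /negbTE je; rewrite shiftE ie je. Qed.

Lemma unshift_cover (T : finType) (i j : T) (F : {set {set T}}) (S : {set T}) s :
  i != j -> uniform3 F -> nu_le F s -> 3 * s + 3 <= #|T| -> 6 + s <= #|T| -> #|S| = s ->
  shift_family i j F = cover_family S -> exists S' : {set T}, #|S'| = s /\ F = cover_family S'.
Proof.
move=> ij uF HF T1 T2 cS EH.
have inv : (i \in S) = (j \in S) -> exists S' : {set T}, #|S'| = s /\ F = cover_family S'.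
  move=> E; exists S; split => //; rewrite -EH; apply: shift_invariant => e.
  by rewrite EH swap_cover swap_id.
case: (boolP (i \in S)) => iS; case: (boolP (j \in S)) => jS; try by apply: inv; rewrite ?iS ?jS ?(negbTE iS) ?(negbTE jS).
(* An edge whose other two vertices lie in D meets S in i alone, so replacing i by j takes it out of
   the cover. *)
- pose D := ~: (j |: S).
  have cD : #|D| = #|T| - s.+1 by rewrite cardsCs setCK cardsU1 jS cS.
  have Dv v : (v \in D) = (v != j) && (v \notin S) by rewrite !inE negb_or.
  have iD : i \notin D by rewrite !inE iS orbT.
  have jD : j \notin D by rewrite !inE eqxx.
  have [||E|E|[q [q' [qD q'D [q2 q'2] dis /andP[iF jF]]]]] := @recolor T i j F D ij uF _ iD jD _.
  + by rewrite cD; move: T2; clear; lia.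
  + move=> e ie je e3; rewrite EH !inE e3 card_swap e3 eqxx /=.
    have -> : ~~ [disjoint e & S] by apply/pred0Pn; exists i; rewrite /= ie iS.
    have -> : [disjoint swap_set i j e & S] = (e :\ i \subset D).
      apply/pred0P/subsetP => [H v|H v /=].
        rewrite !inE => /andP[vi ve]; have vj : v != j by apply: contraNneq je => <-.
        by rewrite negb_or vj; have := H v; rewrite /= inE tpermD 1?eq_sym // ve /= => ->.
      rewrite inE; apply/negP => /andP[]; case: tpermP => [->|->|/eqP vi /eqP vj].
      * by rewrite (negbTE je).
      * by rewrite (negbTE jS).
      * move=> ve vS; have := H v; rewrite !inE vi ve vS orbT /=; by move/(_ isT).
    by case: (_ \subset D).
  + by exists S; rewrite -EH.
  + exists (swap_set i j S); rewrite card_swap cS; split => //; rewrite [LHS]E EH; apply/setP => e.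
    by rewrite inE swap_cover.
  + exfalso.
    have notD (v : T) (p : {set T}) : v \notin D -> p \subset D -> v \notin p by move=> vD pD; apply: contra vD => /(subsetP pD).
    apply: (@two_colours_absurd T i j F s q q' (enum (S :\ i)) (enum (D :\: (q :|: q'))) HF ij iF jF) => //; try exact: notD.
    * rewrite cat_uniq !enum_uniq andbT; apply/hasPn => v; rewrite mem_enum in_setD Dv => /and3P[_ _ vS].
      by rewrite /= mem_enum in_setD1 (negbTE vS) andbF.
    (* Here 3s + 3 <= |T| enters: |T| - (s + 1) - 4 >= 2(s - 1) vertices are left to complete the s
       - 1 remaining points of S. *)
    * rewrite -!cardE; have := cardsD1 i S; rewrite iS cS.
      have := cardsD D (q :|: q'); rewrite cD.
      have := subset_leq_card (subsetIr D (q :|: q')).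
      have := cardsU q q'; rewrite q2 q'2; move: T1; clear; lia.
    * by rewrite -cardE; have := cardsD1 i S; rewrite iS cS; clear; lia.
    * move=> v; rewrite mem_cat !mem_enum in_setD1 in_setD Dv in_setU negb_or => /orP[/andP[vi vS]|/and3P[/andP[-> ->] -> vS]].
        have vD : v \notin D by rewrite Dv vS andbF.
        by rewrite vi (notD v q vD qD) (notD v q' vD q'D) /= andbT; apply: contraNneq jS => <-.
      by rewrite !andbT; apply: contraNneq vS => ->.
    * move=> e e3 [x]; rewrite mem_enum !inE => /andP[xi xS] xe sub.
      apply: (@shift_neutral T i j).
      - apply/negP => /sub; rewrite mem_cat !mem_enum !inE eqxx iS orbT /= andbF //.
      - apply/negP => /sub; rewrite mem_cat !mem_enum !inE eqxx (negbTE jS) !andbF //.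
      - by rewrite EH !inE e3 eqxx /=; apply/pred0Pn; exists x; rewrite /= xe.
(* A shifted family containing j with two points outside S must contain i with the same points, but
   that edge misses S. *)
- exfalso; have : 1 < #|~: (i |: S)|.
    by have := cardsC (i |: S); rewrite cardsU1 iS cS; move: T2; clear; lia.
  case/card_gt1P => x [y [xD yD xy]]; move: xD yD; rewrite !inE !negb_or => /andP[xi xS] /andP[yi yS].
  have xj : x != j by apply: contraNneq xS => ->.
  have yj : y != j by apply: contraNneq yS => ->.
  have iq : i \notin [set x; y] by rewrite !inE negb_or !(eq_sym i) xi.
  have jq : j \notin [set x; y] by rewrite !inE negb_or !(eq_sym j) xj.
  have jH : j |: [set x; y] \in shift_family i j F.
    rewrite EH inE cardsU1 jq cards2 xy /=; apply/pred0Pn; exists j.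
    by rewrite /= setU11 jS.
  have ijq : i \notin j |: [set x; y] by rewrite in_setU1 negb_or ij iq.
  have := shift_closed jH (setU11 _ _) ijq; rewrite swap_setU1 // EH inE => /andP[_ /pred0Pn[v /= /andP[]]].
  rewrite !inE => /or3P[]/eqP-> h; first by rewrite h in iS.
    by rewrite h in xS.
  by rewrite h in yS.
Qed.

(** The coloured pairs live in U minus i, which has 3s + 1 points. For s = 1 these are four, and the
    Kneser graph of pairs of a 4-set is disconnected; hence 1 < s. *)
Lemma unshift_clique (T : finType) (i j : T) (F : {set {set T}}) (U : {set T}) s :
  i != j -> uniform3 F -> nu_le F s -> 1 < s -> #|U| = 3 * s + 2 ->
  shift_family i j F = clique_family U -> exists U' : {set T}, #|U'| = 3 * s + 2 /\ F = clique_family U'.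
Proof.
move=> ij uF HF s1 cU EH.
have inv : (i \in U) = (j \in U) -> exists U' : {set T}, #|U'| = 3 * s + 2 /\ F = clique_family U'.
  move=> E; exists U; split => //; rewrite -EH; apply: shift_invariant => e.
  by rewrite EH swap_clique swap_id.
case: (boolP (i \in U)) => iU; case: (boolP (j \in U)) => jU; try by apply: inv; rewrite ?iU ?jU ?(negbTE iU) ?(negbTE jU).
- pose D := U :\ i.
  have cD : #|D| = 3 * s + 1 by have := cardsD1 i U; rewrite iU cU -/D; clear; lia.
  have Dv v : (v \in D) = (v != i) && (v \in U) by rewrite in_setD1.
  have iD : i \notin D by rewrite Dv eqxx.
  have jD : j \notin D by rewrite Dv (negbTE jU) andbF.
  have [||E|E|[q [q' [qD q'D [q2 q'2] dis /andP[iF jF]]]]] := @recolor T i j F D ij uF _ iD jD _.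
  + by rewrite cD; move: s1; clear; lia.
  + move=> e ie je e3; rewrite EH !inE e3 card_swap e3 eqxx /=.
    have -> : (swap_set i j e \subset U) = false.
      apply/negP => /subsetP /(_ j); rewrite (swap_in i j e).2 ie (negbTE jU); by move/(_ isT).
    have -> : (e \subset U) = (e :\ i \subset D).
      apply/subsetP/subsetP => H v; first by rewrite Dv !inE => /andP[-> /H].
      case: (eqVneq v i) => [->//|vi ve]; have := H v; rewrite Dv !inE vi ve /=; exact.
    by case: (_ \subset D).
  + by exists U; rewrite -EH.
  + exists (swap_set i j U); rewrite card_swap cU; split => //; rewrite [LHS]E EH; apply/setP => e.
    by rewrite inE swap_clique.
  + exfalso.
    have notD (v : T) (p : {set T}) : v \notin D -> p \subset D -> v \notin p by move=> vD pD; apply: contra vD => /(subsetP pD).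
    pose R := enum (D :\: (q :|: q')).
    have sR : 3 * (s - 1) <= size R.
      rewrite /R -cardE; have := cardsD D (q :|: q'); rewrite cD.
      have := subset_leq_card (subsetIr D (q :|: q')).
      have := cardsU q q'; rewrite q2 q'2; move: s1; clear; lia.
    have inR v : (v \in take (s - 1) R ++ drop (s - 1) R) = [&& v \notin q, v \notin q', v != i & v \in U].
      by rewrite cat_take_drop mem_enum in_setD in_setU Dv negb_or -andbA.
    apply: (@two_colours_absurd T i j F s q q' (take (s - 1) R) (drop (s - 1) R) HF ij iF jF) => //; try exact: notD.
    * by rewrite cat_take_drop enum_uniq.
    * by rewrite size_take_min size_drop; move: sR; clear; lia.
    * by rewrite size_take_min; move: sR s1; clear; lia.
    * move=> v; rewrite inR => /and4P[-> -> -> vU]; rewrite !andbT.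
      by apply: contraNneq jU => <-.
    * move=> e e3 _ sub; apply: (@shift_neutral T i j).
      - by apply/negP => /sub; rewrite inR eqxx !andbF.
      - by apply/negP => /sub; rewrite inR (negbTE jU) !andbF.
      - by rewrite EH inE e3 eqxx /=; apply/subsetP => v /sub; rewrite inR => /and4P[].
- exfalso; have : 1 < #|U :\ j|.
    by have := cardsD1 j U; rewrite jU cU; move: s1; clear; lia.
  case/card_gt1P => x [y [xD yD xy]]; move: xD yD; rewrite !in_setD1 => /andP[xj xU] /andP[yj yU].
  have iq : i \notin [set x; y] by rewrite !inE negb_or; apply/andP; split; apply: contraNneq iU => ->.
  have jq : j \notin [set x; y] by rewrite !inE negb_or !(eq_sym j) xj.
  have jH : j |: [set x; y] \in shift_family i j F.
    rewrite EH inE cardsU1 jq cards2 xy /=; apply/subsetP => v; rewrite !inE.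
    by case/or3P => /eqP->.
  have ijq : i \notin j |: [set x; y] by rewrite in_setU1 negb_or ij iq.
  have := shift_closed jH (setU11 _ _) ijq; rewrite swap_setU1 // EH inE => /andP[_ /subsetP /(_ i)].
  by rewrite setU11 (negbTE iU) => /(_ isT).
Qed.

(** * Extremal families of triples *)

Definition mkset n (l : seq nat) : {set 'I_n} := [set v : 'I_n | (v : nat) \in l].

Definition tri_fun n (F : {set {set 'I_n}}) (x y z : nat) : bool :=
  [&& x < y, y < z, z < n & mkset n [:: x; y; z] \in F].

Lemma shifted_step n (F : {set {set 'I_n}}) (l : seq nat) u w :
  (forall i j : 'I_n, i < j -> shift_family i j F = F) -> u < w -> w < n -> w \in l -> u \notin l ->
  mkset n l \in F -> mkset n (map (fun x => if x == w then u else x) l) \in F.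
Proof.
move=> HF uw wn wl ul lF; have un := ltn_trans uw wn.
pose i := Ordinal un; pose j := Ordinal wn.
have : swap_set i j (mkset n l) \in F.
  move: lF; rewrite -{1}(HF i j uw) shiftE /mkset !inE /= wl (negbTE ul) /=.
  by case/andP.
congr (_ \in F); apply/setP => v; rewrite !inE.
case: tpermP => [->|->|vi vj] /=.
- by rewrite wl; apply/esym/mapP; exists w; rewrite ?eqxx.
- rewrite (negbTE ul); apply/esym/mapP => -[x _]; case: eqP => [_|ne] E; last by rewrite E in ne.
  by rewrite E ltnn in uw.
- have vu' : (v : nat) != u by apply/eqP => E; apply: vi; apply: val_inj.
  have vw' : (v : nat) != w by apply/eqP => E; apply: vj; apply: val_inj.
  apply/idP/mapP => [vl|[x xl]]; first by exists (v : nat); rewrite ?(negbTE vw').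
  by case: eqP => [_ E|_ ->] //; rewrite E eqxx in vu'.
Qed.

Lemma tri_shifted n (F : {set {set 'I_n}}) :
  (forall i j : 'I_n, i < j -> shift_family i j F = F) -> shifted_system n (tri_fun F).
Proof.
move=> HF; split=> [x y z /and4P[-> -> -> _]//|x y z x' y' z' /and4P[xy yz zn xF] hx hy hz xy' yz'].
rewrite /tri_fun xy' yz' (leq_ltn_trans hz zn) /=.
have h1 : mkset n [:: x'; y; z] \in F.
  case: (eqVneq x' x) => [->//|ne]; have lt : x' < x by rewrite ltn_neqAle ne.
  have := @shifted_step n F _ x' x HF lt _ _ _ xF; rewrite /= eqxx.
  have /negbTE -> : y != x by rewrite neq_ltn xy orbT.
  have /negbTE -> : z != x by rewrite neq_ltn (ltn_trans xy yz) orbT.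
  by apply; rewrite ?inE ?eqxx //; move: lt xy yz zn; clear; lia.
have h2 : mkset n [:: x'; y'; z] \in F.
  case: (eqVneq y' y) => [->//|ne]; have lt : y' < y by rewrite ltn_neqAle ne.
  have := @shifted_step n F _ y' y HF lt _ _ _ h1; rewrite /= eqxx.
  have /negbTE -> : x' != y by move: hx xy; clear; lia.
  have /negbTE -> : z != y by rewrite neq_ltn yz orbT.
  by apply; rewrite ?inE ?eqxx ?orbT //; move: lt hx xy yz zn xy'; clear; lia.
case: (eqVneq z' z) => [->//|ne]; have lt : z' < z by rewrite ltn_neqAle ne.
have := @shifted_step n F _ z' z HF lt _ _ _ h2; rewrite /= eqxx.
have /negbTE -> : x' != z by move: hx xy yz; clear; lia.
have /negbTE -> : y' != z by move: hy yz; clear; lia.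
by apply; rewrite ?inE ?eqxx ?orbT //; move: lt hx hy xy yz zn xy' yz'; clear; lia.
Qed.

Lemma mkset_perm n l l' : l =i l' -> mkset n l = mkset n l'.
Proof. by move=> E; apply/setP => v; rewrite !inE E. Qed.

Lemma symm_tri n (F : {set {set 'I_n}}) a b c : symm (tri_fun F) a b c -> mkset n [:: a; b; c] \in F.
Proof.
rewrite /symm /tri_fun => /and4P[h1 h2 h3]; congr (_ \in F); apply: mkset_perm => v.
by rewrite !inE; move: h1 h2; clear; lia.
Qed.

Lemma tri_nu n (F : {set {set 'I_n}}) s : nu_le F s -> matching_le (tri_fun F) s.
Proof.
move=> HF M /andP[A U]; rewrite -(size_map (fun t => mkset n (tv t)) M); apply: HF.
  by rewrite all_map; apply/allP => t /(allP A) /symm_tri.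
rewrite /disjoint_seq pairwise_map; move: U; clear; elim: M => // t M IH.
rewrite verts_cons cat_uniq => /and3P[_ /hasPn dis /IH U]; rewrite /= U andbT.
apply/allP => t' t'M /=; apply/pred0P => v /=; rewrite ![v \in mkset _ _]inE.
apply/negP => /andP[v1 v2]; have /negP := dis v (mem_verts t'M v2); apply; exact: v1.
Qed.

Lemma sorted_triple n (e : {set 'I_n}) : #|e| = 3 ->
  exists x y z : 'I_n, [/\ x < y, y < z & e = mkset n [:: nat_of_ord x; nat_of_ord y; nat_of_ord z]].
Proof.
move=> e3; pose l := sort (fun a b : 'I_n => a <= b) (enum e).
have sl : size l = 3 by rewrite size_sort -cardE.
have tot : total (fun a b : 'I_n => a <= b) by move=> a b; exact: leq_total.
have so := sort_sorted tot (enum e); have ul : uniq l by rewrite sort_uniq enum_uniq.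
have ml v : (v \in l) = (v \in e) by rewrite mem_sort mem_enum.
rewrite -/l in so; case: l sl so ul ml => [|x [|y [|z [|]]]] //= _ /and3P[xy yz _].
rewrite !inE negb_or => /and3P[/andP[nxy nxz] nyz _] ml.
exists x, y, z; split.
- by rewrite ltn_neqAle xy andbT.
- by rewrite ltn_neqAle yz andbT.
- by apply/setP => v; rewrite !inE -ml !inE.
Qed.

Lemma mkset_inj n (x y z x' y' z' : 'I_n) : x < y -> y < z -> x' < y' -> y' < z' ->
  mkset n [:: nat_of_ord x; nat_of_ord y; nat_of_ord z] = mkset n [:: nat_of_ord x'; nat_of_ord y'; nat_of_ord z'] ->
  (x, y, z) = (x', y', z').
Proof.
move=> h1 h2 h3 h4 E.
have m v := congr1 (fun A : {set 'I_n} => v \in A) E.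
have := m x; have := m y; have := m z; have := m x'; have := m y'; have := m z'.
rewrite !inE !eqxx ?orbT => e1 e2 e3 e4 e5 e6.
by congr (_, _, _); apply: val_inj => /=; move: h1 h2 h3 h4 e1 e2 e3 e4 e5 e6; clear; lia.
Qed.

Lemma sum_widen m n (G : nat -> nat) : m <= n ->
  \sum_(y < m) G y = \sum_(y < n) if y < m then G y else 0.
Proof. by move=> mn; rewrite (big_ord_widen n G mn) big_mkcond. Qed.

Lemma tri_cnt n (F : {set {set 'I_n}}) : uniform3 F -> cnt (tri_fun F) n = #|F|.
Proof.
move=> uF; pose P := [set t : 'I_n * 'I_n * 'I_n | tri_fun F t.1.1 t.1.2 t.2].
pose h (t : 'I_n * 'I_n * 'I_n) := mkset n [:: nat_of_ord t.1.1; nat_of_ord t.1.2; nat_of_ord t.2].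
have hF : h @: P = F.
  apply/setP => e; apply/imsetP/idP => [[[[x y] z]]|eF].
    by rewrite inE /tri_fun => /and4P[_ _ _ xF] ->.
  have [x [y [z [xy yz E]]]] := sorted_triple (uF e eF).
  by exists (x, y, z) => //; rewrite inE /tri_fun xy yz ltn_ord -E.
rewrite -[in RHS]hF card_in_imset; last first.
  move=> [[x y] z] [[x' y'] z']; rewrite !inE /= => /and4P[a1 a2 _ _] /and4P[b1 b2 _ _].
  exact: mkset_inj.
rewrite -sum1_card (eq_bigl (fun t : 'I_n * 'I_n * 'I_n => tri_fun F t.1.1 t.1.2 t.2)); last first.
  by move=> t; rewrite inE.
rewrite big_mkcond -(pair_bigA _ (fun (p : 'I_n * 'I_n) (z : 'I_n) => if tri_fun F p.1 p.2 z then 1 else 0)) /=.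
rewrite -(pair_bigA _ (fun x y : 'I_n => \sum_(z < n) if tri_fun F x y z then 1 else 0)) /=.
rewrite exchange_big /=; under eq_bigr => y _ do rewrite exchange_big /=.
rewrite exchange_big /= /cnt; apply: eq_bigr => z _.
transitivity (\sum_(y < n) if y < z then \sum_(x < y) tri_fun F x y z else 0); first exact: (sum_widen (fun y => \sum_(x < y) tri_fun F x y z) (ltnW (ltn_ord z))).
apply: eq_bigr => y _; case: ifP => yz; last first.
  by rewrite big1 // => x _; rewrite /tri_fun yz andbF.
transitivity (\sum_(x < n) if x < y then nat_of_bool (tri_fun F x y z) else 0); first exact: (sum_widen (fun x => nat_of_bool (tri_fun F x y z)) (ltnW (ltn_ord y))).
by apply: eq_bigr => x _; rewrite /tri_fun; case: (x < y) => //=; case: (_ && _).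
Qed.

Lemma card_low m n : m <= n -> #|[set v : 'I_n | v < m]| = m.
Proof.
move=> mn; rewrite -sum1_card (eq_bigl (fun v : 'I_n => v < m)); last by move=> v; rewrite inE.
by rewrite -(big_ord_widen n (fun=> 1) mn) sum1_card card_ord.
Qed.

Lemma tri_cover n (F : {set {set 'I_n}}) s : s <= n -> uniform3 F -> is_cover (tri_fun F) n s ->
  exists S : {set 'I_n}, #|S| = s /\ F = cover_family S.
Proof.
move=> sn uF H; pose S := [set v : 'I_n | v < s]; exists S; split.
  exact: card_low.
apply/setP => e; rewrite inE; case: (eqVneq #|e| 3) => [e3|ne] /=; last first.
  by apply/negP => /uF E; rewrite E eqxx in ne.
have [x [y [z [xy yz E]]]] := sorted_triple e3.
have := H x y z xy yz (ltn_ord z); rewrite /tri_fun xy yz ltn_ord -E /= => ->.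
apply/idP/pred0Pn => [xs|[v /=]].
  by exists x; rewrite /= E !inE eqxx xs.
by rewrite E !inE; move: xy yz; clear; lia.
Qed.

Lemma tri_clique n (F : {set {set 'I_n}}) s : 3 * s + 2 <= n -> uniform3 F -> is_clique (tri_fun F) n s ->
  exists U : {set 'I_n}, #|U| = 3 * s + 2 /\ F = clique_family U.
Proof.
move=> sn uF H; pose U := [set v : 'I_n | v < 3 * s + 2]; exists U; split.
  exact: card_low.
apply/setP => e; rewrite inE; case: (eqVneq #|e| 3) => [e3|ne] /=; last first.
  by apply/negP => /uF E; rewrite E eqxx in ne.
have [x [y [z [xy yz E]]]] := sorted_triple e3.
have := H x y z xy yz (ltn_ord z); rewrite /tri_fun xy yz ltn_ord -E /= => ->.
apply/idP/subsetP => [zs v|/(_ z)]; last by rewrite E !inE eqxx !orbT => /(_ isT).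
by rewrite E !inE; move: xy yz zs; clear; lia.
Qed.

Lemma card_clique_family (T : finType) (U : {set T}) : #|clique_family U| = 'C(#|U|, 3).
Proof. by rewrite -cards_draws; congr #|pred_of_set _|; apply/setP => a; rewrite !inE andbC. Qed.

Definition family_extremal n s (F : {set {set 'I_n}}) :=
  #|F| <= maxn (cover_bound n s) (clique_bound s) /\
  (#|F| = maxn (cover_bound n s) (clique_bound s) ->
     (exists S : {set 'I_n}, #|S| = s /\ F = cover_family S) \/
     (exists U : {set 'I_n}, #|U| = 3 * s + 2 /\ F = clique_family U)).

Lemma set_extremal : exists N0, forall n s (F : {set {set 'I_n}}), N0 <= n -> 0 < s -> 3 * s + 2 <= n ->
  uniform3 F -> nu_le F s -> family_extremal s F.
Proof.
(* As s < n/3, the term 2 * N1 yields N1 + s <= n. The 20 provides 6 + s <= n and makes the cover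
   bound exceed the clique bound 10 when s = 1. *)
have [N1 HN] := shifted_extremal; exists (2 * N1 + 20) => n s F hn s0 sn.
have N1n : N1 + s <= n by move: hn sn; clear; lia.
move: {2}(potential F).+1 (ltnSn (potential F)) => k; elim: k F => // k IH F pF uF HF.
case: (boolP [forall i : 'I_n, forall j : 'I_n, (i < j) ==> (shift_family i j F == F)]) => [/forallP sh|].
  have sh' (i j : 'I_n) : i < j -> shift_family i j F = F.
    by move=> ij; have /forallP/(_ j) := sh i; rewrite ij => /eqP.
  have [le eq] := HN s n _ (tri_shifted sh') (tri_nu HF) sn N1n.
  rewrite (tri_cnt uF) in le eq; split => // /eq[co|cl]; [left|right].
    by apply: tri_cover co => //; move: sn; clear; lia.
  exact: tri_clique cl.
rewrite negb_forall => /existsP[i]; rewrite negb_forall => /existsP[j].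
rewrite negb_imply => /andP[ij ne].
have ij' : i != j by rewrite neq_ltn ij.
have [] := IH (shift_family i j F).
- by rewrite -ltnS (leq_trans _ pF) // ltnS shift_potential.
- exact: shift_uniform.
- exact: shift_nu.
rewrite card_shift => le eq; split => // e.
(* At n = 3s + 2 there is no room for [unshift_cover], but the bound is C(n, 3) and equality means
   all triples. *)
have [n2|n3] := leqP n (3 * s + 2).
  have nE : n = 3 * s + 2 by apply/eqP; rewrite eqn_leq n2 sn.
  right; exists setT; rewrite cardsT card_ord; split => //.
  have cE : #|clique_family [set: 'I_n]| = 'C(n, 3).
    by rewrite card_clique_family cardsT card_ord.
  apply/eqP; rewrite eqEcard; apply/andP; split.
    by apply/subsetP => a /uF a3; rewrite inE a3 subsetT.
  by rewrite cE e leq_max /clique_bound -nE leqnn orbT.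
have [[S [cS ES]]|[U [cU EU]]] := eq e.
- left; apply: (unshift_cover ij' uF HF _ _ cS ES); rewrite card_ord; move: n3 hn; clear; lia.
- have s1 : 1 < s.
    case: (ltngtP s 1) s0 => // s1 _; exfalso.
    have : #|F| = 10.
      by rewrite -(card_shift i j F) EU card_clique_family cU s1.
    rewrite e s1; apply/eqP; rewrite neq_ltn; apply/orP; right; rewrite leq_max; apply/orP; left.
    rewrite /cover_bound; have [m mE] : {m | n = m.+1} by exists n.-1; move: hn; clear; lia.
    rewrite mE subSS subn0 binS addnC addnK; have := bin2E m.
    have h : 19 * 18 <= m * (m - 1) by apply: leq_mul; move: hn; rewrite mE; clear; lia.
    by move: h; clear; lia.
  right; exact: (unshift_clique ij' uF HF s1 cU EU).
Qed.

(** * Transfer to hypergraphs *)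

Lemma disjoint_seq_sum (T : finType) (L : seq {set T}) (S : {set T}) : disjoint_seq L ->
  \sum_(e <- L) #|e :&: S| <= #|S|.
Proof.
elim: L S => [|a L IH] S; first by rewrite big_nil.
rewrite /disjoint_seq /= -/(disjoint_seq L) => /andP[/allP da dL]; rewrite big_cons.
rewrite -(cardsID a S) setIC leq_add2l; apply: leq_trans (IH (S :\: a) dL).
rewrite big_seq [X in _ <= X]big_seq; apply: leq_sum => e eL; apply: subset_leq_card.
apply/subsetP => v; rewrite !inE => /andP[ve ->]; rewrite ve andbT /=.
by apply/negP => va; have /pred0P/(_ v) := da e eL; rewrite /= va ve.
Qed.

Lemma cover_nu (T : finType) (S : {set T}) : nu_le (cover_family S) #|S|.
Proof.
move=> L AL DL; apply: leq_trans (disjoint_seq_sum S DL).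
elim: L AL {DL} => [|e L IH] /=; first by rewrite big_nil.
case/andP=> eS /IH h; rewrite big_cons -add1n leq_add //; move: eS.
by rewrite inE -setI_eq0 -card_gt0 => /andP[].
Qed.

Lemma clique_nu (T : finType) (U : {set T}) s : #|U| = 3 * s + 2 -> nu_le (clique_family U) s.
Proof.
move=> cU L AL DL; have := disjoint_seq_sum U DL.
have -> : \sum_(e <- L) #|e :&: U| = 3 * size L.
  elim: L AL {DL} => [|e L IH] /=; first by rewrite big_nil.
  case/andP=> eU /IH h; rewrite big_cons h mulnS; congr (_ + _); move: eU.
  by rewrite inE => /andP[/eqP e3 /setIidPl->].
by rewrite cU; clear; lia.
Qed.

Lemma cover_matching (T : finType) (S : {set T}) : 3 * #|S| <= #|T| ->
  exists L, [/\ all (mem (cover_family S)) L, disjoint_seq L & size L = #|S|].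
Proof.
move=> hS; have [||L [sL DL HL]] := @build_triples T (enum S) (enum (~: S)).
- rewrite cat_uniq !enum_uniq andbT; apply/hasPn => v; rewrite mem_enum inE => vS.
  by rewrite /= mem_enum.
- by rewrite -!cardE; have := cardsC S; move: hS; clear; lia.
exists L; split; rewrite ?sL -?cardE //; apply/allP => e /HL[e3 [x xS xe] _].
by rewrite /= inE e3 eqxx; apply/pred0Pn; exists x; rewrite /= xe -mem_enum.
Qed.

Lemma clique_matching (T : finType) (U : {set T}) s : #|U| = 3 * s + 2 ->
  exists L, [/\ all (mem (clique_family U)) L, disjoint_seq L & size L = s].
Proof.
move=> cU; have sU : size (enum U) = 3 * s + 2 by rewrite -cardE.
have [||L [sL DL HL]] := @build_triples T (take s (enum U)) (drop s (enum U)).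
- by rewrite cat_take_drop enum_uniq.
- by rewrite size_take_min size_drop sU; clear; lia.
exists L; split => //; last by rewrite sL size_take_min sU; clear; lia.
apply/allP => e /HL[e3 _ sub]; rewrite /= inE e3 eqxx; apply/subsetP => v /sub.
by rewrite cat_take_drop mem_enum.
Qed.

Lemma card_cover_family (T : finType) (S : {set T}) : #|cover_family S| = 'C(#|T|, 3) - 'C(#|T| - #|S|, 3).
Proof.
have h : #|clique_family (~: S)| + #|cover_family S| = 'C(#|T|, 3).
  rewrite -card_draws -[RHS](cardsID (clique_family (~: S))); congr (_ + _); congr #|pred_of_set _|.
    by apply/setP => e; rewrite !inE andbA andbb.
  apply/setP => e; rewrite !inE -disjoints_subset; case: (_ == 3) => //=.
  by rewrite andbT.
have cC : #|~: S| = #|T| - #|S| by rewrite cardsCs setCK.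
by rewrite -h card_clique_family cC addKn.
Qed.

(** Vertices are numbered by their place in the enumeration of [V]; any numbering serves. The
    default 0 is never reached when |V| = n. *)
Definition vtx (V : {fset nat}) n (i : 'I_n) : nat := nth 0 (enum_fset V) i.
Definition to_fset (V : {fset nat}) n (A : {set 'I_n}) : {fset nat} :=
  [fset x in [seq vtx V i | i <- enum A]]%fset.
Definition to_set (V : {fset nat}) n (e : {fset nat}) : {set 'I_n} := [set i | vtx V i \in e].
Definition family_of n (G : hgraph) : {set {set 'I_n}} := [set A | to_fset (hV G) A \in hE G].

Lemma vtx_inj V n : #|` V| = n -> injective (@vtx V n).
Proof.
move=> <- i j /eqP; rewrite /vtx nth_uniq ?fset_uniq // => /eqP E; exact: val_inj.
Qed.

Lemma vtx_in V n (i : 'I_n) : #|` V| = n -> vtx V i \in V.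
Proof. by move=> E; apply: mem_nth; rewrite -[size _]/(#|` V|) E. Qed.

Lemma vtx_onto V n x : #|` V| = n -> x \in V -> exists i : 'I_n, vtx V i = x.
Proof.
move=> <- xV; have h : index x (enum_fset V) < #|` V| by rewrite index_mem.
by exists (Ordinal h); rewrite /vtx /= nth_index.
Qed.

Lemma in_to_fset V n (A : {set 'I_n}) (i : 'I_n) : #|` V| = n -> (vtx V i \in to_fset V A) = (i \in A).
Proof.
by move=> E; rewrite !inE /= mem_map ?mem_enum //; exact: vtx_inj.
Qed.

Lemma to_fsetP V n (A : {set 'I_n}) x : x \in to_fset V A -> exists2 i, i \in A & x = vtx V i.
Proof. by rewrite !inE /= => /mapP[i]; rewrite mem_enum => iA ->; exists i. Qed.

Lemma to_fsetK V n : #|` V| = n -> cancel (@to_fset V n) (@to_set V n).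
Proof. by move=> E A; apply/setP => i; rewrite inE in_to_fset. Qed.

Lemma to_setK V n (e : {fset nat}) : #|` V| = n -> (e `<=` V)%fset -> to_fset V (to_set V n e) = e.
Proof.
move=> E eV; apply/fsetP => x; apply/idP/idP => [/to_fsetP[i]|xe].
  by rewrite inE => ? ->.
have [i Ei] := vtx_onto E (fsubsetP eV x xe).
by move: xe; rewrite -Ei in_to_fset // inE.
Qed.

Lemma to_fset_inj V n : #|` V| = n -> injective (@to_fset V n).
Proof. by move=> E; exact: can_inj (to_fsetK E). Qed.

Lemma card_to_fset V n (A : {set 'I_n}) : #|` V| = n -> #|` to_fset V A| = #|A|.
Proof.
move=> E; rewrite card_fseq undup_id ?size_map -?cardE //.
by rewrite map_inj_uniq ?enum_uniq //; exact: vtx_inj.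
Qed.

Lemma to_fset_sub V n (A : {set 'I_n}) : #|` V| = n -> (to_fset V A `<=` V)%fset.
Proof. by move=> E; apply/fsubsetP => x /to_fsetP[i _ ->]; exact: vtx_in. Qed.

Lemma to_fset_subset V n (A C : {set 'I_n}) : #|` V| = n ->
  (to_fset V A `<=` to_fset V C)%fset = (A \subset C).
Proof.
move=> E; apply/fsubsetP/subsetP => H x; last by move=> /to_fsetP[i iA ->]; rewrite in_to_fset // H.
by rewrite -!(in_to_fset _ _ E); exact: H.
Qed.

Lemma to_fset_disjoint V n (A C : {set 'I_n}) : #|` V| = n ->
  (to_fset V A `&` to_fset V C == fset0)%fset = [disjoint A & C].
Proof.
move=> E; apply/eqP/pred0P => [H i /=|H].
  have := in_fset0 (vtx V i); rewrite -H in_fsetI !in_to_fset //.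
apply/fsetP => x; rewrite in_fsetI in_fset0; apply/negP => /andP[/to_fsetP[i iA ->]].
by rewrite in_to_fset // => iC; have := H i; rewrite /= iA iC.
Qed.

Lemma kgraph_edge k G e : kgraph k G -> e \in hE G -> (e `<=` hV G)%fset /\ #|` e| = k.
Proof. by move=> /allP H /H /andP[-> /eqP]. Qed.

Lemma family_uniform n G : kgraph 3 G -> #|` hV G| = n -> uniform3 (family_of n G).
Proof.
move=> kG E A; rewrite inE => /(kgraph_edge kG)[_]; by rewrite card_to_fset.
Qed.

Lemma card_family n G : kgraph 3 G -> #|` hV G| = n -> #|family_of n G| = #|` hE G|.
Proof.
move=> kG E; have -> : family_of n G = [set A in [seq to_set (hV G) n e | e <- enum_fset (hE G)]].
  apply/setP => A; rewrite !inE; apply/idP/mapP => [AE|[e eE ->]].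
    by exists (to_fset (hV G) A); rewrite ?to_fsetK.
  by have [eV _] := kgraph_edge kG eE; rewrite to_setK.
rewrite cardsE; have U : uniq [seq to_set (hV G) n e | e <- enum_fset (hE G)].
  rewrite map_inj_in_uniq ?fset_uniq // => e e' eE e'E H.
  have [eV _] := kgraph_edge kG eE; have [e'V _] := kgraph_edge kG e'E.
  by rewrite -(to_setK E eV) H to_setK.
by move/card_uniqP: U => ->; rewrite size_map.
Qed.

Lemma pairwise_disjointP (M : {fset {fset nat}}) :
  reflect (forall e e', e \in M -> e' \in M -> e != e' -> (e `&` e' == fset0)%fset) (pairwise_disjoint M).
Proof.
apply: (iffP allP) => [H e e' eM e'M ne|H e eM].
  by have /allP/(_ e' e'M) := H e eM; rewrite (negbTE ne).
by apply/allP => e' e'M; case: eqVneq => //= ne; exact: H.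
Qed.

Lemma matching_number_ge n G L : kgraph 3 G -> #|` hV G| = n -> all (mem (family_of n G)) L ->
  disjoint_seq L -> size L <= matching_number G.
Proof.
move=> kG E AL DL; have uF := family_uniform kG E.
(* A repeated entry would be disjoint from itself, hence empty, whereas edges have three points. So
   passing to a finite set keeps the size. *)
have UL : uniq L.
  elim: L AL DL => //= A L IH /andP[AF AL]; rewrite /disjoint_seq /= -/(disjoint_seq L) => /andP[/allP dA DL].
  rewrite IH // andbT; apply/negP => /dA; rewrite -setI_eq0 setIid => /eqP A0.
  by have := uF _ AF; rewrite A0 cards0.
pose M : {fset {fset nat}} := [fset e in [seq to_fset (hV G) A | A <- L]]%fset.
have -> : size L = #|` M|.
  rewrite card_fseq undup_id ?size_map // map_inj_uniq //; exact: to_fset_inj.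
rewrite /matching_number; apply: (@leq_bigmax_seq _ (enum_fset (fpowerset (hE G))) pairwise_disjoint (fun M0 : {fset {fset nat}} => #|` M0|) M).
  rewrite fpowersetE; apply/fsubsetP => e; rewrite !inE /= => /mapP[A AA ->].
  by have := allP AL A AA; rewrite /= inE.
apply/pairwise_disjointP => e e'; rewrite !inE /= => /mapP[A AA ->] /mapP[C CC ->] ne.
rewrite to_fset_disjoint //; have neAC : A != C by apply: contraNneq ne => ->.
move: AA CC DL; elim: (L) => // a L' IH; rewrite !inE /disjoint_seq /= -/(disjoint_seq L').
move=> /orP[/eqP EA|m] /orP[/eqP EC|m'] /andP[/allP Ha P'].
- by rewrite EA EC eqxx in neAC.
- by rewrite EA Ha.
- by rewrite EC disjoint_sym Ha.
- exact: IH.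
Qed.

Lemma matching_number_le n G s : kgraph 3 G -> #|` hV G| = n -> nu_le (family_of n G) s ->
  matching_number G <= s.
Proof.
move=> kG E HF; apply/bigmax_leqP_seq => M; rewrite fpowersetE => /fsubsetP ME /pairwise_disjointP PM.
rewrite -[#|` M|](size_map (to_set (hV G) n) (enum_fset M)); apply: HF.
  rewrite all_map; apply/allP => e eM /=; have eE := ME e eM.
  by have [eV _] := kgraph_edge kG eE; rewrite inE to_setK.
have : uniq (enum_fset M) by exact: fset_uniq.
have sub : {subset enum_fset M <= M} by [].
elim: (enum_fset M) sub => // e L IH sub /= /andP[eL UL].
rewrite /disjoint_seq /= -/(disjoint_seq _) IH // ?andbT; last by move=> x xL; apply: sub; rewrite inE xL orbT.
apply/allP => _ /mapP[e' e'L ->]; rewrite -(to_fset_disjoint _ _ E).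
have eM : e \in M by apply: sub; rewrite mem_head.
have e'M : e' \in M by apply: sub; rewrite inE e'L orbT.
have [eV _] := kgraph_edge kG (ME e eM); have [e'V _] := kgraph_edge kG (ME e' e'M).
by rewrite !to_setK //; apply: PM => //; apply: contraNneq eL => ->.
Qed.

Lemma cover_edges n G (S : {set 'I_n}) : kgraph 3 G -> #|` hV G| = n ->
  family_of n G = cover_family S ->
  hE G = [fset e in fpowerset (hV G) | (#|` e| == 3) && (e `&` to_fset (hV G) S != fset0)]%fset.
Proof.
move=> kG E FS; apply/fsetP => e; rewrite !inE /= fpowersetE; apply/idP/and3P => [eE|[eV e3 eS]].
  have [eV e3] := kgraph_edge kG eE; rewrite eV e3 -(to_setK E eV) to_fset_disjoint //.
  have : to_set (hV G) n e \in family_of n G by rewrite inE to_setK.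
  by rewrite FS inE => /andP[].
have : to_set (hV G) n e \in cover_family S.
  by rewrite inE -(card_to_fset _ E) -(to_fset_disjoint _ _ E) to_setK // e3.
by rewrite -FS inE to_setK.
Qed.

Lemma clique_edges n G (U : {set 'I_n}) : kgraph 3 G -> #|` hV G| = n ->
  family_of n G = clique_family U ->
  hE G = [fset e in fpowerset (to_fset (hV G) U) | #|` e| == 3]%fset.
Proof.
move=> kG E FU; apply/fsetP => e; rewrite !inE /= fpowersetE; apply/idP/andP => [eE|[eU e3]].
  have [eV e3] := kgraph_edge kG eE; rewrite e3 -(to_setK E eV) to_fset_subset //.
  have : to_set (hV G) n e \in family_of n G by rewrite inE to_setK.
  by rewrite FU inE => /andP[].
have eV : (e `<=` hV G)%fset by apply: fsubset_trans eU (to_fset_sub _ E).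
have : to_set (hV G) n e \in clique_family U.
  by rewrite inE -(card_to_fset _ E) -(to_fset_subset _ _ E) to_setK // e3.
by rewrite -FU inE to_setK.
Qed.

Definition graph_of n (F : {set {set 'I_n}}) : hgraph :=
  let V := [fset x in iota 0 n]%fset in HGraph V [fset e in [seq to_fset V A | A <- enum F]]%fset.

Lemma graph_of_vertices n (F : {set {set 'I_n}}) : #|` hV (graph_of F)| = n.
Proof. by rewrite card_fseq undup_id ?iota_uniq // size_iota. Qed.

Lemma graph_of_family n (F : {set {set 'I_n}}) : family_of n (graph_of F) = F.
Proof.
have E := graph_of_vertices F; apply/setP => A; rewrite !inE /= mem_map ?mem_enum //.
exact: to_fset_inj.
Qed.

Lemma graph_of_kgraph n (F : {set {set 'I_n}}) : uniform3 F -> kgraph 3 (graph_of F).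
Proof.
move=> uF; have E := graph_of_vertices F; apply/allP => e; rewrite !inE /= => /mapP[A].
by rewrite mem_enum => AF ->; rewrite to_fset_sub // card_to_fset // (uF _ AF).
Qed.

(** [Hk] asks for matching number exactly s, so a matching of size s has to be supplied along with
    the upper bound. *)
Lemma realize_family n s (F : {set {set 'I_n}}) : uniform3 F -> nu_le F s ->
  (exists L, [/\ all (mem F) L, disjoint_seq L & size L = s]) ->
  exists G, Hk 3 n s G /\ #|` hE G| = #|F|.
Proof.
move=> uF HF [L [AL DL sL]]; have E := graph_of_vertices F; have kG := graph_of_kgraph uF.
have EF := graph_of_family F.
exists (graph_of F); split; last by rewrite -(card_family kG E) EF.
split=> //; split=> //; apply/eqP; rewrite eqn_leq (matching_number_le kG E) ?EF //=.
by rewrite -sL (matching_number_ge kG E) ?EF.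
Qed.

Lemma mu_kE k n s m : is_max_edges k n s m -> mu_k k n s = m.
Proof.
move=> Hm; have [[G [HG EG]] le] : is_max_edges k n s (mu_k k n s) by apply: epsilon_spec; exists m.
have [[G' [HG' EG']] le'] := Hm.
by apply/eqP; rewrite eqn_leq -{1}EG -{2}EG' le' // le.
Qed.

Theorem theorem1 :
  exists n0 : nat, forall n s : nat, n0 <= n -> 1 <= s -> 3 * s + 2 <= n ->
    mu_k 3 n s = maxn ('C(n, 3) - 'C(n - s, 3)) 'C(3 * s + 2, 3) /\
    (forall G : hgraph, Mk 3 n s G -> Cov 3 n s G \/ Cl 3 n s G).
Proof.
have [n0 Hn0] := set_extremal; exists n0 => n s hn s1 sn.
have key G : Hk 3 n s G -> family_extremal s (family_of n G).
  move=> [kG [E mG]]; apply: Hn0 => //; first exact: family_uniform.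
  by move=> L AL DL; rewrite -mG; exact: matching_number_ge DL.
have muE : mu_k 3 n s = maxn (cover_bound n s) (clique_bound s).
  apply: mu_kE; split; last first.
    by move=> G HG; have [kG [E _]] := HG; have [le _] := key G HG; rewrite -(card_family kG E).
  have [le|lt] := leqP (cover_bound n s) (clique_bound s).
    pose U := [set v : 'I_n | v < 3 * s + 2].
    have cU : #|U| = 3 * s + 2 by exact: card_low.
    have [|G [HG EG]] := @realize_family n s (clique_family U) _ (clique_nu cU) (clique_matching cU).
      by move=> e; rewrite inE => /andP[/eqP].
    by exists G; split=> //; rewrite EG card_clique_family cU.
  pose S := [set v : 'I_n | v < s].
  have cS : #|S| = s by apply: card_low; move: sn; clear; lia.
  have [|||G [HG EG]] := @realize_family n s (cover_family S).
  - by move=> e; rewrite inE => /andP[/eqP].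
  - by rewrite -cS; exact: cover_nu.
  - by rewrite -cS; apply: cover_matching; rewrite cS card_ord; move: sn; clear; lia.
  by exists G; split=> //; rewrite EG card_cover_family card_ord cS.
split=> // G [HG EG]; have [kG [E mG]] := HG; have [_ eq] := key G HG.
rewrite (card_family kG E) EG muE in eq.
have [[S [cS FS]]|[U [cU FU]]] := eq erefl; [left|right].
- split=> //; exists (to_fset (hV G) S); rewrite to_fset_sub // card_to_fset // cS.
  by split=> //; split=> //; exact: cover_edges.
- split=> //; split=> //; exists (to_fset (hV G) U); rewrite to_fset_sub // card_to_fset // cU.
  split=> //; split; first by clear; lia.
  exact: clique_edges.
Qed.
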